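(* Let $K,K'$ be number fields, let $l> [K':\mathbb{Q}]$ be a prime number, and suppose that $\psi$ is an element of $\textup{Hom}_{L\textup{-series}}(\check{G}_{K}[l], \check{G}_{K'}[l])$. Then $\psi \in \textup{Hom}^\delta_{\mathcal{P}}(\check{G}_{K}[l], \check{G}_{K'}[l])$.
   Context: $\check{G}_{K}$ is the group of Dirichlet characters (continuous homomorphisms $G_K\to\mathbb{C}^\times$), $\check{G}_{K}[l]$ the subgroup generated by characters of order $l$; $\chi(\mathfrak p)=\chi(\mathrm{Frob}_{\mathfrak p})$ for unramified $\mathfrak p$, $0$ otherwise; $L_p(\chi,T)=\prod_{\mathfrak p\mid p}(1-\chi(\mathfrak p)T^{f_{\mathfrak p}})$, $f_{\mathfrak p}$ the inertia degree. $\textup{Hom}_{L\textup{-series}}(\check{G}_{K}[l], \check{G}_{K'}[l])$: group homomorphisms $\psi$ with $L_p(\chi,T)\mid L_p(\psi(\chi),T)$ for all rational primes $p$ and all $\chi$. $\textup{Hom}^\delta_{\mathcal{P}}(\check{G}_{K}[l], \check{G}_{K'}[l])$: group homomorphisms $\psi$ for which there exist a density-one set $\mathcal S$ inside the set $\mathcal P^{(1)}_K$ of unramified degree-one primes of $K$ and a map $\phi\colon\mathcal P^{(1)}_K\to\mathcal P_{K'}$ with $\mathfrak p\cap\mathbb{Z}=\phi(\mathfrak p)\cap\mathbb{Z}$ and $\psi(\chi)(\phi(\mathfrak p))=\chi(\mathfrak p)^{f_{\phi(\mathfrak p)}}$ for all $\mathfrak p\in\mathcal S$ and $\chi$ unramified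 at $\mathfrak p$. *)

(* Defs.v *)
From HB Require Import structures.
From mathcomp Require Import all_boot all_order all_algebra all_field.
From mathcomp Require Import ring_quotient complex.
From mathcomp Require Import all_classical all_reals all_analysis.

Set Implicit Arguments.
Unset Strict Implicit.
Unset Printing Implicit Defensive.

Import Order.TTheory GRing.Theory Num.Theory.
Import numFieldNormedType.Exports.

Local Open Scope classical_set_scope.
Local Open Scope ring_scope.

Definition integral_elements (F : fieldType) : {pred F} :=
  fun x => `[< integralOver (intr : int -> F) x >].
Arguments integral_elements F : clear implicits.

Lemma integral_elements_subring (F : fieldType) :
  subring_closed (integral_elements F).
Proof.
split=> [|x y /asboolP xI /asboolP yI|x y /asboolP xI /asboolP yI];
  apply/asboolP.
- exact: integral1.
- exact: integral_sub.
- exact: integral_mul.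
Qed.

HB.instance Definition _ (F : fieldType) :=
  GRing.isSubringClosed.Build F (integral_elements F)
    (integral_elements_subring F).

Record ring_of_integers (F : fieldType) := RingOfIntegers {
  int_val :> F;
  int_valP : int_val \in integral_elements F
}.

HB.instance Definition _ (F : fieldType) :=
  [isSub for @int_val F].
HB.instance Definition _ (F : fieldType) :=
  [Choice of ring_of_integers F by <:].
HB.instance Definition _ (F : fieldType) :=
  [SubChoice_isSubComNzRing of ring_of_integers F by <:].

Lemma int_map_subproof (F E : fieldType) (f : {rmorphism F -> E})
    (x : ring_of_integers F) :
  f (int_val x) \in integral_elements E.
Proof.
case: x => x /= /asboolP [p pm px]; apply/asboolP; exists p => //.
suff -> : map_poly (intr : int -> E) p = map_poly f (map_poly intr p).
  by rewrite fmorph_root.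
by rewrite -map_poly_comp; apply: eq_map_poly => z /=; rewrite rmorph_int.
Qed.

Definition int_map (F E : fieldType) (f : {rmorphism F -> E})
    (x : ring_of_integers F) : ring_of_integers E :=
  RingOfIntegers (int_map_subproof f x).

Record prime_of (F : fieldType) := PrimeOf {
  prime_ideal :> ring_of_integers F -> bool;
  prime_idealP : idealr_closed prime_ideal;
  prime_prime : prime_idealr_closed prime_ideal;
  prime_neq0 : exists2 x, x \in prime_ideal & x != 0
}.

HB.instance Definition _ (F : fieldType) := gen_eqMixin (prime_of F).
HB.instance Definition _ (F : fieldType) := gen_choiceMixin (prime_of F).

HB.instance Definition _ (F : fieldType) (P : prime_of F) :=
  isIdealr.Build (ring_of_integers F) (prime_ideal P) (prime_idealP P).
HB.instance Definition _ (F : fieldType) (P : prime_of F) :=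
  isPrimeIdealrClosed.Build (ring_of_integers F) (prime_ideal P)
    (@prime_prime F P).

Definition residue_field (F : fieldType) (P : prime_of F) :=
  {ideal_quot (prime_ideal P : prime_idealr (ring_of_integers F))}.

HB.instance Definition _ (F : fieldType) (P : prime_of F) :=
  GRing.ComNzRing.on (residue_field P).

Definition contraction_to_int (F : fieldType) (P : prime_of F) : set int :=
  [set z | (z%:~R : ring_of_integers F) \in prime_ideal P].

Definition lies_above (F : fieldType) (P : prime_of F) (p : nat) : Prop :=
  (p%:R : ring_of_integers F) \in prime_ideal P.

Definition residue_char (F : fieldType) (P : prime_of F) : nat :=
  xget 0%N [set p | prime p /\ lies_above P p].

(** The residue field has an ['F_p]-basis with [f] elements. *)
Definition residue_dim (F : fieldType) (P : prime_of F) (f : nat) : Prop :=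
  exists b : 'I_f -> residue_field P, forall x : residue_field P,
    exists! c : {ffun 'I_f -> 'F_(residue_char P)},
      x = \sum_(i < f) (c i : nat)%:R * b i.

Definition inertia_degree (F : fieldType) (P : prime_of F) : nat :=
  xget 0%N [set f | residue_dim P f].

Definition prime_norm (F : fieldType) (P : prime_of F) : nat :=
  (residue_char P ^ inertia_degree P)%N.

Definition ideal_power (F : fieldType) (P : prime_of F) (n : nat) :
    set (ring_of_integers F) :=
  [set x | exists (m : nat) (r : 'I_m -> ring_of_integers F)
     (a : 'I_m -> 'I_n -> ring_of_integers F),
     (forall i j, a i j \in prime_ideal P) /\
     x = \sum_(i < m) r i * \prod_(j < n) a i j].

Definition ramification_index (F : fieldType) (P : prime_of F) : nat :=
  xget 0%N [set e | ideal_power P e (residue_char P)%:R /\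
                    ~ ideal_power P e.+1 (residue_char P)%:R].

Definition degree_one_primes (F : fieldType) : set (prime_of F) :=
  [set P | inertia_degree P = 1%N /\ ramification_index P = 1%N].
Arguments degree_one_primes F : clear implicits.

(** Dirichlet density:
    [sum_(P in S) N(P)^-s / sum_P N(P)^-s --> d] as [s] tends to [1+]. *)
Definition prime_zeta (R : realType) (F : fieldType) (S : set (prime_of F))
    (s : R) : R :=
  fine (\esum_(P in S) ((prime_norm P)%:R `^ (- s))%:E)%E.

Definition has_density (R : realType) (F : fieldType) (S : set (prime_of F))
    (d : R) : Prop :=
  (prime_zeta S s / prime_zeta [set: prime_of F] s) @[s --> (1 : R)^'+] --> d.

Section AbsoluteGaloisGroup.
Variables (K L : fieldType) (iota : {rmorphism K -> L}).

Definition is_automorphism_over (s : L -> L) : Prop :=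
  [/\ zmod_morphism s, monoid_morphism s, bijective s &
      forall x, s (iota x) = iota x].

Record galois_group := GaloisElement {
  gal_fun :> L -> L;
  gal_funP : is_automorphism_over gal_fun
}.

HB.instance Definition _ := gen_eqMixin galois_group.
HB.instance Definition _ := gen_choiceMixin galois_group.

HB.instance Definition _ (s : galois_group) :=
  GRing.isZmodMorphism.Build L L (gal_fun s)
    (let: And4 h _ _ _ := gal_funP s in h).
HB.instance Definition _ (s : galois_group) :=
  GRing.isMonoidMorphism.Build L L (gal_fun s)
    (let: And4 _ h _ _ := gal_funP s in h).

Lemma gal_ext (s t : galois_group) : gal_fun s =1 gal_fun t -> s = t.
Proof.
case: s t => [s sP] [t tP] /= /funext st.
by case: _ / st tP => tP; congr GaloisElement; exact: Prop_irrelevance.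
Qed.

Lemma gal_bij (s : galois_group) : bijective (gal_fun s).
Proof. by have [] := gal_funP s. Qed.

Lemma gal_fix (s : galois_group) x : s (iota x) = iota x.
Proof. by have [] := gal_funP s. Qed.

Lemma gal_one_subproof : is_automorphism_over id.
Proof. by split=> //; exists id. Qed.

Lemma gal_mul_subproof (s t : galois_group) : is_automorphism_over (s \o t).
Proof.
split.
- by move=> x y /=; rewrite !rmorphB.
- by split=> [|x y] /=; rewrite ?rmorph1 ?rmorphM.
- exact: bij_comp (gal_bij s) (gal_bij t).
- by move=> x /=; rewrite !gal_fix.
Qed.

Lemma gal_inv_ex (s : galois_group) :
  exists t : L -> L, cancel s t /\ cancel t s.
Proof. by have [t] := gal_bij s; exists t. Qed.

Definition gal_inv_fun (s : galois_group) : L -> L :=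
  projT1 (cid (gal_inv_ex s)).

Lemma gal_invK (s : galois_group) : cancel s (gal_inv_fun s).
Proof. by rewrite /gal_inv_fun; case: cid => t []. Qed.

Lemma gal_Kinv (s : galois_group) : cancel (gal_inv_fun s) s.
Proof. by rewrite /gal_inv_fun; case: cid => t []. Qed.

Lemma gal_inv_subproof (s : galois_group) :
  is_automorphism_over (gal_inv_fun s).
Proof.
split.
- by move=> x y; apply: (can_inj (gal_invK s)); rewrite rmorphB /= !gal_Kinv.
- split=> [|x y]; apply: (can_inj (gal_invK s)).
    by rewrite rmorph1 gal_Kinv.
  by rewrite rmorphM /= !gal_Kinv.
- by exists s; [exact: gal_Kinv|exact: gal_invK].
- by move=> x; rewrite -{1}(gal_fix s x) gal_invK.
Qed.

Definition gal_one := GaloisElement gal_one_subproof.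
Definition gal_mul s t := GaloisElement (gal_mul_subproof s t).
Definition gal_inv s := GaloisElement (gal_inv_subproof s).

Lemma gal_mulA : associative gal_mul.
Proof. by move=> s t u; apply: gal_ext. Qed.
Lemma gal_mul1 : left_id gal_one gal_mul.
Proof. by move=> s; apply: gal_ext. Qed.
Lemma gal_1mul : right_id gal_one gal_mul.
Proof. by move=> s; apply: gal_ext. Qed.
Lemma gal_mulV : left_inverse gal_one gal_inv gal_mul.
Proof. by move=> s; apply: gal_ext => x; exact: gal_invK. Qed.
Lemma gal_Vmul : right_inverse gal_one gal_inv gal_mul.
Proof. by move=> s; apply: gal_ext => x; exact: gal_Kinv. Qed.

HB.instance Definition _ := isGroup.Build galois_group
  gal_mulA gal_mul1 gal_1mul gal_mulV gal_Vmul.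

(** Krull topology: the automorphisms agreeing with [s] on a given finite
    subset of [L] form a basis of neighbourhoods of [s]. *)
Definition krull_nbhs (s : galois_group) (A : set galois_group) : Prop :=
  exists e : seq L, forall t : galois_group, {in e, t =1 s} -> A t.

HB.instance Definition _ := hasNbhs.Build galois_group krull_nbhs.

Lemma krull_nbhs_filter (s : galois_group) : ProperFilter (nbhs s).
Proof.
split; first by case=> e; move/(_ s) => H; apply: H.
split; first by exists [::].
- move=> A B [e eA] [f fB]; exists (e ++ f) => t tef.
  by split; [apply: eA|apply: fB] => x xe; apply: tef;
    rewrite mem_cat xe ?orbT.
- by move=> A B AB [e eA]; exists e => t /eA /AB.
Qed.

Lemma krull_nbhs_singleton (s : galois_group) A : nbhs s A -> A s.
Proof. by case=> e; apply. Qed.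

Lemma krull_nbhs_nbhs (s : galois_group) A : nbhs s A -> nbhs s (nbhs^~ A).
Proof.
case=> e eA; exists e => t ts; exists e => u ut.
by apply: eA => x xe; rewrite ut// ts.
Qed.

HB.instance Definition _ := Nbhs_isNbhsTopological.Build galois_group
  krull_nbhs_filter krull_nbhs_singleton krull_nbhs_nbhs.

End AbsoluteGaloisGroup.

Section DirichletCharacters.
Variables (R : realType) (K L : fieldType) (iota : {rmorphism K -> L}).
Local Notation G_K := (galois_group iota).

(* [R[i]^o] carries the usual topology of the complex numbers. *)
Definition is_dirichlet_character (chi : G_K -> R[i]) : Prop :=
  [/\ forall s, chi s != 0,
      {morph chi : s t / (s * t)%g >-> s * t} &
      continuous (chi : G_K -> R[i]^o)].

Record dirichlet_character := DirichletCharacter {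
  char_fun :> G_K -> R[i];
  char_funP : is_dirichlet_character char_fun
}.

HB.instance Definition _ := gen_eqMixin dirichlet_character.
HB.instance Definition _ := gen_choiceMixin dirichlet_character.

Lemma char_ext (chi psi : dirichlet_character) :
  char_fun chi =1 char_fun psi -> chi = psi.
Proof.
case: chi psi => [s sP] [t tP] /= /funext st.
by case: _ / st tP => tP; congr DirichletCharacter; exact: Prop_irrelevance.
Qed.

Lemma char_neq0 (chi : dirichlet_character) s : chi s != 0.
Proof. by have [] := char_funP chi. Qed.

Lemma char_one_subproof : is_dirichlet_character (fun=> 1).
Proof.
split=> [s|s t|]; rewrite ?oner_neq0 ?mulr1//.
exact: (@cst_continuous G_K R[i]^o 1).
Qed.

Lemma char_mul_subproof (chi psi : dirichlet_character) :
  is_dirichlet_character (fun s => chi s * psi s).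
Proof.
have [chi0 chiM chiC] := char_funP chi; have [psi0 psiM psiC] := char_funP psi.
split=> [s|s t|s]; rewrite ?mulf_neq0//.
  by rewrite chiM psiM mulrACA.
exact: (@cvgM R[i] _ (nbhs s) _ (chi : G_K -> R[i]^o) (psi : G_K -> R[i]^o)
  _ _ (chiC s) (psiC s)).
Qed.

Lemma char_inv_subproof (chi : dirichlet_character) :
  is_dirichlet_character (fun s => (chi s)^-1).
Proof.
have [chi0 chiM chiC] := char_funP chi.
split=> [s|s t|s]; rewrite ?invr_neq0//.
  by rewrite chiM invfM.
exact: (@cvgV R[i] _ (nbhs s) _ (chi : G_K -> R[i]^o) _ (chi0 s) (chiC s)).
Qed.

Definition char_one := DirichletCharacter char_one_subproof.
Definition char_mul chi psi := DirichletCharacter (char_mul_subproof chi psi).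
Definition char_inv chi := DirichletCharacter (char_inv_subproof chi).

Lemma char_mulA : associative char_mul.
Proof. by move=> a b c; apply: char_ext => s /=; rewrite mulrA. Qed.
Lemma char_mul1 : left_id char_one char_mul.
Proof. by move=> a; apply: char_ext => s /=; rewrite mul1r. Qed.
Lemma char_1mul : right_id char_one char_mul.
Proof. by move=> a; apply: char_ext => s /=; rewrite mulr1. Qed.
Lemma char_mulV : left_inverse char_one char_inv char_mul.
Proof.
by move=> a; apply: char_ext => s /=; rewrite mulVf// char_neq0.
Qed.
Lemma char_Vmul : right_inverse char_one char_inv char_mul.
Proof.
by move=> a; apply: char_ext => s /=; rewrite mulfV// char_neq0.
Qed.

HB.instance Definition _ := isGroup.Build dirichlet_character
  char_mulA char_mul1 char_1mul char_mulV char_Vmul.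

(** Here [L] is an algebraic closure of [K], and primes of [L] are the nonzero
    prime ideals of the ring of all algebraic integers in [L]. *)
Definition lies_over (Q : prime_of L) (P : prime_of K) : Prop :=
  forall x : ring_of_integers K,
    (int_map iota x \in prime_ideal Q) = (x \in prime_ideal P).

Definition inertia_group (Q : prime_of L) : set G_K :=
  [set s | forall x : ring_of_integers L, int_map s x - x \in prime_ideal Q].

Definition is_frobenius (Q : prime_of L) (P : prime_of K) (s : G_K) : Prop :=
  lies_over Q P /\
  forall x : ring_of_integers L,
    int_map s x - x ^+ prime_norm P \in prime_ideal Q.

Definition char_unramified (chi : dirichlet_character) (P : prime_of K) :
    Prop :=
  forall (Q : prime_of L) (s : G_K),
    lies_over Q P -> inertia_group Q s -> chi s = 1.

(** [xget] picks the value of an unramified [chi] at a Frobenius element (all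
    these elements give the same value), and returns [0] on the empty set,
    that is when [chi] is ramified at [P]. *)
Definition char_at (chi : dirichlet_character) (P : prime_of K) : R[i] :=
  xget 0 [set z | char_unramified chi P /\
                  exists Q s, is_frobenius Q P s /\ z = chi s].

Definition L_factor (p : nat) (chi : dirichlet_character) : {poly R[i]} :=
  \big[*%R/1]_(P \in [set P : prime_of K | lies_above P p])
    (1 - (char_at chi P) *: 'X^(inertia_degree P)).

End DirichletCharacters.

Definition has_order (G : groupType) (l : nat) (x : G) : Prop :=
  [/\ (0 < l)%N, (x ^+ l = 1)%g &
      forall m, (0 < m < l)%N -> (x ^+ m <> 1)%g].

Definition generated_subgroup (G : groupType) (A : set G) : {pred G} :=
  fun x => `[< forall H : {pred G},
                 group_closed H -> (forall a, A a -> a \in H) -> x \in H >].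

Lemma generated_subgroup_closed (G : groupType) (A : set G) :
  group_closed (generated_subgroup A).
Proof.
split=> [|x y /asboolP xA /asboolP yA]; apply/asboolP => H HG AH.
  by case: HG.
by case: (HG) => _; apply; [exact: xA|exact: yA].
Qed.

Section OrderPart.
Variables (R : realType) (K L : fieldType) (iota : {rmorphism K -> L}).
Variable l : nat.

Definition order_part : {pred dirichlet_character R iota} :=
  generated_subgroup [set chi | has_order l chi].

Record order_part_group := OrderPart {
  order_part_val :> dirichlet_character R iota;
  order_part_valP : order_part_val \in order_part
}.

HB.instance Definition _ := [isSub for order_part_val].
HB.instance Definition _ := [Choice of order_part_group by <:].
HB.instance Definition _ :=
  SubChoice_isSubGroup.Build (dirichlet_character R iota) order_part
    order_part_group (generated_subgroup_closed _).

End OrderPart.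

Arguments order_part_group R {K L} iota l.

Section Homomorphisms.
Variables (R : realType) (K L : fieldType) (iota : {rmorphism K -> L}).
Variables (K' L' : fieldType) (iota' : {rmorphism K' -> L'}) (l : nat).

Local Notation hom :=
  {multiplicative order_part_group R iota l -> order_part_group R iota' l}.

Definition Hom_L_series : set hom :=
  [set psi : hom | forall p, prime p -> forall chi : order_part_group R iota l,
     L_factor p chi %| L_factor p (psi chi)].

Definition Hom_density : set hom :=
  [set psi : hom | exists S : set (prime_of K),
     [/\ S `<=` degree_one_primes K, has_density S (1 : R) &
       exists phi : degree_one_primes K -> prime_of K',
       forall P : degree_one_primes K, S (val P) ->
         contraction_to_int (val P) = contraction_to_int (phi P) /\
         forall chi : order_part_group R iota l, char_unramified chi (val P) ->
           char_at (psi chi) (phi P) =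
           char_at chi (val P) ^+ inertia_degree (phi P)]].

End Homomorphisms.

Arguments Hom_L_series R {K L} iota {K' L'} iota' l psi.
Arguments Hom_density R {K L} iota {K' L'} iota' l psi.

(* Main.v *)
(** Let [P] be an unramified prime of [K] of degree one over [p], with Frobenius
    element [s].  The divisibility [L_p(chi, T) | L_p(psi chi, T)], evaluated at
    [chi(P)^-1], shows that every [chi] unramified at [P] satisfies
    [(psi chi)(P') = chi(P) ^ f(P')] for some [P'] over [p].  For fixed [P'] these
    [chi] form a subgroup of a group of exponent [l], and there are at most
    [[K' : Q] < l] such subgroups; since a group of exponent [l] is not a union of
    at most [l] proper subgroups, a single [P'] works for all [chi].

    The degree-one unramified primes have density one because the other primes
    contribute a bounded sum at [s = 1], while [sum N(P)^-1] diverges.  The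
    divergence is proved without the Dedekind zeta function: if the sum were
    finite, a box in a lattice [Z[t]] could not be covered by the primes of large
    norm, the high powers of the small primes and the elements of bounded norm.
    Frobenius elements come from the action of Galois on the polynomial
    [prod_h (Z - h)], [h] running over the orbit of [sum_i y_i T^i], for finitely
    many integers [y_i] at a time, and from the compactness of the Galois group. *)

Require Import Defs.
From HB Require Import structures.
From mathcomp Require Import all_boot all_order all_algebra all_field.
From mathcomp Require Import ring_quotient generic_quotient complex.
From mathcomp Require Import all_classical all_reals all_analysis.
From mathcomp Require Import zify ring lra.
Set Implicit Arguments.
Unset Strict Implicit.
Unset Printing Implicit Defensive.

Import Order.TTheory GRing.Theory Num.Theory.
Import numFieldNormedType.Exports.

Local Open Scope classical_set_scope.
Local Open Scope quotient_scope.
Local Open Scope ring_scope.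

(** Ideals are handled through an order [Z[t]] of rank [n], the degree of the field. The
    discriminant [D] of its trace form multiplies every algebraic integer into [Z[t]], so at a prime
    [p] not dividing [D] congruences pass between the two rings; the norm of [a(t)] is the
    determinant of multiplication by [a(t)] on [Z[t]]. In the covering argument a prime of norm [q]
    catches [O(Y^n / q)] nonzero points of a box of side [Y]: two points of the prime in one small
    cell differ by an element whose norm is a multiple of [q] smaller than [q]. For the two other
    kinds of points only the constant coefficient is varied, since the norm is a monic polynomial in
    it. The subgroup attached to [P'] is defined by values at Frobenius elements and not by
    [char_at], which is [0] at ramified primes and therefore not multiplicative. This is why the
    independence of the Frobenius element, and with it the transitivity of Galois on the primes
    above [P], is proved. *)

Lemma Zorn_above (T : Type) (good : set (set T)) (A0 : set T) :
    good A0 ->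
    (forall F : set (set T), F `<=` good -> F !=set0 -> total_on F subset ->
      good (\bigcup_(X in F) X)) ->
  exists A, [/\ A0 `<=` A, good A & forall B, A `<=` B -> good B -> B = A].
Proof.
move=> goodA0 chain.
pose Pr := [set A | A = set0 \/ good A /\ A0 `<=` A].
have [|A [PA maxA]] := @Zorn_bigcup T Pr.
  move=> F FP totF; pose F' := F `&` [set A | good A /\ A0 `<=` A].
  have -> : \bigcup_(X in F) X = \bigcup_(X in F') X.
    apply/seteqP; split=> x [X FX Xx]; last by exists X => //; case: FX.
    exists X => //; split=> //.
    by case: (FP _ FX) => [X0|//]; rewrite X0 in Xx.
  have [[X F'X]|F'0] := pselect (F' !=set0); last first.
    by left; rewrite -subset0 => x [X F'X _]; case: F'0; exists X.
  right; split.
    apply: chain => [Y [_ []] //| |Y Z [FY _] [FZ _]]; [by exists X|exact: totF].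
  by move=> x A0x; exists X => //; case: F'X => _ []; move=> _ /(_ x); apply.
have PrA0 : Pr A0 by right; split.
case: PA => [A_0|[goodA A0A]].
  have A00 : A0 = set0.
    apply: contrapT => A0n; apply: (maxA A0) => //; rewrite A_0.
    by split=> // sub0; apply: A0n; rewrite -subset0.
  exists A; split; rewrite ?A_0 -?A00// => B _ goodB.
  apply: contrapT => BA; apply: (maxA B).
    split=> [x|sub0]; first by rewrite A_0.
  by apply: BA; rewrite A00 -subset0; move: sub0; rewrite A_0.
  by right; split=> //; rewrite A00; exact: sub0set.
exists A; split=> // B AB goodB; apply: contrapT => BA; apply: (maxA B).
  by split=> // BsubA; apply: BA; apply/seteqP.
by right; split=> //; apply: subset_trans AB.
Qed.

(** * Prime ideals and residue fields *)

Section RingOfIntegers.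
Variable F : fieldType.
Local Notation O := (ring_of_integers F).

Lemma int_val_zmod : zmod_morphism (@int_val F). Proof. by []. Qed.
Lemma int_val_monoid : monoid_morphism (@int_val F). Proof. by []. Qed.

HB.instance Definition _ :=
  GRing.isZmodMorphism.Build O F (@int_val F) int_val_zmod.
HB.instance Definition _ :=
  GRing.isMonoidMorphism.Build O F (@int_val F) int_val_monoid.

Lemma int_val_inj : injective (@int_val F).
Proof. exact: val_inj. Qed.

Lemma int_mul_eq0 (x y : O) : (x * y == 0) = (x == 0) || (y == 0).
Proof.
by rewrite -!(inj_eq int_val_inj) (rmorphM (@int_val F)) !(rmorph0 (@int_val F)) mulf_eq0.
Qed.

Lemma integral_root (x : O) :
  exists2 q : {poly int}, q \is monic & (map_poly intr q).[x] = 0.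
Proof.
have /asboolP [q qm /eqP qx] := int_valP x; exists q => //.
apply: (@val_inj _ _ O); rewrite -[LHS]/(int_val _) -horner_map -map_poly_comp -[RHS]qx.
by congr (_ .[_]); apply: eq_map_poly => z /=; rewrite rmorph_int.
Qed.

(* For [I] a prime ideal, possibly zero: in [O / I] a nonzero element divides
   a nonzero integer, the constant term of an integral equation of minimal
   degree. *)
Lemma dvd_int_mod (I : {pred O}) :
    0 \in I -> 1 \notin I -> {in I &, forall u v, u - v \in I} ->
    (forall u v, u * v \in I -> (u \in I) || (v \in I)) ->
  forall x, x \notin I ->
  exists y c, x * y - c%:~R \in I /\ c%:~R \notin I.
Proof.
move=> I0 I1 IB IP x xI; have [q qm qx] := integral_root x.
have {}qx : (map_poly intr q).[x] \in I by rewrite qx.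
elim/poly_ind: q qm qx => [|q c IHq] qm.
  by move: qm; rewrite monicE lead_coef0 eq_sym oner_eq0.
rewrite rmorphD rmorphM /= map_polyX map_polyC/= !hornerE => qx.
have [cI|cI] := boolP ((c%:~R : O) \in I); last first.
  exists (- (map_poly intr q).[x]), c; split=> //.
  rewrite mulrN -opprD -sub0r mulrC IB//.
have q0 : q != 0.
  apply: contraNneq I1 => q0; move: qm cI; rewrite q0 mul0r add0r monicE.
  by rewrite lead_coefC => /eqP ->.
apply: IHq.
  move: qm; rewrite !monicE lead_coefDl ?lead_coefMX// size_mulX// ltnS.
  by rewrite (leq_trans (size_polyC_leq1 c))// size_poly_gt0.
have : (map_poly intr q).[x] * x \in I by rewrite -(addrK c%:~R (_ * _)) IB.
by move/IP => /orP[//|]; rewrite (negPf xI).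
Qed.

Lemma dvd_int (x : O) : x != 0 ->
  exists y (c : int), x * y = c%:~R /\ (c%:~R : O) != 0.
Proof.
move=> x0; have [||u v|u v||y [c]] := @dvd_int_mod (pred1 0) _ _ _ _ x.
- by rewrite inE.
- by rewrite inE oner_eq0.
- by rewrite !inE => /eqP-> /eqP->; rewrite subr0.
- rewrite !inE => uv0; rewrite -!(inj_eq val_inj)/= -mulf_eq0.
  by move/eqP/(congr1 val): uv0 => /= ->.
- by rewrite inE.
- by rewrite !inE subr_eq0 => -[/eqP xy c0]; exists y, c.
Qed.

Section PrimeOf.
Variable P : prime_of F.

Lemma prime1 : (1 : O) \in prime_ideal P = false.
Proof. exact: idealr1. Qed.

Lemma prime0 : (0 : O) \in prime_ideal P.
Proof. exact: rpred0. Qed.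

Lemma primeM (x y : O) :
  (x * y \in prime_ideal P) = (x \in prime_ideal P) || (y \in prime_ideal P).
Proof. exact: prime_idealrM. Qed.

Lemma primeMr (a x : O) : x \in prime_ideal P -> a * x \in prime_ideal P.
Proof. exact: idealMr. Qed.

Lemma primeMl (a x : O) : x \in prime_ideal P -> x * a \in prime_ideal P.
Proof. by rewrite mulrC; exact: primeMr. Qed.

Lemma primeX (x : O) n :
  (x ^+ n \in prime_ideal P) = (0 < n)%N && (x \in prime_ideal P).
Proof.
elim: n => [|n IHn]; first by rewrite expr0 prime1.
by rewrite exprS primeM IHn /=; case: (x \in _) => //=; rewrite andbF.
Qed.

Lemma prime_prod (I : Type) (r : seq I) (p : pred I) (f : I -> O) :
  \prod_(i <- r | p i) f i \in prime_ideal P ->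
  exists2 i, p i & f i \in prime_ideal P.
Proof.
elim: r => [|i r IHr]; first by rewrite big_nil prime1.
rewrite big_cons; case: ifP => pi //; rewrite primeM => /orP[fi|//].
by exists i.
Qed.

Lemma prime_dvd_int (x : O) : x \notin prime_ideal P ->
  exists y (c : int), x * y - c%:~R \in prime_ideal P /\
    (c%:~R : O) \notin prime_ideal P.
Proof.
apply: dvd_int_mod; rewrite ?prime0 ?prime1//.
  by move=> u v uP vP; rewrite rpredB.
by move=> u v; rewrite primeM.
Qed.

Lemma lies_above_prime_dvd (n : nat) : (0 < n)%N ->
  (n%:R : O) \in prime_ideal P -> exists2 p, prime p & lies_above P p.
Proof.
elim/ltn_ind: n => n IHn n0 nP.
have n1 : (1 < n)%N.
  by move: n0; rewrite leq_eqVlt => /orP[/eqP n1|//]; rewrite -n1 prime1 in nP.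
have [p p_pr pn] : exists2 p, prime p & (p %| n)%N.
  by exists (pdiv n); [exact: pdiv_prime|exact: pdiv_dvd].
have nE : n = ((n %/ p) * p)%N by rewrite divnK.
move: nP; rewrite nE natrM primeM => /orP[|pP]; last by exists p.
apply: IHn; first by rewrite ltn_Pdiv// prime_gt1.
by rewrite divn_gt0 ?prime_gt0// dvdn_leq.
Qed.

Lemma prime_over_prime : exists2 p, prime p & lies_above P p.
Proof.
have [x xP x0] := prime_neq0 P; have [y [c [xy c0]]] := dvd_int x0.
apply: (@lies_above_prime_dvd `|c|%N).
  by rewrite absz_gt0; apply: contra_neq c0 => ->.
have cP : (c%:~R : O) \in prime_ideal P by rewrite -xy primeMl.
by move: cP; case: (intP c) => [|n|n]; rewrite ?mulrNz ?opprK ?abszN ?rpredN.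
Qed.

Lemma prime_intE (p : nat) (z : int) : prime p -> lies_above P p ->
  ((z%:~R : O) \in prime_ideal P) = (p %| z)%Z.
Proof.
move=> p_pr pP; apply/idP/idP => [zP|/dvdzP[q ->]]; last first.
  by rewrite intrM primeMr.
apply: contraT => pz; have : coprimez p z.
  by rewrite /coprimez /gcdz eqz_nat -[_ == _]/(coprime _ _) prime_coprime.
move=> /coprimezP[[u v] /= uv].
have : ((u * p + v * z)%:~R : O) \in prime_ideal P.
  by rewrite rmorphD !rmorphM/= rpredD// primeMr.
by rewrite uv prime1.
Qed.

Lemma prime_natE (p n : nat) : prime p -> lies_above P p ->
  ((n%:R : O) \in prime_ideal P) = (p %| n)%N.
Proof. exact: (@prime_intE p n). Qed.

Lemma lies_above_uniq (p q : nat) : prime p -> prime q ->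
  lies_above P p -> lies_above P q -> p = q.
Proof.
move=> p_pr q_pr pP qP; apply/eqP; rewrite -dvdn_prime2// -(prime_natE q p_pr pP).
exact: qP.
Qed.

Lemma residue_charP : prime (residue_char P) /\ lies_above P (residue_char P).
Proof.
rewrite /residue_char; case: xgetP => [p _ //|H].
by have [p p_pr pP] := prime_over_prime; case: (H p).
Qed.

Lemma residue_char_prime : prime (residue_char P).
Proof. exact: residue_charP.1. Qed.

Lemma residue_char_eq (p : nat) : prime p -> lies_above P p ->
  residue_char P = p.
Proof. by have [? ?] := residue_charP; move=> ? ?; apply: lies_above_uniq. Qed.

Lemma prime_residue_charE (z : int) :
  ((z%:~R : O) \in prime_ideal P) = (residue_char P %| z)%Z.
Proof. by have [? ?] := residue_charP; apply: prime_intE. Qed.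

Lemma int_inv_mod (p : nat) (c : int) : prime p -> ~~ (p %| c)%Z ->
  exists u, (p %| u * c - 1)%Z.
Proof.
move=> p_pr pc; have : coprimez p c.
  by rewrite /coprimez /gcdz eqz_nat -[_ == _]/(coprime _ _) prime_coprime.
move=> /coprimezP[[u v] /= uv]; exists v.
have -> : v * c - 1 = - u * p by rewrite -uv; ring.
by rewrite dvdz_mull.
Qed.

(** Modulo [P], an element outside [P] divides an integer that [p] does not divide, and such an
    integer is invertible modulo [p]. *)
Lemma prime_maximal (x : O) : x \notin prime_ideal P ->
  exists y, x * y - 1 \in prime_ideal P.
Proof.
move=> /prime_dvd_int[y [c [xy]]]; rewrite prime_residue_charE => pc.
have [u] := int_inv_mod residue_char_prime pc.
rewrite -prime_residue_charE rmorphB rmorphM/= => uc.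
exists (y * u%:~R); rewrite mulrA.
have -> : x * y * u%:~R - 1 =
    (x * y - c%:~R) * u%:~R + (u%:~R * c%:~R - 1) :> O by ring.
by rewrite rpredD// primeMl.
Qed.

End PrimeOf.

Lemma prime_of_ext (P Q : prime_of F) :
  (forall x, (x \in prime_ideal P) = (x \in prime_ideal Q)) -> P = Q.
Proof.
case: P Q => [P P1 P2 P3] [Q Q1 Q2 Q3] /= PQ.
have {}PQ : P = Q by apply/funext => x; exact: PQ.
by case: _ / PQ Q1 Q2 Q3 => Q1 Q2 Q3; congr PrimeOf; exact: Prop_irrelevance.
Qed.

Lemma prime_of_sub (P Q : prime_of F) :
  (forall x, x \in prime_ideal P -> x \in prime_ideal Q) -> P = Q.
Proof.
move=> PQ; apply: prime_of_ext => x; apply/idP/idP => [/PQ//|xQ].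
apply: contraT => /prime_maximal[y /PQ].
move=> xyQ; have : x * y - (x * y - 1) \in prime_ideal Q by rewrite rpredB// primeMl.
by rewrite opprB addrC subrK prime1.
Qed.

(** Krull's argument: an ideal maximal among those that contain [I0] and avoid the multiplicative
    set [S] is prime. The last clause records the maximality, for use in [lies_over_exists]; with
    [S] reduced to [1] the lemma gives a prime over a proper ideal. *)
Lemma exists_prime_avoiding (I0 S : {pred O}) :
    0 \in I0 -> {in I0 &, forall x y, x - y \in I0} ->
    (forall a, {in I0, forall x, a * x \in I0}) ->
    1 \in S -> {in S &, forall x y, x * y \in S} ->
    (forall x, x \in I0 -> x \notin S) ->
  exists Q : O -> bool, [/\ idealr_closed Q, prime_idealr_closed Q,
    (forall x, x \in I0 -> x \in Q), (forall x, x \in Q -> x \notin S) &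
    forall u, u \notin Q -> exists a b, a \in Q /\ a + b * u \in S].
Proof.
move=> I00 I0B I0M S1 SM I0S.
pose good := [set A : set O | [/\ A 0, (forall x y, A x -> A y -> A (x - y)),
  (forall a x, A x -> A (a * x)) & forall x, A x -> x \notin S]].
have [||A [I0A [A0 AB AM AS] Amax]] := @Zorn_above O good [set x | x \in I0].
- by split=> [//|x y|a x|x]; [exact: I0B|exact: I0M|exact: I0S].
- move=> C Cg [X CX] tot; split.
  + by exists X => //; case: (Cg _ CX).
  + move=> x y [Y CY Yx] [Z CZ Zy].
    have [_ YB _ _] := Cg _ CY; have [_ ZB _ _] := Cg _ CZ.
    by have [YZ|ZY] := tot _ _ CY CZ; [exists Z => //; apply: ZB => //; exact: YZ|
      exists Y => //; apply: YB => //; exact: ZY].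
  + by move=> a x [Y CY Yx]; exists Y => //; have [_ _ YM _] := Cg _ CY; exact: YM.
  + by move=> x [Y CY Yx]; have [_ _ _] := Cg _ CY; exact.
have AD x y : A x -> A y -> A (x + y).
  by move=> Ax Ay; rewrite -[y]opprK; apply: (AB) => //; rewrite -sub0r; exact: AB.
have adjoin u : ~ A u -> exists a b, A a /\ a + b * u \in S.
  move=> Au; apply: contrapT => H; apply: Au.
  rewrite -(Amax [set x | exists a b, A a /\ x = a + b * u]).
  - by exists 0, 1; rewrite add0r mul1r.
  - by move=> x Ax; exists x, 0; rewrite mul0r addr0.
  split.
  - by exists 0, 0; rewrite mul0r addr0.
  - move=> _ _ [a [b [Aa ->]]] [a' [b' [Aa' ->]]]; exists (a - a'), (b - b').
    by split; [exact: AB|ring].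
  - move=> c _ [a [b [Aa ->]]]; exists (c * a), (c * b).
    by split; [exact: AM|ring].
  - by move=> _ [a [b [Aa ->]]]; apply/negP => ?; apply: H; exists a, b.
exists (fun x => `[< A x >]); split.
- split; [exact/asboolP| |].
    by apply/negP => /asboolP /AS; rewrite S1.
  by move=> a u v /asboolP uA /asboolP vA; apply/asboolP/AD => //; exact: AM.
- move=> u v /asboolP uv; apply/orP.
  have [/asboolP|uA] := pselect (A u); first by left.
  have [/asboolP|vA] := pselect (A v); first by right.
  have [a [b [Aa Sab]]] := adjoin _ uA; have [c [d [Ac Scd]]] := adjoin _ vA.
  have : A ((a + b * u) * (c + d * v)).
    have -> : (a + b * u) * (c + d * v) = (c + d * v) * a + b * u * c + (b * d) * (u * v).
      by ring.
    by apply: (AD); [apply: (AD); apply: (AM)|apply: (AM)].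
  by move/AS; rewrite SM.
- by move=> x /I0A Ax; exact/asboolP.
- by move=> x /asboolP /AS.
- move=> u /asboolP /adjoin[a [b [Aa Sab]]]; exists a, b.
  by split=> //; apply/asboolP.
Qed.

End RingOfIntegers.

Lemma common_denominator (I : finType) (k : I -> rat) :
  exists d : int, d != 0 /\ exists c : I -> int, forall i, d%:~R * k i = (c i)%:~R.
Proof.
exists (\prod_i denq (k i)); split.
  by apply/prodf_neq0 => i _; exact: denq_neq0.
exists (fun i => (\prod_(j | j != i) denq (k j)) * numq (k i)) => i.
rewrite (bigD1 i)//= rmorphM/= [_%:~R * _]mulrC -mulrA.
rewrite rmorphM/=; congr (_ * _).
by rewrite -[X in _ * X]divq_num_den mulrCA divff ?intr_eq0 ?denq_neq0// mulr1.
Qed.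

Lemma dvdz_exp_eq0 (p : nat) (z : int) : (1 < p)%N ->
  (forall k, ((p ^ k)%N %| z)%Z) -> z = 0.
Proof.
move=> p1 pz; apply/eqP; rewrite -absz_eq0; apply: contraT; rewrite -lt0n => z0.
have := dvdn_leq z0 (pz `|z|%N); rewrite leqNgt.
by rewrite ltn_expl.
Qed.

Lemma pi_residue_eq0 (F : fieldType) (Q : prime_of F) (x : ring_of_integers F) :
  ((\pi_(residue_field Q) x : residue_field Q) == 0) = (x \in prime_ideal Q).
Proof. by rewrite -(rmorph0 (\pi_(residue_field Q))) -Quotient.idealrBE subr0. Qed.

(** * Rank bounds from congruences modulo [p] *)

Section NumberField.
Variable K : fieldExtType rat.
Local Notation O := (ring_of_integers K).
Local Notation n := (\dim {:K}).

Lemma intr_alg (z : int) : (z%:~R : rat)%:A = z%:~R :> K.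
Proof. by rewrite -(rmorph_int (in_alg K)). Qed.

Lemma intr_K_eq0 (z : int) : ((z%:~R : K) == 0) = (z == 0).
Proof. by rewrite -intr_alg scaler_eq0 oner_eq0 orbF intr_eq0. Qed.

Lemma intr_O_eq0 (z : int) : ((z%:~R : O) == 0) = (z == 0).
Proof. rewrite -intr_K_eq0 -(rmorph_int (@int_val K)) -(rmorph0 (@int_val K)).
by rewrite (inj_eq val_inj). Qed.

Lemma natr_O_eq0 (m : nat) : ((m%:R : O) == 0) = (m == 0%N).
Proof. by rewrite pmulrn intr_O_eq0. Qed.

Lemma scale_intr (z : int) (x : K) : (z%:~R : rat) *: x = z%:~R * x.
Proof. by rewrite -intr_alg mulr_algl. Qed.

(* A relation of minimal size would have a coefficient prime to [p], so an
   integral descent bounds the number of elements by the dimension. *)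
Lemma free_mod_leq_dim (p m : nat) (x : 'I_m -> K) : (1 < p)%N ->
    (forall c : 'I_m -> int, \sum_i (c i)%:~R * x i = 0 ->
       forall i, (p %| c i)%Z) ->
  (m <= n)%N.
Proof.
move=> p1 Hx.
have {Hx} Hk k (c : 'I_m -> int) : \sum_i (c i)%:~R * x i = 0 ->
    forall i, ((p ^ k)%N %| c i)%Z.
  elim: k c => [|k IHk] c c0 i; first by rewrite expn0 dvd1z.
  pose d i := (c i %/ p)%Z.
  have cE j : c j = d j * p by rewrite /d divzK// Hx.
  rewrite cE expnSr PoszM dvdz_mul//; apply: IHk.
  apply: (@mulfI _ (p%:~R : K)); first by rewrite intr_K_eq0; case: (p) p1.
  rewrite mulr0 mulr_sumr -[RHS]c0; apply: eq_bigr => j _.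
  by rewrite cE rmorphM/= mulrA [_ * (d j)%:~R]mulrC.
have {Hk} Hk (c : 'I_m -> int) : \sum_i (c i)%:~R * x i = 0 ->
    forall i, c i = 0.
  by move=> c0 i; apply: (@dvdz_exp_eq0 p) => // k; exact: Hk.
have : free [tuple x i | i < m].
  apply/freeP => k; rewrite (eq_bigr (fun i => k i *: x i)); last first.
    by move=> i _; rewrite -tnth_nth tnth_mktuple.
  move=> kx0 i; have [d [d0 [c cE]]] := common_denominator k.
  suff : (c i)%:~R = 0 :> rat.
    by rewrite -cE => /eqP; rewrite mulf_eq0 intr_eq0 (negPf d0) => /eqP.
  rewrite Hk//; transitivity (d%:~R * \sum_i k i *: x i); last by rewrite kx0 mulr0.
  rewrite mulr_sumr; apply: eq_bigr => j _.
  by rewrite -!scale_intr -cE scalerA.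
rewrite /free size_tuple => /eqP <-; exact: dimvS (subvf _).
Qed.

Lemma free_mod_leq_dim_O (p m : nat) (x : 'I_m -> O) : (1 < p)%N ->
    (forall c : 'I_m -> int, \sum_i (c i)%:~R * x i = 0 ->
       forall i, (p %| c i)%Z) ->
  (m <= n)%N.
Proof.
move=> p1 Hx; apply: (free_mod_leq_dim (x := fun i => int_val (x i)) p1).
move=> c c0; apply: Hx; apply: val_inj; rewrite -[RHS]c0 -[LHS]/(int_val _).
by rewrite rmorph_sum; apply: eq_bigr => i _; rewrite rmorphM/= rmorph_int.
Qed.

(** As in the Chinese remainder theorem, each prime of [s] gets an element outside it that lies in
    all the others. In a linear relation between these elements every coefficient lies in the prime
    of its index, so [p] divides it, and [free_mod_leq_dim_O] bounds their number. *)
Lemma primes_over_leq_dim (p : nat) (s : seq (prime_of K)) : prime p -> uniq s ->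
  (forall P, P \in s -> lies_above P p) -> (size s <= n)%N.
Proof.
move=> p_pr s_uniq sp; pose P i := tnth (in_tuple s) i.
have Pp i : lies_above (P i) p by apply: sp; rewrite mem_tnth.
have /choice[w wP] : forall ij : 'I_(size s) * 'I_(size s), exists x : O,
    ij.1 != ij.2 -> x \in prime_ideal (P ij.2) /\ x \notin prime_ideal (P ij.1).
  case=> i j /=; apply: contrapT => /forallNP H.
  have Pij : P j = P i.
    apply: prime_of_sub => x xj; apply: contrapT => xi.
    by case: (H x) => ij; split=> //; exact/negP.
  case: (H 0) => /eqP[]; apply/val_inj => /=.
  move: Pij; rewrite /P !(tnth_nth (P i))/= => /eqP.
  by rewrite nth_uniq// => /eqP.
pose e i := \prod_(j | j != i) w (i, j).
apply: (free_mod_leq_dim_O (x := e) (prime_gt1 p_pr)) => c c0 i.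
rewrite -(prime_intE _ p_pr (Pp i)).
have eP : e i \notin prime_ideal (P i).
  apply/negP => /prime_prod[j ji]; apply/negP.
  by have [|_] := wP (i, j); rewrite //= eq_sym.
have : (c i)%:~R * e i \in prime_ideal (P i).
  move/eqP: c0; rewrite (bigD1 i)//= addr_eq0 => /eqP ->.
  rewrite rpredN; apply: rpred_sum => j ji; apply: primeMr.
  rewrite /e (bigD1 i)/=; last by rewrite eq_sym.
  by apply: primeMl; have [] := wP (j, i).
by rewrite primeM (negPf eP) orbF.
Qed.

(** * Integral lifts of bases of residue fields *)

Section Residue.
Variable P : prime_of K.
Local Notation p := (residue_char P).
Local Notation k := (residue_field P).

(** Lifts to [O] of an [F_p]-basis of [O / P], with integer coefficients in place of elements of
    [F_p], so that integer matrices and their determinants can be used. *)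
Definition residue_basis (f : nat) (b : 'I_f -> O) : Prop :=
  (forall x, exists c : 'I_f -> int, x - \sum_i (c i)%:~R * b i \in prime_ideal P) /\
  (forall c : 'I_f -> int, \sum_i (c i)%:~R * b i \in prime_ideal P ->
     forall i, (p %| c i)%Z).

Let p_pr : prime p := residue_char_prime P.

Lemma intr_Fp_eq0 (q : nat) (z : int) : prime q ->
  ((z%:~R : 'F_q) == 0) = (q %| z)%Z.
Proof.
move=> q_pr; rewrite -[RHS]/(_ %| _)%N (dvdn_pcharf (pchar_Fp q_pr)).
by case: (intP z) => [|m|m]; rewrite ?mulrNz ?abszN ?oppr_eq0.
Qed.

(** Independent families modulo [P] have at most [n] elements, so a largest one exists; it spans,
    because in a relation with a new element the coefficient of that element is prime to [p] and can
    be inverted modulo [p]. *)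
Lemma residue_basis_exists : exists f b, @residue_basis f b.
Proof.
pose indep f := exists b : 'I_f -> O, forall c : 'I_f -> int,
  \sum_i (c i)%:~R * b i \in prime_ideal P -> forall i, (p %| c i)%Z.
have bound f : `[< indep f >] -> (f <= n)%N.
  move=> /asboolP[b bP]; apply: (free_mod_leq_dim_O (x := b) (prime_gt1 p_pr)).
  by move=> c c0; apply: bP; rewrite c0 prime0.
have indep0 : exists f, `[< indep f >].
  by exists 0%N; apply/asboolP; exists (fun=> 0) => c _ [].
case: (ex_maxnP indep0 bound) => f /asboolP[b bP] fmax.
exists f, b; split=> // x.
have : ~ indep f.+1 by move/asboolP/fmax; rewrite ltnn.
move=> /forallNP /(_ (fun i => oapp b x (unlift ord0 i)))/existsNP[c].
move=> /not_implyP[]; rewrite big_ord_recl unlift_none/=.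
under eq_bigr do rewrite liftK/=.
move=> cxb /existsNP[i ci].
have c0 : ~~ (p %| c ord0)%Z.
  apply/negP => pc0; apply: ci; have [j ->|->//] := unliftP ord0 i.
  apply: (bP (fun i => c (lift ord0 i))).
  rewrite -[X in X \in _](addKr ((c ord0)%:~R * x)) addrC rpredB//.
  by rewrite primeMl// (prime_residue_charE P).
have [u uP] := int_inv_mod p_pr c0.
exists (fun j => - u * c (lift ord0 j)).
have -> : x - \sum_(i < f) (- u * c (lift ord0 i))%:~R * b i =
   u%:~R * ((c ord0)%:~R * x + \sum_(i < f) (c (lift ord0 i))%:~R * b i)
   - (u * c ord0 - 1)%:~R * x.
  rewrite mulrDr mulr_sumr rmorphB rmorphM/= mulrBl mulrA.
  rewrite -sumrN [X in _ = _ + X - _](eq_bigr (fun i => - ((- u * c (lift ord0 i))%:~R * b i))).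
    by rewrite rmorph1; ring.
  by move=> j _; rewrite rmorphM rmorphN/=; ring.
by rewrite rpredB//; [exact: primeMr|rewrite primeMl// prime_residue_charE].
Qed.

Lemma Fp_natE (a : 'F_p) : ((a : nat)%:R : 'F_p) = a.
Proof. exact: natr_Zp. Qed.

Lemma Fp_lift_mod (z : int) : (p %| ((z%:~R : 'F_p) : nat)%:Z - z)%Z.
Proof. by rewrite -(intr_Fp_eq0 _ p_pr) rmorphB/= -pmulrn Fp_natE subrr. Qed.

Lemma pi_residue_comb f (c : 'I_f -> nat) (b : 'I_f -> O) :
  \pi_k (\sum_i (c i)%:R * b i) = \sum_i (c i)%:R * \pi_k (b i).
Proof. by rewrite rmorph_sum; apply: eq_bigr => i _; rewrite rmorphM/= rmorph_nat. Qed.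

Lemma residue_basis_dim f (b : 'I_f -> O) : residue_basis b -> residue_dim P f.
Proof.
move=> [bspan bind]; exists (fun i => \pi_k (b i)) => x.
have [c cP] := bspan (repr x); exists [ffun i => (c i)%:~R]; split.
  apply/eqP; rewrite -[x in x == _]reprK -subr_eq0.
  set d : {ffun 'I_f -> 'F_p} := finfun _.
  rewrite -[X in _ - X](pi_residue_comb (fun i => d i : nat) b).
  rewrite -rmorphB pi_residue_eq0 /d.
  set s := \sum_(i < f) _; set t := \sum_(i < f) _ in cP.
  rewrite -(subrKA t) rpredD// -sumrB; apply: rpred_sum => i _.
  rewrite -mulrBl primeMl// pmulrn -rmorphB prime_residue_charE ffunE.
  by rewrite -opprB dvdzE abszN -dvdzE Fp_lift_mod.
move=> d xE; apply/ffunP => i; rewrite ffunE; apply/eqP.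
rewrite -(Fp_natE (d i)) pmulrn -subr_eq0 -rmorphB.
rewrite intr_Fp_eq0//; apply: (bind (fun i => c i - (d i : nat)%:Z)).
have xd : repr x - \sum_i (d i : nat)%:R * b i \in prime_ideal P.
  rewrite -pi_residue_eq0 rmorphB/= reprK {1}xE rmorph_sum subr_eq0.
  by apply/eqP/eq_bigr => j _; rewrite rmorphM/= rmorph_nat.
have -> : \sum_i (c i - (d i : nat)%:Z)%:~R * b i =
    (repr x - \sum_i (d i : nat)%:R * b i) - (repr x - \sum_i (c i)%:~R * b i).
  rewrite opprB addrC subrKA -sumrB; apply: eq_bigr => j _.
  by rewrite rmorphB/= mulrBl.
by rewrite rpredB.
Qed.

Lemma residue_dim_basis f : residue_dim P f -> exists b, @residue_basis f b.
Proof.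
case=> b bP; exists (fun i => repr (b i)).
have piE (c : 'I_f -> nat) : \pi_k (\sum_i (c i)%:R * repr (b i)) = \sum_i (c i)%:R * b i.
  by rewrite rmorph_sum; apply: eq_bigr => i _; rewrite rmorphM/= rmorph_nat reprK.
split=> [x|c cP].
  have [c [xE _]] := bP (\pi x); exists (fun i => (c i : nat)%:Z).
  by rewrite -pi_residue_eq0 rmorphB/= piE -xE subrr.
have [d [_ dU]] := bP 0.
have d0 : d = [ffun=> 0].
  by apply: dU; rewrite big1// => i _; rewrite ffunE mul0r.
suff : d = [ffun i => (c i)%:~R].
  by rewrite d0 => /ffunP dc i; have := dc i; rewrite !ffunE => /esym/eqP; rewrite intr_Fp_eq0.
apply: dU; rewrite -piE; apply/esym/eqP; rewrite pi_residue_eq0.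
rewrite -[X in X \in _](subrK (\sum_i (c i)%:~R * repr (b i))) rpredD//.
rewrite -sumrB; apply: rpred_sum => i _.
rewrite -mulrBl primeMl// pmulrn -rmorphB prime_residue_charE ffunE.
exact: Fp_lift_mod.
Qed.

(** [residue_basis_exists] provides a dimension, so the [xget] in [inertia_degree] does not fall
    back on [0]. *)
Lemma inertia_basis : exists b, @residue_basis (inertia_degree P) b.
Proof.
apply: residue_dim_basis; rewrite /inertia_degree; case: xgetP => [f _ //|H].
by have [f [b /residue_basis_dim]] := residue_basis_exists => /H.
Qed.

Lemma inertia_degree_gt0 : (0 < inertia_degree P)%N.
Proof.
have [b [bspan _]] := inertia_basis; rewrite lt0n; apply/negP => /eqP f0.
have [c] := bspan 1; rewrite big1 ?subr0 ?prime1//= => -[i lif]; by exfalso; move: (lif); rewrite f0.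
Qed.

Lemma inertia_degree_leq_dim : (inertia_degree P <= n)%N.
Proof.
have [b [_ bind]] := inertia_basis.
apply: (free_mod_leq_dim_O (x := b) (prime_gt1 p_pr)) => c c0; apply: bind.
by rewrite c0 prime0.
Qed.

Lemma prime_norm_gt1 : (1 < prime_norm P)%N.
Proof. by rewrite /prime_norm (ltn_exp2l 0)// ?prime_gt1// inertia_degree_gt0. Qed.

(** Writing [1] as a multiple [d b] of the single basis element makes [d] invertible modulo [p], so
    [b] is itself congruent to an integer. *)
Lemma degree1_int_mod (x : O) : inertia_degree P = 1%N ->
  exists a : int, x - a%:~R \in prime_ideal P.
Proof.
have [b [bspan _]] := inertia_basis => f1; move: b bspan; rewrite f1 => b bspan.
have [c] := bspan x; have [d] := bspan 1; rewrite !big_ord1 => d1 cx.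
have pd : ~~ (p %| d ord0)%Z.
  apply/negP; rewrite -(prime_residue_charE P) => dP.
  have : 1 - (d ord0)%:~R * b ord0 + (d ord0)%:~R * b ord0 \in prime_ideal P.
    by rewrite rpredD// primeMl.
  by rewrite subrK prime1.
have [u uP] := int_inv_mod p_pr pd; exists (c ord0 * u).
have -> : x - (c ord0 * u)%:~R = (x - (c ord0)%:~R * b ord0)
   + (c ord0 * u)%:~R * ((d ord0)%:~R * b ord0 - 1)
   - (c ord0)%:~R * b ord0 * (u * d ord0 - 1)%:~R.
  by rewrite !rmorphB !rmorphM/= rmorph1; ring.
apply: rpredB; first apply: rpredD => //.
  by apply: (@primeMr _ P); rewrite -opprB rpredN.
by apply: (@primeMr _ P); rewrite prime_residue_charE.
Qed.

End Residue.
End NumberField.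

(** * Integral generators and ramification *)

Section MulMatrix.
Variables (R : comNzRingType) (n : nat).
Implicit Types a b g : {poly R}.

(* Rows are the coordinates of [a * 'X^i] in the basis ['X^j] of [R[X]/(g)]. *)
Definition mulmodmx g a : 'M[R]_n :=
  \matrix_(i, j) (Pdiv.Ring.rmodp (a * 'X^i) g)`_j.

Variable g : {poly R}.
Hypothesis (gm : g \is monic) (gn : size g = n.+1).
Local Notation M := (mulmodmx g).

Lemma size_rmodp_monic a : (size (Pdiv.Ring.rmodp a g) <= n)%N.
Proof. by rewrite -ltnS -gn Pdiv.Ring.ltn_rmodpN0// monic_neq0. Qed.

Lemma poly_sum_coef a : (size a <= n)%N -> a = \sum_(j < n) a`_j *: 'X^j.
Proof.
move=> an; rewrite -poly_def; apply/polyP => i; rewrite coef_poly.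
by case: ltnP => // ni; rewrite nth_default// (leq_trans an).
Qed.

Lemma mulmodmxM a b : M (a * b) = M a *m M b.
Proof.
apply/matrixP => i j; rewrite !mxE.
under eq_bigr do rewrite !mxE -coefZ -Pdiv.RingMonic.rmodpZ//.
rewrite -coef_sum -Pdiv.RingMonic.rmodp_sum//; congr (_`_j).
under eq_bigr do rewrite scalerAr.
rewrite -mulr_sumr -poly_sum_coef ?size_rmodp_monic//.
by rewrite Pdiv.RingMonic.rmodp_mulmr// mulrCA mulrA.
Qed.

Lemma mulmodmxD a b : M (a + b) = M a + M b.
Proof. by apply/matrixP => i j; rewrite !mxE mulrDl Pdiv.RingMonic.rmodpD// coefD. Qed.

Lemma mulmodmxZ c a : M (c *: a) = c *: M a.
Proof. by apply/matrixP => i j; rewrite !mxE -scalerAl Pdiv.RingMonic.rmodpZ// coefZ. Qed.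

Lemma mulmodmx1 : M 1 = 1%:M.
Proof.
apply/matrixP => i j; rewrite !mxE mul1r Pdiv.Ring.rmodp_small.
  by rewrite coefXn eq_sym.
by rewrite gn size_polyXn ltnS.
Qed.

Lemma mulmodmxC c : M c%:P = c%:M.
Proof. by rewrite -alg_polyC mulmodmxZ mulmodmx1 scalemx1. Qed.

Lemma mulmodmx_sum (I : Type) (r : seq I) (p : pred I) (f : I -> {poly R}) :
  M (\sum_(i <- r | p i) f i) = \sum_(i <- r | p i) M (f i).
Proof.
elim: r => [|i r IHr]; first by rewrite !big_nil -[0]/(0%:P) mulmodmxC raddf0.
by rewrite !big_cons; case: ifP => // _; rewrite mulmodmxD IHr.
Qed.

Lemma mulmodmx_modulus a : M (a * g) = 0.
Proof.
apply/matrixP => i j; rewrite !mxE mulrAC Pdiv.RingMonic.rmodp_mull//.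
by rewrite coef0.
Qed.

Lemma det_mulmodmx_addC (c : R) a :
  \det (M (c%:P + a)) = (char_poly (- M a)).[c].
Proof.
rewrite mulmodmxD mulmodmxC /char_poly -[RHS]/(horner_eval c _) -det_map_mx.
congr (\det _); apply/matrixP => i j; rewrite !mxE /= /horner_eval !hornerE.
by rewrite hornerMn hornerX opprK.
Qed.

(** Turns an integral equation for [a] modulo [g] into one for each eigenvalue of [M a]. *)
Lemma mulmodmx_comp (v : 'rV[R]_n) (c : R) a (h : {poly R}) :
  v *m M a = c *: v -> v *m M (h \Po a) = h.[c] *: v.
Proof.
move=> va; elim/poly_ind: h => [|h e IHh].
  by rewrite comp_poly0 horner0 scale0r -[0]/(0%:P) mulmodmxC raddf0 mulmx0.
rewrite comp_polyD comp_polyM comp_polyX comp_polyC mulmodmxD mulmodmxM mulmodmxC.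
rewrite mulmxDr mulmxA IHh -scalemxAl va !hornerE scalerDl scalerA mul_mx_scalar.
by [].
Qed.

Lemma mulmodmx_row a (i : 'I_n) :
  \sum_j M a i j *: 'X^j = Pdiv.Ring.rmodp (a * 'X^i) g.
Proof.
rewrite [RHS]poly_sum_coef ?size_rmodp_monic//.
by apply: eq_bigr => j _; rewrite mxE.
Qed.

End MulMatrix.

Lemma map_mulmodmx (R S : comNzRingType) (f : {rmorphism R -> S}) n (g a : {poly R}) :
  g \is monic -> size g = n.+1 ->
  map_mx f (mulmodmx n g a) = mulmodmx n (map_poly f g) (map_poly f a).
Proof.
move=> gm gn; apply/matrixP => i j; rewrite !mxE -coef_map; congr (_`_j).
have gm' : map_poly f g \is monic by exact: monic_map.
rewrite -(map_polyXn f) -rmorphM.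
rewrite {2}(Pdiv.RingMonic.rdivp_eq gm (a * 'X^i)) rmorphD rmorphM/=.
rewrite Pdiv.RingMonic.rmodp_addl_mul_small//.
apply: leq_ltn_trans (size_poly _ _) _; rewrite size_map_poly_id0.
  by rewrite Pdiv.Ring.ltn_rmodpN0// monic_neq0.
by rewrite (eqP gm) rmorph1 oner_eq0.
Qed.

Lemma Crat_Aint_intr (r : rat) : (ratr r : algC) \in Aint -> exists z : int, r = z%:~R.
Proof.
move=> /(Cint_rat_Aint (Crat_rat r)) /intrP[z zE]; exists z.
by apply: (fmorph_inj (ratr : {rmorphism rat -> algC})); rewrite [LHS]zE rmorph_int.
Qed.

(* The eigenvalues of [A] are roots of [h], hence algebraic integers. *)
Lemma trace_mulmod_int n (g c : {poly rat}) (h : {poly int}) :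
    (0 < n)%N -> g \is monic -> size g = n.+1 -> h \is monic ->
    Pdiv.Ring.rmodp (map_poly intr h \Po c) g = 0 ->
  exists z : int, \tr (mulmodmx n g c) = z%:~R.
Proof.
move=> n0 gm gn hm hc; pose A := map_mx (ratr : rat -> algC) (mulmodmx n g c).
apply: Crat_Aint_intr; rewrite -trace_map_mx -/A.
rewrite -[\tr A]opprK rpredN -char_poly_trace//.
have [r rE] := closed_field_poly_normal (char_poly A).
rewrite (eqP (char_poly_monic A)) scale1r in rE.
have rA z : z \in r -> z \in Aint.
  move=> zr; have : root (char_poly A) z by rewrite rE root_prod_XsubC.
  rewrite -eigenvalue_root_char => /eigenvalueP[v vA v0].
  have gm' : map_poly (ratr : rat -> algC) g \is monic by exact: monic_map.
  have gn' : size (map_poly (ratr : rat -> algC) g) = n.+1 by rewrite size_map_poly.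
  rewrite /A map_mulmodmx// in vA.
  have := mulmodmx_comp gm' gn' (map_poly (ratr : rat -> algC) (map_poly intr h)) vA.
  rewrite -map_comp_poly {1}(Pdiv.RingMonic.rdivp_eq gm (_ \Po c)) hc addr0.
  rewrite rmorphM/= mulmodmx_modulus// mulmx0 => /esym/eqP.
  rewrite scaler_eq0 (negPf v0) orbF -map_poly_comp/= => hz.
  apply: (root_monic_Aint (p := map_poly (ratr \o intr) h)) => //.
    by apply: monic_map.
  by apply/polyOverP => i; rewrite coef_map /= ratr_int intr_int.
suff : char_poly A \is a polyOver Aint by move/polyOverP/(_ n.-1).
rewrite rE; elim: r rA {rE} => [|z r IHr] rA; first by rewrite big_nil rpred1.
rewrite big_cons rpredM ?polyOverXsubC//; first by rewrite rA ?mem_head.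
by apply: IHr => y yr; rewrite rA// inE yr orbT.
Qed.

(** * An integral primitive element and its discriminant *)

Section Generator.
Variable K : fieldExtType rat.
Local Notation O := (ring_of_integers K).
Local Notation n := (\dim {:K}).

(** By [gen_free] and [gen_span] the powers of [gen] below [n] form a [Q]-basis of [K], so [Z[gen]]
    is an order of [K]. *)
Record integral_generator := IntegralGenerator {
  gen :> O;
  gen_poly : {poly int};
  gen_monic : gen_poly \is monic;
  gen_size : size gen_poly = n.+1;
  gen_root : (map_poly intr gen_poly).[gen] = 0;
  gen_free : forall c : {poly rat}, (size c <= n)%N ->
    (map_poly (in_alg K) c).[int_val gen] = 0 -> c = 0;
  gen_span : forall x : K, exists2 c : {poly rat}, (size c <= n)%N &
    x = (map_poly (in_alg K) c).[int_val gen]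
}.

Lemma generator_free_span (x : K) : <<1; x>>%VS = fullv ->
  (forall c : {poly rat}, (size c <= n)%N ->
    (map_poly (in_alg K) c).[x] = 0 -> c = 0) /\
  (forall y : K, exists2 c : {poly rat}, (size c <= n)%N &
    y = (map_poly (in_alg K) c).[x]).
Proof.
move=> xfull.
have nE : adjoin_degree 1 x = n by rewrite -xfull dim_Fadjoin dimv1 muln1.
split=> [c cn c0|y].
  apply/eqP; rewrite -(map_poly_eq0 (in_alg K)); apply: contraT => cn0.
  have := dvdp_leq cn0 (@minPoly_dvdp _ _ 1%AS x (map_poly (in_alg K) c) _ _).
  rewrite size_minPoly nE size_map_poly ltnNge cn; apply.
    by apply/polyOver1P; exists c.
  exact/rootP.
have yx : y \in <<1; x>>%VS by rewrite xfull memvf.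
have /polyOver1P[c cE] := Fadjoin_polyOver 1 x y.
exists c; last by rewrite -cE Fadjoin_poly_eq.
by rewrite -(size_map_poly (in_alg K)) -cE -nE size_Fadjoin_poly.
Qed.

Lemma integral_generator_exists : inhabited integral_generator.
Proof.
have sepK : separable 1%AS {:K}%AS.
  by apply/separableP => y _; apply: pcharf0_separable => p; rewrite pchar_lalg pchar_num.
have := eq_adjoin_separable_generator sepK (sub1v _).
set a := separable_generator _ _ => /= /esym afull.
have nE : adjoin_degree 1 a = n by rewrite -afull dim_Fadjoin dimv1 muln1.
have /polyOver1P[q qE] := minPolyOver 1 a.
have qn : size q = n.+1 by rewrite -(size_map_poly (in_alg K)) -qE size_minPoly nE.
have qm : q`_n = 1.
  apply: (fmorph_inj (in_alg K)); rewrite -coef_map -qE rmorph1 -nE.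
  by have /monicP := monic_minPoly 1 a; rewrite /lead_coef size_minPoly.
have [d [d0 [c cE]]] := common_denominator (fun i : 'I_n => q`_i).
(* The lower part of [d^n q(X / d)], the monic polynomial of [d a]: its coefficient [d^(n-i) q_i]
   equals [d^(n-1-i) c_i]. *)
pose r : {poly int} := \poly_(i < n) (d ^+ (n.-1 - i) * oapp c 0 (insub i)).
pose g : {poly int} := 'X^n + r.
have gs : (size r < size ('X^n : {poly int}))%N.
  by rewrite size_polyXn ltnS size_poly.
have gm : g \is monic by rewrite monicE lead_coefDl// lead_coefXn.
have gn : size g = n.+1 by rewrite size_polyDl// size_polyXn.
have da : <<1; d%:~R * a>>%VS = fullv :> {vspace K}.
  apply/eqP; rewrite eqEsubv subvf/= -afull; apply/FadjoinP; split; first exact: sub1v.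
  have da : (d%:~R : rat)^-1 *: (d%:~R * a) = a.
    by rewrite -scale_intr scalerA mulVf ?intr_eq0// scale1r.
  by rewrite -[X in X \in _]da memvZ// memv_adjoin.
have groot : (map_poly intr g).[d%:~R * a] = 0.
  have : (map_poly (in_alg K) q).[a] = 0 by rewrite -qE minPolyxx.
  rewrite (@horner_coef_wide _ n.+1) ?size_map_poly ?qn// big_ord_recr/=.
  rewrite coef_map qm /= scale1r mul1r => q0.
  transitivity (d%:~R ^+ n * 0 : K); last by rewrite mulr0.
  rewrite -q0 mulrDr rmorphD/= map_polyXn !hornerE -exprMn addrC; congr (_ + _).
  rewrite (@horner_coef_wide _ n (map_poly _ r)); last first.
    exact: leq_trans (size_poly _ _) (size_poly _ _).
  rewrite mulr_sumr; apply: eq_bigr => i _.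
  rewrite coef_map coef_poly ltn_ord valK /=.
  rewrite coef_map/= rmorphM rmorphXn/= exprMn -[(c i)%:~R]intr_alg -cE.
  rewrite -scalerA -[(_%:~R : rat) *: _]/(_ *: _) scale_intr.
  transitivity (d%:~R ^+ (n.-1 - i + 1 + i) * ((q`_i)%:A * a ^+ i) : K).
    have aux (u v w x y : K) : u * (v * x) * (w * y) = u * v * w * (x * y) by ring.
    by rewrite !exprD expr1 aux.
  by congr (_ ^+ _ * _); have := ltn_ord i; lia.
have oI : (d%:~R * a) \in integral_elements K.
  apply/asboolP; exists g => //; exact/rootP.
have [dfree dspan] := generator_free_span da.
constructor; apply: (@IntegralGenerator (RingOfIntegers oI) g) => //.
apply: val_inj; rewrite -[LHS]/(int_val _) -horner_map -map_poly_comp -[RHS]groot.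
by congr (_ .[_]); apply: eq_map_poly => z /=; rewrite rmorph_int.
Qed.

Variable t : integral_generator.
Local Notation g := (gen_poly t).
Local Notation gQ := (map_poly intr g : {poly rat}).

Definition evO : {poly int} -> O := horner_eval (gen t) \o map_poly intr.
HB.instance Definition _ := GRing.RMorphism.copy evO (horner_eval (gen t) \o map_poly intr).

Definition evK : {poly rat} -> K := horner_eval (int_val t) \o map_poly (in_alg K).
HB.instance Definition _ :=
  GRing.RMorphism.copy evK (horner_eval (int_val t) \o map_poly (in_alg K)).

Lemma evO_X : evO 'X = t.
Proof. by rewrite /evO /= /horner_eval map_polyX hornerX. Qed.

Lemma evO_C c : evO c%:P = c%:~R.
Proof. by rewrite /evO /= /horner_eval map_polyC hornerC. Qed.

Lemma evOD a b : evO (a + b) = evO a + evO b. Proof. exact: rmorphD. Qed.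
Lemma evOB a b : evO (a - b) = evO a - evO b. Proof. exact: rmorphB. Qed.
Lemma evOM a b : evO (a * b) = evO a * evO b. Proof. exact: rmorphM. Qed.

Lemma evK_C c : evK c%:P = c%:A.
Proof. by rewrite /evK /= /horner_eval map_polyC hornerC. Qed.

Lemma evK_map (a : {poly int}) : evK (map_poly intr a) = int_val (evO a).
Proof.
rewrite /evO /evK /= /horner_eval -horner_map -!map_poly_comp.
by congr (_ .[_]); apply: eq_map_poly => z /=; rewrite rmorph_int intr_alg.
Qed.

Lemma gQ_monic : gQ \is monic. Proof. exact/monic_map/gen_monic. Qed.
Lemma gQ_size : size gQ = n.+1.
Proof. by rewrite size_map_poly_id0 ?gen_size// (monicP (gen_monic t)) oner_eq0. Qed.

Lemma evO_gen_poly : evO g = 0. Proof. exact: gen_root. Qed.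

Lemma evO_rmodp a : evO (Pdiv.Ring.rmodp a g) = evO a.
Proof.
rewrite {2}(Pdiv.RingMonic.rdivp_eq (gen_monic t) a) rmorphD rmorphM/=.
by rewrite evO_gen_poly mulr0 add0r.
Qed.

Lemma evK_eq0 c : evK c = 0 -> Pdiv.Ring.rmodp c gQ = 0.
Proof.
move=> c0; apply: (@gen_free t).
  by rewrite -ltnS -gQ_size Pdiv.Ring.ltn_rmodpN0// monic_neq0// gQ_monic.
rewrite -[LHS]/(evK _); move: c0.
rewrite {1}(Pdiv.RingMonic.rdivp_eq gQ_monic c) rmorphD rmorphM/=.
by rewrite evK_map evO_gen_poly mulr0 add0r.
Qed.

Lemma evO_inj (a b : {poly int}) : (size a <= n)%N -> (size b <= n)%N ->
  evO a = evO b -> a = b.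
Proof.
move=> an bn ab; apply/eqP; rewrite -subr_eq0; apply/eqP.
apply: (map_inj_poly (@intr_inj rat)) => //; rewrite rmorph0; apply: (@gen_free t).
  apply: leq_trans (size_poly _ _) _; rewrite (leq_trans (size_polyD _ _))//.
  by rewrite geq_max an size_polyN.
by rewrite -[LHS]/(evK _) evK_map rmorphB/= ab subrr.
Qed.

Local Notation M := (mulmodmx n g).
Local Notation MQ := (mulmodmx n gQ).

Lemma mulmodmx_coord a (i : 'I_n) :
  \sum_j (M a i j)%:~R * gen t ^+ j = evO a * gen t ^+ i.
Proof.
rewrite -evO_X -rmorphXn -rmorphM/= -[RHS]evO_rmodp.
rewrite -(mulmodmx_row (gen_monic t) (gen_size t)) rmorph_sum.
by apply: eq_bigr => j _; rewrite -mul_polyC rmorphM/= evO_C !rmorphXn.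
Qed.

Lemma trace_integral (x : O) c : int_val x = evK c ->
  exists z : int, \tr (MQ c) = z%:~R.
Proof.
move=> xc; have /asboolP[h hm /rootP hx] := int_valP x.
apply: (@trace_mulmod_int _ _ _ h); rewrite ?adim_gt0 ?gQ_monic ?gQ_size//.
apply: evK_eq0; rewrite /evK/= /horner_eval map_comp_poly horner_comp.
rewrite -[X in _.[X]]/(evK c) -xc -[RHS]hx -map_poly_comp.
by congr (_ .[_]); apply: eq_map_poly => z /=; rewrite intr_alg.
Qed.

(** [D] is the determinant of the trace form [T] on the powers of [t]. For integral [x] the traces
    of [x t^i] are integers, and Cramer's rule recovers the coordinates of [x] from them up to the
    factor [D]. *)
Lemma conductor_exists : exists2 D : int, D != 0 &
  forall x : O, exists a : {poly int}, D%:~R * x = evO a.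
Proof.
pose T : 'M[int]_n := \matrix_(j, i) \tr (M ('X^j * 'X^i)).
have TQ (c : {poly rat}) (i : 'I_n) : (size c <= n)%N ->
    (poly_rV c *m map_mx intr T) 0 i = \tr (MQ (c * 'X^i)).
  move=> cn; rewrite mxE {2}(poly_sum_coef cn) mulr_suml mulmodmx_sum ?gQ_monic ?gQ_size// raddf_sum/=.
  apply: eq_bigr => j _; rewrite -scalerAl mulmodmxZ ?gQ_monic// mxtraceZ !mxE.
  congr (_ * _); rewrite -(trace_map_mx (intr : int -> rat)) map_mulmodmx ?gen_monic ?gen_size//.
  by rewrite rmorphM/= !map_polyXn.
exists (\det T); last first.
  move=> x; have [c cn xc] := gen_span t (int_val x).
  have /choice[z zE] (i : 'I_n) : exists z : int, \tr (MQ (c * 'X^i)) = z%:~R.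
    apply: (@trace_integral (x * gen t ^+ i)).
    rewrite rmorphM rmorphXn/= rmorphM rmorphXn/= [int_val x]xc.
    by rewrite {2}/evK/= /horner_eval map_polyX hornerX.
  have cT : poly_rV c *m map_mx intr T = map_mx intr (\row_i z i).
    by apply/rowP => i; rewrite TQ// zE !mxE.
  exists (rVpoly (\row_i z i *m \adj T)); apply: val_inj.
  rewrite -[LHS]/(int_val _) -[RHS]/(int_val _) -evK_map map_rVpoly map_mxM -cT.
  rewrite -mulmxA map_mx_adj mul_mx_adj det_map_mx mul_mx_scalar linearZ/= poly_rV_K//.
  rewrite -mul_polyC [RHS]rmorphM/= evK_C intr_alg -[evK c]xc.
  by rewrite -(rmorph_int (@int_val K)) -(rmorphM (@int_val K)).
(* A kernel vector of [T] gives a nonzero element of [K] whose product with every element has trace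
   [0]; but its product with its inverse has the trace of [1], which is [n]. *)
apply/negP => /eqP T0; have : \det (map_mx (intr : int -> rat) T) == 0.
  by rewrite det_map_mx T0.
move=> /det0P[v v0 vT]; pose c := rVpoly v.
have cn : (size c <= n)%N by exact: size_poly.
have w0 : evK c != 0.
  apply: contra v0 => /eqP /(gen_free cn) c0.
  by rewrite -(rVpolyK v) -/c c0 linear0.
have [u un uE] := gen_span t (evK c)^-1.
have : \tr (MQ (c * u)) = 0.
  rewrite {1}(poly_sum_coef un) mulr_sumr mulmodmx_sum ?gQ_monic ?gQ_size// raddf_sum/=.
  rewrite big1// => i _; rewrite -scalerAr mulmodmxZ ?gQ_monic// mxtraceZ.
  by rewrite -TQ// rVpolyK vT mxE mulr0.
have : Pdiv.Ring.rmodp (c * u - 1) gQ = 0.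
  by apply: evK_eq0; rewrite rmorphB rmorphM rmorph1/= {2}/evK/= /horner_eval -uE mulfV// subrr.
move=> cu0; rewrite -[c * u](subrK 1) (Pdiv.RingMonic.rdivp_eq gQ_monic (c * u - 1)).
rewrite cu0 addr0 mulmodmxD ?gQ_monic// mulmodmx_modulus ?gQ_monic// mulmodmx1 ?gQ_size//.
rewrite add0r mxtrace1 => /eqP; rewrite pnatr_eq0 => /eqP n0.
by have := adim_gt0 {:K}%AS; rewrite /= n0.
Qed.

(** * Ramified primes of degree one *)

Section Ramification.
Variables (P : prime_of K) (D : int).
Hypothesis DP : forall x : O, exists a : {poly int}, D%:~R * x = evO a.
Local Notation p := (residue_char P).
Hypothesis pD : ~~ (p %| D)%Z.

Lemma evO_sub_mod (a : {poly int}) (z : int) :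
  exists y : O, evO a - (a.[z])%:~R = (gen t - z%:~R) * y.
Proof.
have : root (a - (a.[z])%:P) z by rewrite rootE !hornerE subrr.
case/factor_theorem => q qE; exists (evO q).
by rewrite -evO_C -rmorphB qE rmorphM rmorphB/= evO_C evO_X mulrC.
Qed.

(** [D y] is some [a(t)], congruent to [a(z)] modulo [t - z]. The integer [a(z)] lies in [P], hence
    is a multiple of [p], and [D] is invertible modulo [p]. So [p] and [t - z] generate [P]. *)
Lemma degree1_prime_gen (z : int) : gen t - z%:~R \in prime_ideal P ->
  forall y, y \in prime_ideal P -> exists u v : O, y = p%:R * u + (gen t - z%:~R) * v.
Proof.
move=> tz y yP; have [a aE] := DP y; have [w wE] := evO_sub_mod a z.
have [e] := int_inv_mod (residue_char_prime P) pD.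
move=> /dvdzP[d dE].
have : (a.[z])%:~R \in prime_ideal P.
  have -> : (a.[z])%:~R = D%:~R * y - (gen t - z%:~R) * w by rewrite -wE aE; ring.
  by apply: rpredB; [exact: primeMr|exact: primeMl].
rewrite prime_residue_charE => /dvdzP[b bE].
exists (- d%:~R * y + (e * b)%:~R), (e%:~R * w).
have : e%:~R * (D%:~R * y) = e%:~R * (b%:~R * p%:R + (gen t - z%:~R) * w) :> O.
  by rewrite aE -wE bE rmorphM/= -pmulrn; ring.
have : (e * D - 1)%:~R = d%:~R * p%:R :> O by rewrite dE rmorphM/= -pmulrn.
rewrite rmorphB rmorphM/= rmorph1 => E1 E2; rewrite rmorphM/=.
have yE : y = e%:~R * (D%:~R * y) - (e%:~R * D%:~R - 1) * y by ring.
by rewrite {1}yE E1 E2; ring.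
Qed.

Lemma ideal_power2_gen (z : int) (x : O) : gen t - z%:~R \in prime_ideal P ->
  ideal_power P 2 x -> exists A B : O, [/\ A \in prime_ideal P, B \in prime_ideal P &
    x = p%:R * A + (gen t - z%:~R) * B].
Proof.
move=> tz [m [r [a [aP ->]]]].
have /choice[uv uvE] i : exists uv : O * O,
    a i ord0 = p%:R * uv.1 + (gen t - z%:~R) * uv.2.
  by have [u [v E]] := degree1_prime_gen tz (aP i ord0); exists (u, v).
exists (\sum_(i < m) r i * (uv i).1 * a i ord_max), (\sum_(i < m) r i * (uv i).2 * a i ord_max).
split; [by apply: rpred_sum => i _; apply: primeMr|by apply: rpred_sum => i _; apply: primeMr|].
rewrite !mulr_sumr -big_split; apply: eq_bigr => i _ /=.
by rewrite big_ord_recl big_ord1 uvE (_ : lift _ _ = ord_max); [ring|exact: val_inj].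
Qed.

(** With [g = (X - t) H] one has [g'(t) = H(t)]. If this is outside [P], so is [H(z)] for an integer
    [z] congruent to [t], and [g(z) = (z - t) H(z)] places [t - z] in [p O + (t - z) P]. Together
    with [p] in [P^2] this contradicts Nakayama's lemma for the ideal generated by [p] and
    [t - z]. *)
Lemma ramified_dvd : inertia_degree P = 1%N -> ideal_power P 2 (p%:R) ->
  evO g^`() \in prime_ideal P.
Proof.
move=> f1 p2; apply: contraT => g'P.
have [z tz] := degree1_int_mod (gen t) f1.
have [A [B [AP BP pE]]] := ideal_power2_gen tz p2.
set s : O := gen t - z%:~R in tz pE.
have /factor_theorem[H HE] : root (map_poly intr g : {poly O}) (gen t).
  exact/rootP/(gen_root t).
have g'E : evO g^`() = H.[gen t].
  rewrite /evO/= /horner_eval -deriv_map HE derivM derivXsubC mulr1 !hornerE.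
  by rewrite subrr mulr0 add0r.
have Hz : H.[z%:~R] \notin prime_ideal P.
  apply: contra g'P => HzP; rewrite g'E.
  have : root (H - (H.[z%:~R])%:P) z%:~R by rewrite rootE !hornerE subrr.
  case/factor_theorem => q qE.
  have -> : H.[gen t] = (q * ('X - (z%:~R)%:P)).[gen t] + H.[z%:~R].
    by rewrite -qE !hornerE subrK.
  by rewrite rpredD// !hornerE; apply: primeMr.
have gz : (g.[z])%:~R = - s * H.[z%:~R].
  have -> : (g.[z])%:~R = (map_poly intr g).[z%:~R] :> O by rewrite horner_map.
  by rewrite HE !hornerE /s; ring.
have : (p %| g.[z])%Z by rewrite -(prime_residue_charE P) gz mulNr rpredN primeMl.
case/dvdzP => m mE.
have [w wP] := prime_maximal Hz.
have sE : s = p%:R * (- (m%:~R * w) * A) +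
    s * (- (m%:~R * w) * B - (H.[z%:~R] * w - 1)).
  have mp : m%:~R * p%:R = - s * H.[z%:~R] :> O by rewrite -gz mE rmorphM/= -pmulrn.
  have -> : p%:R * (- (m%:~R * w) * A) + s * (- (m%:~R * w) * B - (H.[z%:~R] * w - 1)) =
     - m%:~R * w * (p%:R * A + s * B) - s * (H.[z%:~R] * w - 1) by ring.
  by rewrite -pE -mulrA [w * _]mulrC mulNr mulrA mp; ring.
set C := _ * A in sE; set E := _ - _ in sE.
clearbody s.
have CP : C \in prime_ideal P by exact: primeMr.
have EP : E \in prime_ideal P by apply: rpredB => //; exact: primeMr.
(* The matrix of the two relations kills the pair of [p] and [s], so its determinant kills [p]; but
   this determinant is [1] modulo [P], and [O] is a domain. *)
clearbody C E; have : ((1 - A) * (1 - E) - B * C) * p%:R = 0.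
  have pE' : (1 - A) * p%:R = s * B by rewrite mulrBl mul1r {1}pE; ring.
  have sE' : (1 - E) * s = p%:R * C by rewrite mulrBl mul1r {1}sE; ring.
  have -> : ((1 - A) * (1 - E) - B * C) * p%:R =
    (1 - E) * ((1 - A) * p%:R) - B * (p%:R * C) by ring.
  by rewrite pE' -sE'; ring.
move/eqP; rewrite int_mul_eq0 natr_O_eq0 orbC gtn_eqF ?prime_gt0 ?residue_char_prime//=.
move=> /eqP ABCE.
have : A + E - A * E + B * C \in prime_ideal P.
  apply: rpredD; last exact: primeMr.
  by apply: rpredB; [exact: rpredD|exact: primeMr].
have -> : A + E - A * E + B * C = 1 - ((1 - A) * (1 - E) - B * C) by ring.
by rewrite ABCE subr0 prime1.
Qed.

End Ramification.

Lemma ideal_power2 (P : prime_of K) e x : (1 < e)%N -> ideal_power P e x -> ideal_power P 2 x.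
Proof.
case: e => [|[|e]]// _ [m [r [a [aP ->]]]].
exists m, (fun i => r i * \prod_(j < e) a i (lift ord0 (lift ord0 j))).
exists (fun i j => if j == ord0 then a i ord0 else a i (lift ord0 ord0)); split.
  by move=> i j; case: ifP.
apply: eq_bigr => i _; rewrite !big_ord_recl big_ord0 /= mulr1 -!mulrA.
by congr (_ * _); rewrite mulrA mulrC.
Qed.

(** [p] always lies in [P], so if it were outside [P^2] the exponent [1] would qualify and be the
    only one. The fallback [0] of [xget] is covered too. *)
Lemma ramified_ideal_power2 (P : prime_of K) : ramification_index P != 1%N ->
  ideal_power P 2 (residue_char P)%:R.
Proof.
move=> e1; apply: contrapT => p2; move/eqP: e1; apply.
have pP := (residue_charP P).2.
have p1 : ideal_power P 1 (residue_char P)%:R.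
  exists 1%N, (fun=> 1), (fun _ _ => (residue_char P)%:R); split=> //.
  by rewrite !big_ord1 mul1r.
rewrite /ramification_index; case: xgetP => [e _ [pe pe1]|/(_ 1%N)[]//].
case: e pe pe1 => [_ //|[//|e] pe _].
by case: p2; exact: ideal_power2 pe.
Qed.

Lemma evO_neq0 (a : {poly int}) : (size a <= n)%N -> a != 0 -> evO a != 0.
Proof.
move=> an; apply: contra_neq => a0; apply: evO_inj => //; first by rewrite size_poly0.
by rewrite a0 rmorph0.
Qed.

(** [B] is [D] times an integer multiple [c] of [g'(t)]: outside the divisors of [D], [ramified_dvd]
    puts [g'(t)], hence [c], into [P]. *)
Lemma ramified_bound : exists2 B : int, B != 0 &
  forall P : prime_of K, inertia_degree P = 1%N -> ramification_index P != 1%N ->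
    (residue_char P %| B)%Z.
Proof.
have [D D0 DP] := conductor_exists.
have g'n : g^`()`_n.-1 = n%:R.
  rewrite coef_deriv prednK ?(adim_gt0 {:K}%AS)//.
  by have /monicP := gen_monic t; rewrite /lead_coef gen_size => ->.
have g'0 : g^`() != 0.
  apply/eqP => g'0; move: g'n; rewrite g'0 coef0 => /esym/eqP.
  by rewrite pnatr_eq0 gtn_eqF// (adim_gt0 {:K}%AS).
have g's : (size g^`() <= n)%N by rewrite -ltnS -(gen_size t) lt_size_deriv// monic_neq0// gen_monic.
have [y [c [yE c0]]] := dvd_int (evO_neq0 g's g'0).
exists (D * c) => [|P f1 /ramified_ideal_power2 p2].
  by rewrite mulf_neq0//; apply: contraNneq c0 => ->.
have [pD|pD] := boolP (residue_char P %| D)%Z; first exact: dvdz_mulr.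
apply: dvdz_mull; rewrite -prime_residue_charE -yE; apply: primeMl.
exact: ramified_dvd DP pD f1 p2.
Qed.

End Generator.

(** * Norms and primes *)

Lemma det_col_dvd (n f : nat) (p : int) (A : 'M[int]_n) : (f <= n)%N ->
  (forall i j : 'I_n, (j < f)%N -> (p %| A i j)%Z) -> (p ^+ f %| \det A)%Z.
Proof.
move=> fn pA.
pose d : 'rV[int]_n := \row_j (if (j < f)%N then p else 1).
pose A' : 'M[int]_n := \matrix_(i, j) (if (j < f)%N then (A i j %/ p)%Z else A i j).
have -> : A = A' *m diag_mx d.
  apply/matrixP => i j; rewrite mul_mx_diag !mxE.
  by case: ifP => [jf|_]; rewrite ?mulr1// divzK// pA.
rewrite det_mulmx det_diag dvdz_mull//.
under eq_bigr do rewrite mxE.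
by rewrite -big_mkcond/= -(big_ord_widen _ (fun=> p))// prodr_const card_ord.
Qed.

Lemma dvdz_sum_entries (p : int) (I : finType) (c e : I -> int) :
  (forall i, (p %| e i)%Z) -> (p %| \sum_i c i * e i)%Z.
Proof. by move=> pe; apply: rpred_sum => i _; exact: dvdz_mull. Qed.

(* [L] brings [E] to Smith form, and the first [f] columns of [A *m L] are then
   divisible by [p]. *)
Lemma det_dvd_exp (n f p : nat) (D : int) (A : 'M[int]_n) (E : 'M[int]_(n, f))
    (S : 'M[int]_(f, n)) :
    prime p -> (f <= n)%N -> ~~ (p %| D)%Z ->
    (forall i k, (p %| (A *m E) i k)%Z) ->
    (forall i k, (p %| (S *m E - D%:M) i k)%Z) ->
  ((p ^ f)%N %| \det A)%Z.
Proof.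
move=> p_pr fn pD pAE pSE; have pz : prime `|p%:Z| by rewrite absz_nat.
have [L Lu [R Ru [d _ EE]]] := int_Smith_normal_form E.
set De := \matrix_(i, j) _ in EE.
(* [S E] is [D] modulo [p], so the columns of [E] are independent modulo [p]: if [p] divided [d_k],
   the vector [w] would be killed by [E], hence by [D], modulo [p], although [R w] is a unit
   vector. *)
have pd (k : 'I_f) : ~~ (p %| d`_k)%Z.
  apply/negP => pdk.
  pose w : 'cV[int]_f := invmx R *m delta_mx k ord0.
  have pEw i : (p %| (E *m w) i ord0)%Z.
    rewrite /w EE -!mulmxA mulKVmx// mxE; apply: dvdz_sum_entries => j.
    rewrite mxE (bigD1 k)//= big1 ?addr0; last first.
      by move=> l lk; rewrite !mxE (negPf lk)/= mulr0.
    rewrite !mxE !eqxx mulr1; case: eqP => [->|_]; last by rewrite mulr0n dvdz0.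
    by rewrite mulr1n.
  have pw i : (p %| w i ord0)%Z.
    have : (p %| D * w i ord0)%Z.
      have -> : D * w i ord0 = (S *m (E *m w)) i ord0 - ((S *m E - D%:M) *m w) i ord0.
        by rewrite mulmxBl mul_scalar_mx -mulmxA !mxE; ring.
      rewrite rpredB//; first by rewrite mxE; exact: dvdz_sum_entries.
      rewrite mxE (eq_bigr (fun j => w j ord0 * (S *m E - D%:M) i j)).
        exact: dvdz_sum_entries.
      by move=> j _; rewrite mulrC.
    by rewrite !dvdzE abszM Euclid_dvdM// -!dvdzE (negPf pD).
  have : (p %| (R *m w) k ord0)%Z by rewrite mxE; exact: dvdz_sum_entries.
  by rewrite /w mulKVmx// mxE !eqxx dvdz1 absz_nat gtn_eqF// prime_gt1.
have : ((p : int) ^+ f %| \det (A *m L))%Z.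
  apply: det_col_dvd => // i j jf.
  have : (p %| (A *m L) i j * d`_j)%Z.
    have -> : (A *m L) i j * d`_j = ((A *m E) *m invmx R) i (Ordinal jf).
      rewrite EE -!mulmxA mulmxV// mulmx1 mulmxA [RHS]mxE (bigD1 j)//= big1.
        by rewrite addr0 !mxE eqxx.
      by move=> k kj; rewrite !mxE (_ : (_ == _ :> nat) = false) ?mulr0//; apply/negbTE.
    rewrite mxE (eq_bigr (fun k => invmx R k (Ordinal jf) * (A *m E) i k)).
      exact: dvdz_sum_entries.
    by move=> k _; rewrite mulrC.
  by rewrite !dvdzE abszM Euclid_dvdM// -!dvdzE (negPf (pd (Ordinal jf))) orbF.
rewrite det_mulmx => pAL; have : (p : int) ^+ f = (p ^ f)%N by rewrite -[RHS]natz natrX natz.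
move=> <-; move: Lu; rewrite unitmxE => Lu.
by rewrite -(mulrK Lu (\det A)) dvdz_mulr.
Qed.

Lemma det_bound (n : nat) (B : nat) (A : 'M[int]_n) :
  (forall i j, (`|A i j| <= B)%N) -> (`|\det A| <= n`! * B ^ n)%N.
Proof.
move=> AB; rewrite -lez_nat abszE; apply: le_trans (ler_norm_sum _ _ _) _.
rewrite -natz -perm.card_Sn -sum_nat_const natr_sum.
apply: ler_sum => s _; rewrite normrM normrX normrN1 expr1n mul1r normr_prod.
rewrite natz -natz natrX -[X in _ <= _ ^+ X]card_ord -prodr_const.
by apply: ler_prod => i _; rewrite normr_ge0 -abszE natz lez_nat AB.
Qed.

(** * Norms in the order generated by [t] *)

Section Norm.
Variable K : fieldExtType rat.
Local Notation O := (ring_of_integers K).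
Local Notation n := (\dim {:K}).
Variable t : integral_generator K.
Local Notation g := (gen_poly t).
Local Notation M := (mulmodmx n g).

(** The norm from [K] to [Q] of [a(t)]. *)
Definition gen_norm (a : {poly int}) : int := \det (M a).

Lemma evO_eq0 (a : {poly int}) : evO t a = 0 -> M a = 0.
Proof.
move=> a0; apply/matrixP => i j; rewrite !mxE.
suff -> : Pdiv.Ring.rmodp (a * 'X^i) g = 0 by rewrite coef0.
apply: (@evO_inj _ t); rewrite ?size_poly0//.
  exact: size_rmodp_monic (gen_monic t) (gen_size t) _.
by rewrite evO_rmodp evOM a0 mul0r rmorph0.
Qed.

Lemma evO_poly (a : {poly int}) : (size a <= n)%N ->
  evO t a = \sum_(j < n) (a`_j)%:~R * gen t ^+ j.
Proof.
move=> an; rewrite {1}(poly_sum_coef an) rmorph_sum; apply: eq_bigr => j _.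
by rewrite -mul_polyC rmorphM/= evO_C rmorphXn/= evO_X.
Qed.

(** A left kernel vector of [M a] is the coordinate vector of a nonzero element annihilated by
    [a(t)] in the domain [O]. *)
Lemma gen_norm_eq0 (a : {poly int}) : (size a <= n)%N -> gen_norm a = 0 -> a = 0.
Proof.
move=> an /eqP /det0P[v v0 va]; apply: (evO_inj (t := t)); rewrite ?size_poly0//.
rewrite rmorph0; have vn : (size (rVpoly v) <= n)%N by exact: size_poly.
have : evO t a * evO t (rVpoly v) == 0.
  rewrite (evO_poly vn) mulr_sumr; apply/eqP.
  transitivity (\sum_j ((v *m M a) 0 j)%:~R * gen t ^+ j).
    under [RHS]eq_bigr do rewrite mxE rmorph_sum mulr_suml.
    rewrite exchange_big/=; apply: eq_bigr => i _.
    rewrite mulrCA -mulmodmx_coord mulr_sumr coef_rVpoly_ord; apply: eq_bigr => j _.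
    by rewrite rmorphM/= mulrA.
  by rewrite va big1// => j _; rewrite mxE mul0r.
rewrite int_mul_eq0 => /orP[/eqP//|]; apply: contraTeq => _.
apply: evO_neq0 => //; apply: contra v0 => /eqP v0.
by rewrite -(rVpolyK v) v0 linear0.
Qed.

Lemma gen_norm_bound : exists2 C : nat, (0 < C)%N &
  forall (a : {poly int}) (m : nat), (size a <= n)%N ->
    (forall i, (`|(a`_i)%R| <= m)%N) -> (`|gen_norm a| <= C * m ^ n)%N.
Proof.
pose B := (\sum_(k < n) \sum_(i < n) \sum_(j < n) `|M 'X^k i j|)%N.
exists (n`! * B ^ n + 1)%N; first by rewrite addn1.
move=> a m an am; apply: leq_trans (_ : n`! * (m * B) ^ n <= _)%N; last first.
  by rewrite expnMn [(m ^ n * _)%N]mulnC mulnA leq_mul2r leq_addr orbT.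
apply: det_bound => i j; rewrite {1}(poly_sum_coef an) mulmodmx_sum ?gen_monic ?gen_size//.
rewrite summxE -lez_nat abszE; apply: le_trans (ler_norm_sum _ _ _) _.
rewrite -natz /B big_distrr/= natr_sum; apply: ler_sum => k _.
rewrite mulmodmxZ ?gen_monic// mxE normrM natz PoszM ler_pM// -abszE lez_nat//.
rewrite (bigD1 i)//= (bigD1 j)//= -addnA leq_addr//.
Qed.

(** The polynomial is the characteristic polynomial of [- M b]. Through it the counts on a line of
    the box become counts for a monic polynomial in one variable. *)
Lemma gen_norm_addC (b : {poly int}) : exists h : {poly int},
  [/\ h \is monic, size h = n.+1 & forall c, gen_norm (c%:P + b) = h.[c]].
Proof.
exists (char_poly (- M b)); split; rewrite ?char_poly_monic ?size_char_poly// => c.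
by rewrite /gen_norm det_mulmodmx_addC ?gen_monic ?gen_size.
Qed.

Variable D : int.
Hypothesis DP : forall x : O, exists a : {poly int}, D%:~R * x = evO t a.

(** Let [E] hold the coordinates of the [t^j] in a basis of [O / P], and let the other matrix hold
    those of the [D b_k] in the powers of [t]. The rows of [M a] represent elements of [P], so [p]
    divides [M a E]; the other matrix times [E] is [D] modulo [p], so [det_dvd_exp] applies. *)
Lemma gen_norm_dvd (P : prime_of K) (a : {poly int}) :
    ~~ (residue_char P %| D)%Z -> evO t a \in prime_ideal P ->
  (prime_norm P %| `|gen_norm a|)%N.
Proof.
move=> pD aP; have [b [bspan bind]] := inertia_basis P.
have /choice[e eP] (j : 'I_n) := bspan (gen t ^+ j).
have /choice[s sP] k : exists s : {poly int}, (size s <= n)%N /\ D%:~R * b k = evO t s.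
  have [s sE] := DP (b k); exists (Pdiv.Ring.rmodp s g); rewrite evO_rmodp; split=> //.
  exact: size_rmodp_monic (gen_monic t) (gen_size t) _.
pose E := \matrix_(j < n, k < inertia_degree P) e j k.
have evE (c : 'I_n -> int) :
    \sum_j (c j)%:~R * gen t ^+ j - \sum_k ((\row_j c j *m E) 0 k)%:~R * b k \in prime_ideal P.
  under [X in _ - X]eq_bigr do rewrite mxE rmorph_sum mulr_suml.
  rewrite exchange_big -sumrB; apply: rpred_sum => j _ /=.
  under eq_bigr do rewrite rmorphM/= -mulrA.
  rewrite -mulr_sumr !mxE -mulrBr; apply: primeMr.
  under eq_bigr do rewrite mxE; exact: eP.
rewrite -[X in (_ %| X)%N]/(`|_|)%N /prime_norm.
have := @det_dvd_exp _ _ (residue_char P) D (M a) E (\matrix_(k, j) (s k)`_j).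
rewrite dvdzE/=; apply=> //; rewrite ?residue_char_prime ?inertia_degree_leq_dim//.
  move=> i k; have := bind (fun k => (M a *m E) i k); apply.
  have := evE (fun j => M a i j); rewrite mulmodmx_coord => aE.
  have -> : \sum_k ((M a *m E) i k)%:~R * b k = \sum_k ((\row_j M a i j *m E) 0 k)%:~R * b k.
    apply: eq_bigr => l _; congr (_%:~R * _); rewrite !mxE.
    by apply: eq_bigr => j _; rewrite !mxE.
  by rewrite -[X in X \in _](subKr (evO t a * gen t ^+ i)) rpredB// primeMl.
move=> k l; apply: (bind (fun l => ((\matrix_(k, j) (s k)`_j) *m E - D%:M) k l)).
have [sn sE] := sP k; have := evE (fun j => (s k)`_j).
set T := (X in X \in _ -> _); set U := (X in _ -> X \in _).
suff -> : U = - T by rewrite rpredN.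
rewrite /T -evO_poly// -sE.
pose DM : 'M[int]_(inertia_degree P) := D%:M.
have -> : D%:~R * b k = \sum_l (DM k l)%:~R * b l.
  rewrite (bigD1 k)//= big1 ?addr0; first by rewrite mxE eqxx mulr1n.
  by move=> l' lk; rewrite mxE eq_sym (negPf lk) mulr0n mul0r.
have UE (W W' : 'M[int]_(inertia_degree P)) l' : (W - W') k l' = W k l' - W' k l'.
  by rewrite !mxE.
rewrite opprB -sumrB /U; apply: eq_bigr => l' _; rewrite UE rmorphB mulrBl -/DM.
congr (_%:~R * _ - _); rewrite !mxE; apply: eq_bigr => j _.
by rewrite !mxE.
Qed.

(** If [p] and [a(t)] generated the unit ideal, multiplying by [D] would give [p X + a Y = D] in
    [Z[t]]. Since [p] divides the norm of [a], taking determinants modulo [p] yields [0 = D^n] up to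
    sign, although [p] does not divide [D]. *)
Lemma exists_prime_gen_norm (p : nat) (a : {poly int}) :
    prime p -> ~~ (p %| D)%Z -> (p %| gen_norm a)%Z ->
  exists2 P : prime_of K, lies_above P p & evO t a \in prime_ideal P.
Proof.
move=> p_pr pD pa.
pose I0 : {pred O} := fun z => `[< exists x y, z = p%:R * x + evO t a * y >].
pose S1 : {pred O} := pred1 1.
have [||c|||z|Q [Qi Qp I0Q QS _]] := @exists_prime_avoiding K I0 S1.
- by apply/asboolP; exists 0, 0; rewrite !mulr0 addr0.
- move=> _ _ /asboolP[x [y ->]] /asboolP[x' [y' ->]]; apply/asboolP.
  by exists (x - x'), (y - y'); ring.
- move=> _ /asboolP[x [y ->]]; apply/asboolP.
  by exists (c * x), (c * y); ring.
- by rewrite inE.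
- by move=> x y; rewrite !inE => /eqP -> /eqP ->; rewrite mulr1.
- move=> /asboolP[x [y ->]]; rewrite inE; apply/negP => /eqP xy1.
  have [X XE] := DP x; have [Y YE] := DP y.
  have : evO t (p%:Z%:P * X + a * Y - D%:P) = 0.
    rewrite evOB evOD !evOM !evO_C -XE -YE -pmulrn.
    have -> : p%:R * (D%:~R * x) + evO t a * (D%:~R * y) - D%:~R =
      D%:~R * (p%:R * x + evO t a * y) - D%:~R by ring.
    by rewrite xy1 mulr1 subrr.
  move=> /evO_eq0; rewrite -polyCN !(mulmodmxD, mulmodmxM, mulmodmxC) ?gen_monic ?gen_size//.
  move=> /eqP; rewrite addr_eq0 => /eqP.
  move/(congr1 (map_mx (intr : int -> 'F_p)))/(congr1 (fun A => \det A)).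
  have p0 : (p%:Z%:~R : 'F_p) = 0 by apply/eqP; rewrite intr_Fp_eq0.
  rewrite map_mxD !map_mxM !map_scalar_mx/= map_mxN map_scalar_mx/= p0 raddf0 mul0mx add0r.
  rewrite det_mulmx det_map_mx [X in X * _](_ : _ = 0); last first.
    by apply/eqP; rewrite intr_Fp_eq0.
  rewrite mul0r -raddfN det_scalar => /esym/eqP; rewrite expf_eq0 => /andP[_].
  by rewrite rmorphN opprK intr_Fp_eq0// (negPf pD).
have pQ : (p%:R : O) \in Q.
  by apply: I0Q; apply/asboolP; exists 1, 0; rewrite mulr1 mulr0 addr0.
have Q0 : exists2 z : O, z \in Q & z != 0.
  by exists p%:R => //; rewrite natr_O_eq0 -lt0n prime_gt0.
exists (PrimeOf Qi Qp Q0) => //.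
by apply: I0Q; apply/asboolP; exists 0, 1; rewrite mulr1 mulr0 add0r.
Qed.

End Norm.

(** * Divergence of the sum of inverse norms *)

Section Counting.
Local Close Scope classical_set_scope.

Lemma card_modulo (q Y : nat) (a : int) : (0 < q)%N ->
  (#|[set x : 'I_Y | (q %| ((x : nat)%:Z - a)%R)%Z]| <= Y %/ q + 1)%N.
Proof.
move=> q0; set A := [set x | _].
have lt (x : 'I_Y) : (x %/ q < Y %/ q + 1)%N.
  by rewrite addn1 ltnS leq_div2r// ltnW.
pose f x : 'I_(Y %/ q + 1) := Ordinal (lt x).
rewrite -[X in (_ <= X)%N]card_ord -(card_in_imset (f := f)) ?max_card//.
move=> x y; rewrite !inE => xa ya /(congr1 val)/= xy; apply: val_inj => /=.
have : (q %| ((x : nat)%:Z - (y : nat)%:Z)%R)%Z.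
  have -> : (x : nat)%:Z - (y : nat)%:Z = ((x : nat)%:Z - a) - ((y : nat)%:Z - a) by ring.
  exact: rpredB.
by rewrite -eqz_mod_dvd !modz_nat eqz_nat => /eqP xyq; rewrite (divn_eq x q) (divn_eq y q) xy xyq.
Qed.

(* If [p ^ (n s + 1)] divides [h x] and [h a], then either [x] and [a] agree
   modulo [p ^ (s + 1)], or the quotient of [h - h a] by ['X - a], of degree
   [n - 1], vanishes at [x] modulo [p ^ ((n - 1) s + 1)]. *)
Lemma card_root_mod (p s n Y : nat) (h : {poly int}) : prime p ->
    h \is monic -> size h = n.+1 ->
  (#|[set x : 'I_Y | ((p ^ (n * s + 1))%N %| h.[(x : nat)%:Z])%Z]| <=
     n * (Y %/ p ^ s.+1 + 1))%N.
Proof.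
move=> p_pr; elim: n h => [|n IHn] h hm hs.
  rewrite mul0n add0n expn1 leqn0 cards_eq0; apply/eqP/setP => x; rewrite !inE.
  have /size_poly1P[c c0 hc] : size h == 1%N by rewrite hs.
  move: hm; rewrite hc monicE lead_coefC => /eqP ->.
  by rewrite hornerC dvdz1 absz_nat gtn_eqF ?prime_gt1.
set A := [set x | _]; have [->|[a aA]] := set_0Vmem A; first by rewrite cards0.
pose z := (a : nat)%:Z.
have : root (h - (h.[z])%:P) z by rewrite rootE !hornerE subrr.
case/factor_theorem => k kE.
have hE : h = k * ('X - z%:P) + (h.[z])%:P by rewrite -kE subrK.
have k0 : k != 0.
  by apply/eqP => k0; move: hs; rewrite hE k0 mul0r add0r size_polyC; case: eqP.
have ks : size k = n.+1.
  move: hs; rewrite hE size_polyDl size_Mmonic ?monicXsubC// size_XsubC ?addn2/=.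
    by case.
  by rewrite size_polyC; case: eqP => //= _; rewrite ltnS size_poly_gt0.
have km : k \is monic.
  move: hm; rewrite hE !monicE lead_coefDl ?lead_coef_Mmonic ?monicXsubC//.
  rewrite size_Mmonic ?monicXsubC// size_XsubC addn2/= size_polyC.
  by case: eqP => //= _; rewrite ltnS size_poly_gt0.
have sub : A \subset [set x : 'I_Y | ((p ^ s.+1)%N %| ((x : nat)%:Z - z)%R)%Z] :|:
    [set x : 'I_Y | ((p ^ (n * s + 1))%N %| k.[(x : nat)%:Z])%Z].
  apply/fintype.subsetP => x; rewrite !inE => hx.
  have : ((p ^ (n.+1 * s + 1))%N %| (k.[(x : nat)%:Z] * ((x : nat)%:Z - z))%R)%Z.
    have -> : k.[(x : nat)%:Z] * ((x : nat)%:Z - z) = h.[(x : nat)%:Z] - h.[z].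
      by rewrite {1}hE !hornerE; ring.
    by rewrite rpredB//; move: aA; rewrite inE.
  case: (boolP (_ %| ((x : nat)%:Z - z)%R)%Z) => //= xz; rewrite !dvdzE !abszM !absz_nat.
  have xz0 : (0 < `|((x : nat)%:Z - z)%R|)%N.
    by rewrite absz_gt0; apply: contraNneq xz => ->.
  have [->|k0'] := posnP `|k.[(x : nat)%:Z]|%N; first by [].
  rewrite !pfactor_dvdn ?muln_gt0 ?k0'// lognM//.
  move: xz; rewrite dvdzE absz_nat pfactor_dvdn// -ltnNge mulSn.
  lia.
rewrite (leq_trans (subset_leq_card sub))// (leq_trans (leq_card_setU _ _))//.
by rewrite mulSn leq_add ?IHn// card_modulo// expn_gt0 prime_gt0.
Qed.

Lemma card_poly_value (n Y : nat) (h : {poly int}) (v : int) :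
  (0 < n)%N -> size h = n.+1 -> (#|[set x : 'I_Y | h.[(x : nat)%:Z] == v]| <= n)%N.
Proof.
move=> n0 hs; have hv : size (h - v%:P) = n.+1.
  by rewrite size_polyDl// size_polyN hs size_polyC; case: eqP.
have hv0 : h - v%:P != 0 by rewrite -size_poly_eq0 hv.
rewrite cardE -(size_map (fun x : 'I_Y => (x : nat)%:Z)) -ltnS -hv.
apply: max_poly_roots => //; last first.
  by rewrite map_inj_uniq ?enum_uniq// => x y [] /val_inj.
apply/allP => _ /mapP[x xh ->]; move: xh; rewrite mem_enum inE rootE !hornerE.
by move=> /eqP ->; rewrite subrr.
Qed.

Lemma card_bigcup_leq (I T : finType) (A : I -> {set T}) (k : nat) :
  (forall i, (#|A i| <= k)%N) -> (#|\bigcup_i A i| <= #|I| * k)%N.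
Proof.
move=> Ak; rewrite -sum_nat_const.
apply: leq_trans (_ : \sum_i #|A i| <= _)%N; last exact: leq_sum.
elim/big_ind2: _ => [|m1 A1 m2 A2 H1 H2|//]; first by rewrite cards0.
by rewrite (leq_trans (leq_card_setU _ _))// leq_add.
Qed.

Lemma card_poly_small (n Y m : nat) (h : {poly int}) :
  (0 < n)%N -> size h = n.+1 ->
  (#|[set x : 'I_Y | (`|(h.[(x : nat)%:Z])%R| <= m)%N]| <= (m + m).+1 * n)%N.
Proof.
move=> n0 hs; pose A (v : 'I_(m + m).+1) := [set x : 'I_Y | h.[(x : nat)%:Z] == (v : nat)%:Z - m%:Z].
have sub : [set x : 'I_Y | (`|(h.[(x : nat)%:Z])%R| <= m)%N] \subset \bigcup_v A v.
  apply/fintype.subsetP => x; rewrite inE => hx; apply/finset.bigcupP.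
  have lt : (absz (h.[(x : nat)%:Z] + m%:Z)%R < (m + m).+1)%N by lia.
  by exists (Ordinal lt) => //; rewrite inE /=; apply/eqP; lia.
rewrite (leq_trans (subset_leq_card sub))// -[X in (X * _)%N]card_ord.
by apply: card_bigcup_leq => v; exact: card_poly_value.
Qed.

Lemma card_slices (A B : finType) (S : {set A * B}) (k : nat) :
  (forall b, (#|[set a | (a, b) \in S]| <= k)%N) -> (#|S| <= #|B| * k)%N.
Proof.
move=> Sk; pose T b := [set (a, b) | a in [set a | (a, b) \in S]].
have sub : S \subset \bigcup_b T b.
  apply/fintype.subsetP => -[a b] ab; apply/finset.bigcupP; exists b => //.
  by apply/imsetP; exists a => //; rewrite inE.
rewrite (leq_trans (subset_leq_card sub))//; apply: card_bigcup_leq => b.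
exact: leq_trans (leq_imset_card _ _) (Sk b).
Qed.

(* Cells of side [m] contain at most one element of [S]. *)
Lemma card_cells (n' Y m : nat) (S : {set 'I_Y * {ffun 'I_n' -> 'I_Y}}) : (0 < m)%N ->
    (forall u v, u \in S -> v \in S -> (`|((u.1 : nat)%:Z - (v.1 : nat)%:Z)%R| < m)%N ->
      (forall i, (`|((u.2 i : nat)%:Z - (v.2 i : nat)%:Z)%R| < m)%N) -> u = v) ->
  (#|S| <= (Y %/ m + 1) ^ n'.+1)%N.
Proof.
move=> m0 Su.
have lt (x : 'I_Y) : (x %/ m < Y %/ m + 1)%N.
  by rewrite addn1 ltnS leq_div2r// ltnW.
pose c x : 'I_(Y %/ m + 1) := Ordinal (lt x).
pose f (u : 'I_Y * {ffun 'I_n' -> 'I_Y}) := (c u.1, [ffun i => c (u.2 i)]).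
have cE x y : c x = c y -> (`|((x : nat)%:Z - (y : nat)%:Z)%R| < m)%N.
  move=> /(congr1 val)/= xy; rewrite (divn_eq x m) (divn_eq y m) xy.
  by have := ltn_pmod x m0; have := ltn_pmod y m0; lia.
have finj : {in S &, injective f}.
  move=> u v uS vS fuv; have /cE uv1 := congr1 fst fuv.
  have /ffunP uv2 := congr1 snd fuv; apply: Su => // i.
  by have := uv2 i; rewrite !ffunE => /cE.
rewrite -(card_in_imset finj) (leq_trans (max_card _))//.
by rewrite card_prod card_ffun !card_ord expnS.
Qed.
End Counting.

(** * The box and its covering *)

Section Divergence.
Local Close Scope classical_set_scope.
Variable K : fieldExtType rat.
Local Notation O := (ring_of_integers K).
Local Notation n := (\dim {:K}).
Local Notation n' := (\dim {:K}).-1.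

(** The first coordinate, which becomes the constant coefficient, is set apart because the norm is
    monic in it; the other [n' = n - 1] coordinates select a line. *)
Definition box (Y : nat) : finType := ('I_Y * {ffun 'I_n' -> 'I_Y})%type.

Definition box_poly (Y : nat) (u : box Y) : {poly int} :=
  ((u.1 : nat)%:Z)%:P +
  'X * \poly_(i < n') oapp (fun i => ((u.2 i : 'I_Y) : nat)%:Z) 0 (insub i).

Let nE : n = n'.+1. Proof. by rewrite prednK// (adim_gt0 {:K}%AS). Qed.

Lemma coef_box_poly0 Y (u : box Y) : (box_poly u)`_0 = (u.1 : nat)%:Z.
Proof. by rewrite coefD coefC coefXM addr0. Qed.

Lemma coef_box_polyS Y (u : box Y) (i : 'I_n') :
  (box_poly u)`_i.+1 = (u.2 i : nat)%:Z.
Proof. by rewrite coefD coefC coefXM add0r coef_poly ltn_ord valK. Qed.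

Lemma coef_box_poly_ge Y (u : box Y) i : (n <= i)%N -> (box_poly u)`_i = 0.
Proof.
rewrite nE; case: i => // i ni.
by rewrite coefD coefC coefXM add0r coef_poly ltnNge -ltnS ni.
Qed.

Lemma size_box_poly Y (u : box Y) : (size (box_poly u) <= n)%N.
Proof. by apply/leq_sizeP => i; exact: coef_box_poly_ge. Qed.

Lemma box_poly_inj Y : injective (@box_poly Y).
Proof.
move=> [u1 u2] [v1 v2] uv; congr (_, _).
  by apply: val_inj; have := congr1 (fun a : {poly int} => a`_0) uv; rewrite !coef_box_poly0 => -[].
apply/ffunP => i; apply: val_inj.
by have := congr1 (fun a : {poly int} => a`_i.+1) uv; rewrite !coef_box_polyS => -[].
Qed.

Lemma card_box Y : #|box Y| = (Y ^ n)%N.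
Proof. by rewrite card_prod card_ffun !card_ord -expnS -nE. Qed.

Variable t : integral_generator K.
Local Notation N := (gen_norm t).
Variables (C : nat) (D : int).
Hypothesis C0 : (0 < C)%N.
Hypothesis CP : forall (a : {poly int}) (m : nat), (size a <= n)%N ->
    (forall i, (`|(a`_i)%R| <= m)%N) -> (`|N a| <= C * m ^ n)%N.
Hypothesis D0 : D != 0.
Hypothesis DP : forall x : O, exists a : {poly int}, D%:~R * x = evO t a.

(** Take the largest [m] with [C m^n < q]. An element of [P] with coefficients at most [m] has a
    norm divisible by [q] and smaller than [q], so it is [0]; hence a cell of side [m] holds at most
    one point. For [m <= Y] the product of [(Y / m + 1)^n] and [C (m + 1)^n] is at most [C (4 Y)^n],
    as [Y / m + 1 <= 2 Y / m] and [m + 1 <= 2 m]. *)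
Lemma card_box_prime (P : prime_of K) Y :
    ~~ (residue_char P %| D)%Z -> (C < prime_norm P)%N ->
  (#|[set u : box Y | (evO t (box_poly u) \in prime_ideal P) && (box_poly u != 0%R)]|
     * prime_norm P <= 4 ^ n * C * Y ^ n)%N.
Proof.
clear D0; set q := prime_norm P => pD Cq; set S := [set u | _].
have n0 : (0 < n)%N by rewrite nE.
have ex1 : exists m, (C * m ^ n < q)%N by exists 1%N; rewrite exp1n muln1.
have bound m : (C * m ^ n < q)%N -> (m <= q)%N.
  move=> /ltnW; apply: leq_trans; apply: leq_trans (leq_pmull _ C0).
  case: m => // m; rewrite -{1}(expn1 m.+1); exact: leq_pexp2l.
case: (ex_maxnP ex1 bound) => m mq mmax.
have m0 : (0 < m)%N by apply: mmax; rewrite exp1n muln1.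
have qm : (q <= C * m.+1 ^ n)%N by rewrite leqNgt; apply/negP => /mmax; rewrite ltnn.
have norm0 (a : {poly int}) : (size a <= n)%N -> (forall i, (`|(a`_i)%R| <= m)%N) ->
    evO t a \in prime_ideal P -> a = 0.
  move=> an am aP; apply: (gen_norm_eq0 (t := t)) => //; apply/eqP.
  rewrite -absz_eq0; apply: contraTT mq => Na; rewrite -leqNgt.
  rewrite (leq_trans _ (CP an am))// dvdn_leq ?lt0n//.
  by have := gen_norm_dvd DP pD aP.
(* If [Y < m], all coefficients in the box are below [m], so only the excluded zero polynomial can
   lie in [P]. *)
have [mY|Ym] := leqP m Y; last first.
  suff -> : S = finset.set0 by rewrite finset.cards0.
  apply/eqP; rewrite -finset.subset0; apply/fintype.subsetP => u; rewrite inE => /andP[uP].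
  suff -> : box_poly u = 0 by rewrite eqxx.
  apply: norm0 => //; first exact: size_box_poly.
  move=> i; have [ni|] := leqP n i; first by rewrite coef_box_poly_ge.
  rewrite nE; case: i => [|i] ni; first by rewrite coef_box_poly0 absz_nat ltnW// (ltn_trans _ Ym).
  by rewrite (coef_box_polyS u (Ordinal (ni : (i < n')%N))) absz_nat ltnW// (ltn_trans _ Ym).
have Sm : (#|S| <= (Y %/ m + 1) ^ n)%N.
  rewrite [X in (_ <= _ ^ X)%N]nE; apply: card_cells => // u v.
  rewrite !inE => /andP[uP _] /andP[vP _] uv1 uv2; apply: box_poly_inj; apply/eqP.
  rewrite -subr_eq0; apply/eqP/norm0.
  - rewrite (leq_trans (size_polyD _ _))// size_polyN geq_max.
    by rewrite !size_box_poly.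
  - move=> i; have [ni|] := leqP n i; first by rewrite coefB !coef_box_poly_ge.
    rewrite nE; case: i => [|i] ni; first by rewrite coefB !coef_box_poly0 ltnW.
    by rewrite coefB !(coef_box_polyS _ (Ordinal (ni : (i < n')%N))) ltnW.
  - by rewrite evOB rpredB.
apply: leq_trans (leq_mul Sm qm) _.
rewrite mulnCA [(4 ^ n * C)%N]mulnC -mulnA leq_pmul2l// -!expnMn leq_exp2r//.
have := leq_trunc_div Y m; nia.
Qed.

Lemma card_box_exp (p s Y : nat) : prime p ->
  (#|[set u : box Y | ((p ^ (n * s + 1))%N %| N (box_poly u))%Z]|
     <= Y ^ n' * (n * (Y %/ p ^ s.+1 + 1)))%N.
Proof.
move=> p_pr; rewrite -[X in (X ^ _ * _)%N](card_ord Y) -[X in (_ ^ X * _)%N](card_ord n') -card_ffun.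
apply: card_slices => b.
pose b' := 'X * \poly_(i < n') oapp (fun i => ((b i : 'I_Y) : nat)%:Z) 0 (insub i).
have [h [hm hs hE]] := gen_norm_addC t b'.
apply: leq_trans (card_root_mod s Y p_pr hm hs); apply: subset_leq_card.
by apply/fintype.subsetP => a; rewrite !inE -hE.
Qed.

Lemma card_box_small (m Y : nat) :
  (#|[set u : box Y | (`|N (box_poly u)| <= m)%N]| <= Y ^ n' * ((m + m).+1 * n))%N.
Proof.
rewrite -[X in (X ^ _ * _)%N](card_ord Y) -[X in (_ ^ X * _)%N](card_ord n') -card_ffun.
apply: card_slices => b.
pose b' := 'X * \poly_(i < n') oapp (fun i => ((b i : 'I_Y) : nat)%:Z) 0 (insub i).
have [h [hm hs hE]] := gen_norm_addC t b'.
have n0 : (0 < n)%N by rewrite nE.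
apply: leq_trans (card_poly_small Y m n0 hs); apply: subset_leq_card.
by apply/fintype.subsetP => a; rewrite !inE -hE.
Qed.

(* The elements of the box are divisible by a prime of large norm, or by a high
   power of a small rational prime, or have bounded norm. *)
Lemma box_cover (z s Y : nat) (u : box Y) : (`|D| <= z)%N ->
  let m := (\prod_(p < z.+1 | prime p) p ^ (n * s + 1))%N in
  [\/ (`|N (box_poly u)| <= m)%N,
      exists2 p : 'I_z.+1, prime p & ((p ^ (n * s + 1))%N %| N (box_poly u))%Z |
      exists P : prime_of K, [/\ (z < prime_norm P)%N, ~~ (residue_char P %| D)%Z,
        evO t (box_poly u) \in prime_ideal P & box_poly u != 0]].
Proof.
move=> Dz m; have [->|Na0] := eqVneq (N (box_poly u)) 0; first by apply: Or31.
have u0 : box_poly u != 0.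
  apply: contra_neq Na0 => ->; rewrite /gen_norm (evO_eq0 (rmorph0 (evO t))).
  have := adim_gt0 {:K}%AS; rewrite /=; case: (\dim {:K}) => // k _; exact: det0.
have [[p [p_pr zp pN]]|H] := pselect (exists p, [/\ prime p, (z < p)%N & (p %| N (box_poly u))%Z]).
  have pD : ~~ (p %| D)%Z.
    rewrite dvdzE absz_nat; apply/negP => /dvdn_leq; rewrite absz_gt0 D0 => /(_ isT).
    by rewrite leqNgt (leq_ltn_trans Dz).
  have [P Pp uP] := exists_prime_gen_norm DP p_pr pD pN.
  apply: Or33; exists P; split=> //; last by rewrite (residue_char_eq p_pr Pp).
  rewrite (leq_trans zp)// /prime_norm (residue_char_eq p_pr Pp).
  apply: (leq_trans (_ : p <= p ^ 1)%N); first by rewrite expn1.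
  by rewrite leq_exp2l ?prime_gt1// inertia_degree_gt0.
have [[p p_pr pN]|H'] := pselect (exists2 p : 'I_z.+1, prime p &
    ((p ^ (n * s + 1))%N %| N (box_poly u))%Z); first by apply: Or32; exists p.
(* What remains has only prime factors up to [z], each with exponent at most [n s], so the norm
   divides [m]. *)
apply: Or31; have m0 : (0 < m)%N.
  by apply: prodn_cond_gt0 => p p_pr; rewrite expn_gt0 prime_gt0.
apply: dvdn_leq => //; have Npos : (0 < `|N (box_poly u)|)%N by rewrite absz_gt0.
apply/dvdn_partP => // p; rewrite mem_primes => /and3P[p_pr _ pN].
have pz : (p < z.+1)%N.
  rewrite ltnS leqNgt; apply/negP => zp; by apply: H; exists p.
rewrite p_part /m (bigD1 (Ordinal pz))//= dvdn_mulr// dvdn_exp2l//.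
rewrite leqNgt; apply/negP => ps; apply: H'; exists (Ordinal pz) => //=.
by rewrite dvdzE absz_nat pfactor_dvdn// ltnW.
Qed.

End Divergence.

Section DivergenceTheorem.
Variables (K : fieldExtType rat) (R : realType).
Local Notation n := (\dim {:K}).

Lemma leq_mul4_div (b c d : nat) : (b <= d * (c %/ (4 * d)) -> 4 * b <= c)%N.
Proof. by have := leq_trunc_div c (4 * d); nia. Qed.

(** The final count, with [y = Y^(n-1)], [Y = 2 (c + d) + 1] and [s = 4 c]: the three bounds add up
    to [y (2 Y + 4 (c + d))], which is below [4 y Y] because [2 (c + d) < Y]. *)
Lemma box_card_contra (y a1 a2 a3 c d : nat) : (0 < y)%N ->
  (a1 <= y * d -> 4 * a2 <= y * ((2 * (c + d)).+1 + 4 * c) ->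
   4 * a3 <= y * (2 * (c + d)).+1 ->
   4 * (y * (2 * (c + d)).+1) <= 4 * a1 + 4 * a2 + 4 * a3 -> False)%N.
Proof. nia. Qed.

(** Otherwise finite families of sum at least [e] could be chosen one after the other, each with
    weights beyond the maximum of the previous ones; they are disjoint, and enough of them exceed
    [B]. *)
Lemma small_tail (T : eqType) (w : T -> nat) (B e : R) : 0 < e ->
    (forall s : seq T, uniq s -> \sum_(x <- s) (w x)%:R^-1 <= B) ->
  exists z : nat, forall s : seq T, uniq s -> (forall x, x \in s -> (z < w x)%N) ->
    \sum_(x <- s) (w x)%:R^-1 <= e.
Proof.
move=> e0 sB; apply: contrapT => /forallNP H.
have {}H z : exists s : seq T, [/\ uniq s, (forall x, x \in s -> (z < w x)%N) &
    e <= \sum_(x <- s) (w x)%:R^-1].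
  have /existsNP[s /not_implyP[us /not_implyP[sz /negP]]] := H z.
  by rewrite -ltNge => /ltW es; exists s.
have Hk k : exists s : seq T, uniq s /\ e *+ k <= \sum_(x <- s) (w x)%:R^-1.
  elim: k => [|k [s [us es]]]; first by exists [::]; rewrite big_nil.
  have [s' [us' sz' es']] := H (\max_(x <- s) w x)%N.
  exists (s ++ s'); split; last by rewrite big_cat mulrSr lerD.
  rewrite cat_uniq us us' andbT; apply/hasPn => x /sz'; apply: contraTN => xs.
  by rewrite -leqNgt leq_bigmax_seq.
have [s [us es]] := Hk (Num.bound (B / e)).+1.
have := le_trans es (sB s us); apply/negP; rewrite -ltNge -mulr_natr.
rewrite mulrC -ltr_pdivrMr//.
have [B0|B0] := leP 0 (B / e); last by rewrite (lt_le_trans B0)// ler0n.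
apply: lt_trans (archi_boundP B0) _; by rewrite ltr_nat.
Qed.

Lemma sum_prime_norm_unbounded (B : R) : exists s : seq (prime_of K),
  uniq s /\ B < \sum_(P <- s) (prime_norm P)%:R^-1.
Proof.
apply: contrapT => /forallNP H.
have {}H (s : seq (prime_of K)) : uniq s -> \sum_(P <- s) (prime_norm P)%:R^-1 <= B.
  by move=> us; rewrite leNgt; apply/negP => Bs; apply: (H s).
have [t] := integral_generator_exists K.
have [C C0 CP] := gen_norm_bound t; have [D D0 DP] := conductor_exists t.
have k0 : (0 < 4 ^ n * C)%N by rewrite muln_gt0 expn_gt0.
(* With this bound on the tail, the estimates [4^n C Y^n / N(P)] of [card_box_prime] add up to at
   most a quarter of the box. *)
have [||z0 zP] := @small_tail (prime_of K) (@prime_norm K) B (4 * (4 ^ n * C)%:R)^-1 => //.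
  by rewrite invr_gt0 mulr_gt0// ltr0n.
(* [z0] bounds the tail, [C] is required by [card_box_prime], and primes above [|D|] do not divide
   [D]. *)
pose z := (z0 + C + `|D|)%N.
have Dz : (`|D| <= z)%N by rewrite leq_addl.
(* As [p^(s+1) >= s], a small prime takes at most [1 / (4 (z + 1))] of the box up to lower order,
   and all of them together a quarter. [Y] is then chosen to absorb the terms of order [Y^(n-1)]. *)
pose s := (4 * (z.+1 * n))%N.
pose m := (\prod_(p < z.+1 | prime p) p ^ (n * s + 1))%N.
pose Y := (2 * (z.+1 * n + (m + m).+1 * n)).+1.
pose A1 : {set box K Y} := finset (fun u => (`|gen_norm t (box_poly u)| <= m)%N).
pose A2 (p : 'I_z.+1) : {set box K Y} :=
  finset (fun u => prime p && ((p ^ (n * s + 1))%N %| gen_norm t (box_poly u))%Z).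
pose bad (u : box K Y) (P : prime_of K) := [/\ (z < prime_norm P)%N, ~~ (residue_char P %| D)%Z,
        evO t (box_poly u) \in prime_ideal P & box_poly u != 0].
pose A3 : {set box K Y} := finset (fun u => `[< exists P, bad u P >]).
have cover : [set: box K Y]%SET \subset A1 :|: (\bigcup_p A2 p)%SET :|: A3.
  apply/fintype.subsetP => u _; rewrite !finset.inE.
  have [u1|[p p_pr up]|uP] := box_cover D0 DP s u Dz.
  - by rewrite u1.
  - apply/orP; left; apply/orP; right; apply/finset.bigcupP; exists p => //.
    by rewrite finset.inE p_pr.
  - by apply/orP; right; apply/asboolP.
have Y0 : (0 < Y)%N by [].
have YE : (Y ^ n = Y ^ n.-1 * Y)%N by rewrite -expnSr prednK// (adim_gt0 {:K}%AS).
have A1c : (#|A1| <= Y ^ n.-1 * ((m + m).+1 * n))%N by exact: card_box_small.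
have A2c p : (4 * (z.+1 * #|A2 p|) <= Y ^ n.-1 * (Y + s))%N.
  have [p_pr|p_pr] := boolP (prime p); last first.
    rewrite (_ : A2 p = finset.set0) ?finset.cards0 ?muln0//.
    by apply/finset.setP => u; rewrite !finset.inE (negPf p_pr).
  have : (#|A2 p| <= Y ^ n.-1 * (n * (Y %/ p ^ s.+1 + 1)))%N.
    apply: leq_trans (card_box_exp t s Y p_pr); apply: subset_leq_card.
    by apply/fintype.subsetP => u; rewrite !finset.inE p_pr.
  have sp : (s <= p ^ s.+1)%N.
    by rewrite ltnW// (ltn_trans (ltnSn s))// ltn_expl// prime_gt1.
  move: (leq_trunc_div Y (p ^ s.+1)) sp; rewrite /s.
  move: (p ^ _)%N (Y ^ _)%N (Y %/ _)%N (#|A2 p|) => a b c d.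
  move: (z.+1) n => e f ca fa db; rewrite (leq_trans (_ : _ <= 4 * (e * (b * (f * (c + 1)))))%N)//.
    by rewrite !leq_mul2l db !orbT.
  have -> : (4 * (e * (b * (f * (c + 1)))) = b * (c * (4 * (e * f)) + 4 * (e * f)))%N by lia.
  by rewrite leq_mul2l leq_add2r (leq_trans _ ca) ?orbT// leq_mul2l fa orbT.
pose S (P : prime_of K) : {set box K Y} := finset (fun u =>
  (evO t (box_poly u) \in prime_ideal P) && (box_poly u != 0)).
have A3c : (4 * #|A3| <= Y ^ n)%N.
  have /choice[P PP] (u : box K Y) : exists P : option (prime_of K),
      u \in A3 -> exists2 Q, P = Some Q & bad u Q.
    have [|uA] := boolP (u \in A3); last by exists None.
    by rewrite finset.inE => /asboolP[Q uQ]; exists (Some Q) => _; exists Q.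
  pose ps := undup (pmap P (enum A3)).
  have psP Q : Q \in ps -> exists u, bad u Q.
    rewrite mem_undup mem_pmap => /mapP[u]; rewrite mem_enum => uA QE.
    by exists u; have [Q' Q'E] := PP u uA; rewrite Q'E in QE; case: QE => ->.
  have sub : A3 \subset (\bigcup_(Q <- ps) S Q)%SET.
    apply/fintype.subsetP => u uA; have [Q QE uQ] := PP u uA.
    have Qps : Q \in ps.
      by rewrite mem_undup mem_pmap; apply/mapP; exists u; rewrite ?mem_enum.
    rewrite (big_rem Q)//= finset.inE finset.inE.
    by have [_ _ -> ->] := uQ.
  have cS (r : seq (prime_of K)) : (#|(\bigcup_(Q <- r) S Q)%SET| <= \sum_(Q <- r) #|S Q|)%N.
    elim/big_ind2: _ => [|m1 B1 m2 B2 H1 H2|//]; first by rewrite finset.cards0.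
    by rewrite (leq_trans (leq_card_setU _ _))// leq_add.
  have := leq_trans (subset_leq_card sub) (cS ps).
  rewrite -(ler_nat R) natr_sum => A3S; rewrite -(ler_nat R) natrM.
  have bnd : \sum_(Q <- ps) #|S Q|%:R <= \sum_(Q <- ps) (4 ^ n * C * Y ^ n)%:R * (prime_norm Q)%:R^-1 :> R.
    rewrite big_seq [leRHS]big_seq; apply: ler_sum => Q Qps.
    have [u [zQ QD _ _]] := psP Q Qps.
    rewrite ler_pdivlMr ?ltr0n ?(leq_trans _ (prime_norm_gt1 Q))//.
    have CQ : (C < prime_norm Q)%N.
      by apply: leq_ltn_trans zQ; rewrite /z -addnA addnCA leq_addr.
    by rewrite -natrM ler_nat; have := card_box_prime C0 CP DP Y QD CQ.
  have tail : \sum_(Q <- ps) (prime_norm Q)%:R^-1 <= (4 * (4 ^ n * C)%:R)^-1 :> R.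
    apply: zP; first exact: undup_uniq.
    move=> Q /psP[u [zQ _ _ _]]; apply: leq_ltn_trans zQ.
    by rewrite /z -addnA leq_addr.
  rewrite -mulr_sumr in bnd; have := le_trans A3S bnd.
  have k0R : 0 < (4 ^ n * C)%:R :> R by rewrite ltr0n.
  have Yn0 : 0 <= (Y ^ n)%:R :> R by rewrite ler0n.
  rewrite natrM => A3b; have : (4 ^ n * C)%:R * (Y ^ n)%:R * \sum_(Q <- ps) (prime_norm Q)%:R^-1
      <= (Y ^ n)%:R / 4 :> R.
    apply: le_trans (ler_wpM2l _ tail) _; first by rewrite mulr_ge0// ltW.
    by rewrite [4 * _]mulrC invfM mulrA [_ * (Y ^ n)%:R]mulrC mulfK ?gt_eqF.
  move=> /(le_trans A3b); rewrite ler_pdivlMr ?ltr0n// mulrC; exact.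
have := subset_leq_card cover; rewrite finset.cardsT card_box => cov.
have A2s : (#|(\bigcup_p A2 p)%SET| <= z.+1 * ((Y ^ n.-1 * (Y + s)) %/ (4 * z.+1)))%N.
  rewrite -[X in (X * _)%N]card_ord; apply: card_bigcup_leq => p.
  by rewrite leq_divRL// mulnC -mulnA.
have A2t : (4 * #|(\bigcup_p A2 p)%SET| <= Y ^ n.-1 * (Y + s))%N.
  exact: leq_mul4_div A2s.
have Yp : (0 < Y ^ n.-1)%N by rewrite expn_gt0 Y0.
have : (4 * Y ^ n <= 4 * #|A1| + 4 * #|(\bigcup_p A2 p)%SET| + 4 * #|A3|)%N.
  rewrite -!mulnDr leq_mul2l /= (leq_trans cov)// (leq_trans (leq_card_setU _ _))//.
  by rewrite leq_add2r leq_card_setU.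
move: A1c A2t A3c; rewrite YE /s /Y.
exact: box_card_contra.
Qed.

End DivergenceTheorem.

(** * Density of the primes of degree one *)

Section Density.
Variables (R : realType) (K : fieldExtType rat).
Local Notation n := (\dim {:K}).
Implicit Types (s : seq (prime_of K)).

(** Group the primes by residue characteristic: each group has at most [n] members by
    [primes_over_leq_dim]. *)
Lemma sum_residue_char_leq (v : nat -> R) (u : prime_of K -> R) (B : R) s :
    (forall m, 0 <= v m) -> (forall P, u P <= v (residue_char P)) ->
    (forall N, \sum_(m < N) v m <= B) -> uniq s ->
  \sum_(P <- s) u P <= n%:R * B.
Proof.
move=> v0 uv vB us; pose N := (\max_(P <- s) residue_char P).+1.
have lt P : P \in s -> (residue_char P < N)%N by move=> Ps; rewrite ltnS leq_bigmax_seq.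
apply: le_trans (ler_wpM2l (ler0n _ n) (vB N)).
apply: le_trans (_ : \sum_(P <- s) v (residue_char P) <= _); first exact: ler_sum.
rewrite big_seq (partition_big (fun P => inord (residue_char P) : 'I_N) xpredT)//=.
rewrite mulr_sumr; apply: ler_sum => m _.
rewrite (eq_bigr (fun=> v m)); last first.
  by move=> P /andP[Ps /eqP <-]; rewrite inordK// lt.
rewrite big_const_seq iter_addr_0 -[X in X <= _]mulr_natl ler_wpM2r// ler_nat.
rewrite -size_filter; case E : (seq.filter _ s) => [//|P0 s0]; rewrite -E.
have P0s : P0 \in seq.filter (fun P => (P \in s) && (inord (residue_char P) == m)) s.
  by rewrite E mem_head.
move: P0s; rewrite mem_filter => /andP[/andP[P0s /eqP P0m] _].
apply: (@primes_over_leq_dim _ (residue_char P0)).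
- exact: residue_char_prime.
- exact: filter_uniq.
- move=> P; rewrite mem_filter => /andP[/andP[Ps /eqP Pm] _].
  have -> : residue_char P0 = residue_char P.
    by rewrite -(inordK (lt _ Ps)) -(inordK (lt _ P0s)) P0m Pm.
  exact: (residue_charP P).2.
Qed.

Definition pseries_term (x : R) (m : nat) : R := if m == 0%N then 0 else m%:R `^ (- x).

Lemma pseries_term_ge0 x m : 0 <= pseries_term x m.
Proof. by rewrite /pseries_term; case: eqP => // _; exact: powR_ge0. Qed.

(** Dyadic blocks: the terms from [2^k] up to [2^(k+1)] add up to at most [r^k], where
    [r = 2^(1-x) < 1]. *)
Lemma pseries_bounded (x : R) : 1 < x ->
  exists B, forall N, \sum_(m < N) pseries_term x m <= B.
Proof.
move=> x1; pose r : R := 2 `^ (1 - x).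
have r0 : 0 < r by exact: powR_gt0.
have r1 : r < 1.
  rewrite /r /powR pnatr_eq0/= -[ltRHS]expR0 ltr_expR pmulr_llt0 ?subr_lt0//.
  by rewrite ln_gt0// ltr1n.
have dyadic k : \sum_(m < 2 ^ k) pseries_term x m <= \sum_(j < k) r ^+ j.
  elim: k => [|k IHk]; first by rewrite expn0 big_ord1 big_ord0 /pseries_term eqxx.
  rewrite big_ord_recr/= expnS mul2n -addnn -(big_mkord xpredT) (big_cat_nat _ (n := (2 ^ k)%N)) ?leq_addr//=.
  rewrite big_mkord lerD// -{1}[(2 ^ k)%N]add0n big_addn addnK big_mkord.
  apply: le_trans (_ : \sum_(m < 2 ^ k) (2 ^ k)%:R `^ (- x) <= _).
    apply: ler_sum => m _; rewrite /pseries_term addn_eq0 expn_eq0 andbF.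
    rewrite !powRN lef_pV2 ?posrE ?powR_gt0 ?ltr0n ?addn_gt0 ?expn_gt0 ?orbT//.
    by rewrite ge0_ler_powR ?nnegrE ?ler0n// ?ler_nat ?leq_addl// ltW// (lt_trans ltr01).
  rewrite sumr_const card_ord -[X in X <= _]mulr_natl.
  rewrite -{1}(powRr1 (ler0n R (2 ^ k))) -powRD; last by rewrite pnatr_eq0 expn_eq0 implybT.
  by rewrite natrX -(powR_mulrn k (ler0n R 2)) powRAC powR_mulrn// powR_ge0.
exists (1 - r)^-1 => N; apply: le_trans (_ : \sum_(m < 2 ^ N) pseries_term x m <= _).
  rewrite -!(big_mkord xpredT (pseries_term x)).
  rewrite [leRHS](big_cat_nat _ (n := N)) ?(ltnW (ltn_expl _ _))//= lerDl.
  by apply: sumr_ge0 => i _; exact: pseries_term_ge0.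
apply: le_trans (dyadic N) _.
have -> : \sum_(j < N) r ^+ j = (1 - r ^+ N) / (1 - r).
  have r1' : 1 - r != 0 by rewrite subr_eq0 gt_eqF.
  apply: (mulIf r1'); rewrite divfK// mulrC.
  by rewrite -opprB mulNr -subrX1 opprB.
by rewrite ler_pdivrMr ?subr_gt0// mulVf ?subr_eq0 ?gt_eqF// gerBl exprn_ge0// ltW.
Qed.

Lemma esum_le_fin (S : set (prime_of K)) (u : prime_of K -> R) (B : R) :
    (forall P, 0 <= u P) ->
    (forall s, uniq s -> (forall P, P \in s -> S P) -> \sum_(P <- s) u P <= B) ->
  (\esum_(P in S) (u P)%:E <= B%:E)%E.
Proof.
move=> u0 uB; apply: ge_ereal_sup => _ [X [Xfin XS] <-].
rewrite fsbig_finite//= sumEFin lee_fin; apply: uB; first exact: finmap.fset_uniq.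
by move=> P; rewrite in_fset_set// inE => /XS.
Qed.

Lemma esum_ge_seq (S : set (prime_of K)) (u : prime_of K -> R) s :
    (forall P, 0 <= u P) -> uniq s -> (forall P, P \in s -> S P) ->
  ((\sum_(P <- s) u P)%:E <= \esum_(P in S) (u P)%:E)%E.
Proof.
move=> u0 us sS; apply: esum_ge; exists [set` s]; first by split; [exact: finite_seq|move=> P /sS].
by rewrite -fsbig_seq// sumEFin.
Qed.

Local Notation w P x := ((prime_norm P)%:R `^ (- x) : R).

Lemma prime_norm_ge (P : prime_of K) : (residue_char P <= prime_norm P)%N.
Proof.
rewrite -[X in (X <= _)%N]expn1 /prime_norm leq_exp2l ?prime_gt1 ?residue_char_prime//.
exact: inertia_degree_gt0.
Qed.

Lemma norm_pow_leq (P : prime_of K) (x : R) : 0 <= x -> w P x <= pseries_term x (residue_char P).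
Proof.
move=> x0; have p0 := prime_gt0 (residue_char_prime P).
rewrite /pseries_term gtn_eqF// !powRN lef_pV2 ?posrE ?powR_gt0 ?ltr0n//; last first.
  exact: leq_trans (prime_norm_ge P).
by rewrite ge0_ler_powR ?nnegrE ?ler0n// ler_nat prime_norm_ge.
Qed.

Lemma prime_esum_fin (x : R) (S : set (prime_of K)) : 1 < x ->
  (\esum_(P in S) (w P x)%:E \is a fin_num)%E.
Proof.
move=> x1; have [B HB] := pseries_bounded x1.
rewrite ge0_fin_numE; last by apply: esum_ge0 => P _; rewrite lee_fin powR_ge0.
apply: le_lt_trans (ltry (n%:R * B)); apply: esum_le_fin => [P|s us _]; first exact: powR_ge0.
apply: (sum_residue_char_leq (pseries_term_ge0 x)) => // P.
by apply: norm_pow_leq; rewrite ltW// (lt_trans ltr01).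
Qed.

(** The bound is uniform in [x]: a prime with [f >= 2] contributes at most [p^-2], while a ramified
    one with [f = 1] has [p] dividing [b], hence [p <= |b|], and contributes at most [1]. The
    function [v] adds these two bounds. *)
Lemma non_degree_one_bounded : exists B : R, forall x, 1 < x ->
  (\esum_(P in ~` degree_one_primes K) (w P x)%:E <= B%:E)%E.
Proof.
have [t] := integral_generator_exists K; have [b b0 bP] := ramified_bound t.
have [B HB] : exists B, forall N, \sum_(m < N) pseries_term 2 m <= B.
  by apply: pseries_bounded; rewrite ltr1n.
pose v m := pseries_term 2 m + (m <= `|b|)%:R.
have v0 m : 0 <= v m by rewrite addr_ge0 ?pseries_term_ge0.
exists (n%:R * (B + `|b|.+1%:R)) => x x1.
(* Set to [0] on the degree-one primes, so that the bound by [v] holds at every prime. *)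
pose u P := if `[< degree_one_primes K P >] then 0 else w P x.
have x0 : 0 <= x by rewrite ltW// (lt_trans ltr01).
have -> : (\esum_(P in ~` degree_one_primes K) (w P x)%:E =
           \esum_(P in ~` degree_one_primes K) (u P)%:E)%E.
  by apply: eq_esum => P /asboolPn/negbTE Pn; rewrite /u Pn.
apply: esum_le_fin => [P|s us _]; first by rewrite /u; case: ifP; rewrite ?powR_ge0.
apply: (sum_residue_char_leq v0) => // [P|N].
  rewrite /u; case: asboolP => // Pn; have p_pr := residue_char_prime P.
  have N0 : 0 < (prime_norm P)%:R :> R by rewrite ltr0n (leq_trans _ (prime_norm_gt1 P)).
  have wN : w P x <= (prime_norm P)%:R^-1.
    rewrite powRN lef_pV2 ?posrE ?powR_gt0//; apply: le1r_powR; last exact: ltW.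
    by rewrite ler1n -(ltr0n R).
  have [f1|f1] := eqVneq (inertia_degree P) 1%N.
    have e1 : ramification_index P != 1%N by apply/eqP => e1; apply: Pn.
    have pb := bP P f1 e1.
    rewrite /v (_ : (residue_char P <= _)%N); last first.
      by rewrite dvdn_leq ?absz_gt0//; move: pb; rewrite dvdzE.
    rewrite (le_trans wN)// -[X in X <= _]add0r lerD ?pseries_term_ge0//.
    by rewrite invf_le1// ler1n -(ltr0n R).
  have f2 : (1 < inertia_degree P)%N by rewrite ltn_neqAle eq_sym f1 inertia_degree_gt0.
  rewrite (le_trans wN)// /v -[X in X <= _]addr0 lerD//.
  have p0 : 0 < (residue_char P)%:R :> R by rewrite ltr0n prime_gt0.
  rewrite /pseries_term gtn_eqF ?prime_gt0// powRN lef_pV2 ?posrE ?powR_gt0//.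
  rewrite powR_mulrn// -natrX ler_nat /prime_norm leq_exp2l// prime_gt1//.
rewrite big_split/= lerD//; first exact: HB.
rewrite -natr_sum ler_nat -(big_mkord xpredT (fun m => (m <= `|b|)%N : nat)).
rewrite -big_mkcond/= -(size_iota 0 `|b|.+1) sum1_count -size_filter.
apply: uniq_leq_size; first by rewrite filter_uniq// /index_iota iota_uniq.
by move=> m; rewrite mem_filter mem_iota => /andP[].
Qed.

(** For [N <= m] and [x - 1 < 1 / m] one has [N^(x-1) <= (2^m)^(1/m) = 2]. *)
Lemma norm_pow_half (P : prime_of K) (x : R) (m : nat) : (prime_norm P <= m)%N ->
  1 < x -> x < 1 + m%:R^-1 -> (prime_norm P)%:R^-1 / 2 <= w P x.
Proof.
move=> Pm x1 xm; have N0 : 0 < (prime_norm P)%:R :> R.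
  by rewrite ltr0n (leq_trans _ (prime_norm_gt1 P)).
have m0 : 0 < m%:R :> R by rewrite (lt_le_trans N0)// ler_nat.
rewrite powRN -invfM lef_pV2 ?posrE ?powR_gt0 ?mulr_gt0// -mulr_powRB1 ?(ltW N0)//; last first.
  exact: lt_trans x1.
rewrite ler_pM2l//; apply: le_trans (_ : (2 ^+ m) `^ (x - 1) <= _).
  rewrite ge0_ler_powR ?nnegrE ?exprn_ge0 ?(ltW N0)// ?subr_ge0 ?(ltW x1)//.
  by rewrite -natrX ler_nat (leq_trans Pm)// ltnW// ltn_expl.
rewrite -powR_mulrn// -powRrM -[leRHS]powRr1// ler_powR ?ler1n//.
by rewrite mulrC -ler_pdivlMr// mul1r lerBlDl ltW.
Qed.

(** The defect [1 - Z1 / (Z1 + Z2)] equals [Z2 / (Z1 + Z2)], where [Z2] stays bounded and the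
    denominator grows without bound as [x] tends to [1]. *)
Theorem degree_one_primes_density : has_density (degree_one_primes K) (1 : R).
Proof.
have [B HB] := non_degree_one_bounded.
apply/cvgrPdist_lt => e e0.
(* The factor [2] makes up for the half lost in [norm_pow_half]. *)
have [s [us sB]] := sum_prime_norm_unbounded K (2 * (`|B| / e + 1) : R).
pose m := (\max_(P <- s) prime_norm P).+1.
have mP P : P \in s -> (prime_norm P <= m)%N.
  by move=> Ps; rewrite ltnW// ltnS leq_bigmax_seq.
near=> x.
have x1 : 1 < x by near: x; exact: nbhs_right_gt.
have xm : x < 1 + m%:R^-1.
  by near: x; apply: nbhs_right_lt; rewrite ltrDl invr_gt0 ltr0n.
rewrite /prime_zeta; set S := degree_one_primes K.
have w0 (P : prime_of K) : 0 <= w P x by exact: powR_ge0.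
have finE := prime_esum_fin _ x1.
have ZE : \esum_(P in [set: prime_of K]) (w P x)%:E =
    (\esum_(P in S) (w P x)%:E + \esum_(P in ~` S) (w P x)%:E)%E.
  rewrite (esumID S) => [|P _]; last by rewrite lee_fin.
  by rewrite setTI setTI.
have ZB : `|B| / e + 1 <= fine (\esum_(P in [set: prime_of K]) (w P x)%:E).
  rewrite -lee_fin fineK ?finE//; apply: le_trans (esum_ge_seq w0 us _) => //.
  rewrite lee_fin; apply: le_trans (_ : \sum_(P <- s) (prime_norm P)%:R^-1 / 2 <= _).
    by rewrite -mulr_suml ler_pdivlMr// mulrC ltW.
  rewrite big_seq [leRHS]big_seq; apply: ler_sum => P Ps.
  exact: norm_pow_half (mP P Ps) x1 xm.
have ZrB : fine (\esum_(P in ~` S) (w P x)%:E) <= `|B|.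
  by rewrite -lee_fin fineK ?finE// (le_trans (HB x x1))// lee_fin ler_norm.
have Zr0 : 0 <= fine (\esum_(P in ~` S) (w P x)%:E).
  by rewrite fine_ge0// esum_ge0.
rewrite ZE fineD ?finE// in ZB *.
set Z1 := fine (\esum_(P in S) _) in ZB *; set Z2 := fine _ in ZB ZrB Zr0 *.
have Z0 : 0 < Z1 + Z2.
  by rewrite (lt_le_trans _ ZB)// ltr_wpDl// divr_ge0// ltW.
have -> : 1 - Z1 / (Z1 + Z2) = Z2 / (Z1 + Z2).
  by rewrite -{1}(divff (lt0r_neq0 Z0)) -mulrBl addrAC subrr add0r.
rewrite ger0_norm ?divr_ge0 ?(ltW Z0)// ltr_pdivrMr//.
apply: le_lt_trans ZrB _; rewrite -ltr_pdivrMl// mulrC.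
by apply: lt_le_trans ZB; rewrite ltrDl.
Unshelve. all: by end_near.
Qed.

End Density.

(** * Automorphisms of the algebraic closure *)

Section Extension.
Variables (K : fieldExtType rat) (L : closedFieldType) (iota : {rmorphism K -> L}).
Hypothesis algL : forall x : L, algebraicOver iota x.
Implicit Types (x y : L) (G : set (L * L)).

Lemma natr_L_neq0 m : (0 < m)%N -> (m%:R : L) != 0.
Proof.
move=> m0; rewrite -(rmorph_nat iota) fmorph_eq0.
by rewrite -(rmorph_nat (in_alg K)) fmorph_eq0 pnatr_eq0 -lt0n.
Qed.

(** [s] lists the roots of a polynomial over [K] that vanishes at [x]. Here [f] is a bare function,
    so that maps not yet known to be bijective are included. *)
Lemma algebraic_roots x : exists s : seq L,
  x \in s /\ forall f : L -> L, zmod_morphism f -> monoid_morphism f ->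
    (forall k, f (iota k) = iota k) -> {in s, forall y, f y \in s}.
Proof.
have [p p0 px] := algL x; have [s sE] := closed_field_poly_normal (map_poly iota p).
have p0' : lead_coef (map_poly iota p) != 0 by rewrite lead_coef_eq0 map_poly_eq0.
have rootE y : root (map_poly iota p) y = (y \in s).
  by rewrite sE rootZ// root_prod_XsubC.
exists s; split; first by rewrite -rootE.
move=> f fB fM fK y; rewrite -!rootE => /rootP py; apply/rootP.
pose F1 := GRing.isZmodMorphism.Build L L f fB.
pose F2 := GRing.isMonoidMorphism.Build L L f fM.
pose F : {rmorphism L -> L} := HB.pack f F1 F2.
rewrite -[f y]/(F y) -(rmorph0 F) -py -horner_map -map_poly_comp.
by congr (_ .[_]); apply: eq_map_poly => k /=; rewrite fK.
Qed.

(** An injective map of a finite stable set of roots into itself is onto, and every element lies in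
    such a set. *)
Lemma endomorphism_bij (f : L -> L) : zmod_morphism f -> monoid_morphism f ->
  (forall k, f (iota k) = iota k) -> bijective f.
Proof.
move=> fB fM fK.
pose F1 := GRing.isZmodMorphism.Build L L f fB.
pose F2 := GRing.isMonoidMorphism.Build L L f fM.
pose F : {rmorphism L -> L} := HB.pack f F1 F2.
have finj : injective f by exact: (fmorph_inj F).
have /choice[g gP] y : exists x, f x = y.
  have [s [ys fs]] := algebraic_roots y.
  have : y \in map f (undup s).
    have us : uniq (map f (undup s)) by rewrite map_inj_uniq ?undup_uniq.
    have sub : {subset map f (undup s) <= undup s}.
      by move=> _ /mapP[x xs ->]; rewrite mem_undup fs// -mem_undup.
    have [_ ->] := uniq_min_size us sub (eq_leq (esym (size_map _ _))).
    by rewrite mem_undup.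
  by case/mapP => x _ ->; exists x.
by exists g => // x; apply: finj; rewrite gP.
Qed.

(* Graphs of [K]-homomorphisms from a subring of [L] to [L]. *)
Definition hom_graph G : Prop :=
  [/\ forall k, G (iota k, iota k),
      forall u v, G u -> G v -> G (u.1 - v.1, u.2 - v.2),
      forall u v, G u -> G v -> G (u.1 * v.1, u.2 * v.2) &
      forall y, G (0, y) -> y = 0].

Definition poly_graph G (g h : {poly L}) : Prop := forall i, G (g`_i, h`_i).

Section Adjoin.
Variable G : set (L * L).
Hypothesis gG : hom_graph G.

Let GK k : G (iota k, iota k). Proof. by case: gG. Qed.
Let GB u v : G u -> G v -> G (u.1 - v.1, u.2 - v.2). Proof. by case: gG => _ + _ _; apply. Qed.
Let GM u v : G u -> G v -> G (u.1 * v.1, u.2 * v.2). Proof. by case: gG => _ _ + _; apply. Qed.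
Let G0 y : G (0, y) -> y = 0. Proof. by case: gG => _ _ _; apply. Qed.
Let G00 : G (0, 0). Proof. by have := GK 0; rewrite rmorph0. Qed.
Let G11 : G (1, 1). Proof. by have := GK 1; rewrite rmorph1. Qed.
Let GD u v : G u -> G v -> G (u.1 + v.1, u.2 + v.2).
Proof.
move=> Gu Gv; have := GB Gu (GB G00 Gv) => /=.
by rewrite !sub0r !opprK.
Qed.

Lemma poly_graphB g1 g2 h1 h2 : poly_graph G g1 g2 -> poly_graph G h1 h2 ->
  poly_graph G (g1 - h1) (g2 - h2).
Proof. by move=> g h i; rewrite !coefB; exact: GB (g i) (h i). Qed.

Lemma poly_graphM g1 g2 h1 h2 : poly_graph G g1 g2 -> poly_graph G h1 h2 ->
  poly_graph G (g1 * h1) (g2 * h2).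
Proof.
move=> g h i; rewrite !coefM.
elim/big_ind2: _ => // [a b c d Ga Gb|j _]; first exact: GD Ga Gb.
exact: GM (g j) (h _).
Qed.

Lemma poly_graphC u : G u -> poly_graph G u.1%:P u.2%:P.
Proof. by move=> Gu i; rewrite !coefC; case: ifP => //; case: u Gu. Qed.

Lemma poly_graphXn n : poly_graph G 'X^n 'X^n.
Proof. by move=> i; rewrite !coefXn; case: eqP. Qed.

Lemma poly_graph_map (p : {poly K}) : poly_graph G (map_poly iota p) (map_poly iota p).
Proof. by move=> i; rewrite !coef_map; exact: GK. Qed.

Lemma graph_poly (p : {poly K}) u : G u -> G ((map_poly iota p).[u.1], (map_poly iota p).[u.2]).
Proof.
move=> Gu; elim/poly_ind: p => [|p c IHp]; first by rewrite rmorph0 !horner0.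
rewrite rmorphD rmorphM/= map_polyX map_polyC !hornerE.
exact: GD (GM IHp Gu) (GK c).
Qed.

(** The inverse of an element algebraic over [K] is a polynomial in it, so the domain of the graph
    is a field. *)
Lemma graph_inv u : G u -> u.1 != 0 -> exists v, [/\ G v, u.1 * v.1 = 1 & u.2 * v.2 = 1].
Proof.
move=> Gu u0; have [p p0 pu] := algL u.1.
have {p p0 pu} [h [k [k0 hk]]] : exists (h : {poly K}) k,
    k != 0 /\ u.1 * (map_poly iota h).[u.1] = iota k.
  elim/poly_ind: p p0 pu => [|p c IHp]; first by rewrite eqxx.
  move=> pc0; rewrite rootE rmorphD rmorphM/= map_polyX map_polyC !hornerE => pu.
  have [c0|c0] := eqVneq c 0; last first.
    exists (- p), c; split=> //; rewrite rmorphN hornerN mulrN [u.1 * _]mulrC.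
    by move: pu; rewrite addr_eq0 => /eqP ->; rewrite opprK.
  have ic0 : iota c = 0 by apply/eqP; rewrite fmorph_eq0; apply/eqP.
  have {}pu : (map_poly iota p).[u.1] * u.1 + iota c == 0 by [].
  rewrite ic0 addr0 mulf_eq0 (negPf u0) orbF in pu.
  by apply: IHp => //; apply: contra_neq pc0 => ->; rewrite c0 mul0r add0r.
have Gv := GM (graph_poly h Gu) (GK k^-1).
exists ((map_poly iota h).[u.1] * iota k^-1, (map_poly iota h).[u.2] * iota k^-1).
have uv1 : u.1 * ((map_poly iota h).[u.1] * iota k^-1) = 1.
  by rewrite mulrA hk -rmorphM mulfV// rmorph1.
split=> //=; apply/eqP; rewrite -subr_eq0; apply/eqP/G0.
by have := GB (GM Gu Gv) G11; rewrite /= uv1 subrr.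
Qed.

Lemma graph_snd0 x : G (x, 0) -> x = 0.
Proof.
move=> Gx; apply/eqP; apply: contraT => x0.
by have [v [_ _ /eqP]] := graph_inv Gx x0; rewrite mul0r eq_sym oner_eq0.
Qed.

Variables (x x' : L) (m1 m2 : {poly L}).
Hypotheses (mG : poly_graph G m1 m2) (mm : m1 \is monic) (mx : root m1 x).
Hypothesis (m_min : forall g1 g2, poly_graph G g1 g2 -> g1 != 0 -> root g1 x ->
  (size m1 <= size g1)%N).
Hypothesis (mx' : root m2 x').

(** Division of [g1] by the minimal polynomial [m1] of [x], mirrored on the second components; each
    step removes the leading term of [g1]. It makes the assignment of [x'] to [x] well defined. *)
Lemma poly_graph_root g1 g2 : poly_graph G g1 g2 -> root g1 x -> root g2 x'.
Proof.
have [k] := ubnP (size g1); elim: k g1 g2 => // k IHk g1 g2 gk g gx.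
have [g10|g10] := eqVneq g1 0.
  suff -> : g2 = 0 by rewrite root0.
  by apply/polyP => i; rewrite coef0; apply: G0; have := g i; rewrite g10 coef0.
have sg := m_min g g10 gx.
pose c : L * L := (lead_coef g1, g2`_(size g1).-1).
have Gc : G c by exact: g.
pose d := (size g1 - size m1)%N.
pose f1 := c.1%:P * 'X^d * m1; pose f2 := c.2%:P * 'X^d * m2.
have fG : poly_graph G f1 f2.
  by apply: poly_graphM => //; apply: poly_graphM; [exact: poly_graphC|exact: poly_graphXn].
have f1s : size f1 = size g1.
  rewrite /f1 -mulrA size_Cmul ?lead_coef_eq0// mulrC size_Mmonic ?monicXn//.
    by rewrite size_polyXn addnS/= subnKC.
  exact: monic_neq0.
have f1l : lead_coef f1 = lead_coef g1.
  by rewrite /f1 !lead_coefM lead_coefC lead_coefXn (monicP mm) !mulr1.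
have IH : root (g2 - f2) x'.
  apply: (IHk (g1 - f1)); last 2 first.
  - exact: poly_graphB.
  - by rewrite rootE !hornerE (rootP gx) (rootP mx) !mulr0 subrr.
  apply: (leq_trans (n := size g1)); last exact: gk.
  have s0 : (0 < size g1)%N by rewrite size_poly_gt0.
  rewrite -(prednK s0) ltnS; apply/leq_sizeP => i; rewrite leq_eqVlt => /orP[/eqP <-|si].
    by rewrite coefB -/(lead_coef g1) -f1s -/(lead_coef f1) f1l subrr.
  by rewrite coefB !nth_default ?subrr// ?f1s -(prednK s0).
by move: IH; rewrite !rootE !hornerE (rootP mx') mulr0 subr0.
Qed.

Definition adjoin_graph : set (L * L) :=
  [set u | exists g1 g2, [/\ poly_graph G g1 g2, u.1 = g1.[x] & u.2 = g2.[x']]].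

Lemma adjoin_graph_hom : hom_graph adjoin_graph.
Proof.
split=> [k|u v|u v|y].
- exists (iota k)%:P, (iota k)%:P; split; rewrite ?hornerC//.
  exact: (@poly_graphC (_, _)).
- move=> [g1 [g2 [g -> ->]]] [h1 [h2 [h -> ->]]]; exists (g1 - h1), (g2 - h2).
  by split; rewrite ?hornerE//; exact: poly_graphB.
- move=> [g1 [g2 [g -> ->]]] [h1 [h2 [h -> ->]]]; exists (g1 * h1), (g2 * h2).
  by split; rewrite ?hornerE//; exact: poly_graphM.
- move=> [g1 [g2 [g /= /esym/rootP g1x ->]]]; apply/rootP; exact: poly_graph_root g g1x.
Qed.

Lemma sub_adjoin_graph : G `<=` adjoin_graph.
Proof.
by move=> u Gu; exists u.1%:P, u.2%:P; split; rewrite ?hornerC//; exact: poly_graphC.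
Qed.

Lemma mem_adjoin_graph : adjoin_graph (x, x').
Proof. by exists 'X, 'X; split; rewrite ?hornerX//; have := poly_graphXn 1; rewrite expr1. Qed.

End Adjoin.

Lemma min_poly_graph G x : hom_graph G -> exists m1 m2,
  [/\ poly_graph G m1 m2, m1 \is monic, root m1 x &
   forall g1 g2, poly_graph G g1 g2 -> g1 != 0 -> root g1 x -> (size m1 <= size g1)%N].
Proof.
move=> gG; pose D d := `[< exists g1 g2, [/\ poly_graph G g1 g2, g1 != 0, root g1 x & size g1 = d] >].
have exD : exists d, D d.
  have [p p0 px] := algL x; exists (size (map_poly iota p)); apply/asboolP.
  exists (map_poly iota p), (map_poly iota p); split=> //; first exact: poly_graph_map.
  by rewrite map_poly_eq0.
case: (ex_minnP exD) => d /asboolP[g1 [g2 [g g10 gx gd]]] dmin.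
have l0 : lead_coef g1 != 0 by rewrite lead_coef_eq0.
have [v [Gv v1 _]] := graph_inv gG (g (size g1).-1) l0.
have v0 : v.1 != 0 by apply: contra_eq_neq v1 => ->; rewrite mulr0 eq_sym oner_eq0.
exists (v.1%:P * g1), (v.2%:P * g2); split.
- by apply: poly_graphM => //; exact: poly_graphC.
- by rewrite monicE lead_coefM lead_coefC mulrC; apply/eqP.
- by rewrite rootE !hornerE (rootP gx) mulr0.
- move=> h1 h2 h h10 hx; rewrite size_Cmul// gd; apply: dmin; apply/asboolP.
  by exists h1, h2.
Qed.

(** For a maximal graph, the image of the minimal polynomial of any [x] over the domain has a root
    [x'] in [L], and [adjoin_graph] puts [x] into the domain; so the domain is [L]. *)
Lemma hom_graph_extend G : hom_graph G -> exists s : galois_group iota,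
  forall u, G u -> s u.1 = u.2.
Proof.
move=> gG; have [||H [GH gH Hmax]] := @Zorn_above _ hom_graph G => //.
  move=> C Cg [H CH] tot; split=> [k|u v|u v|y].
  - by exists H => //; have [+ _ _ _] := Cg _ CH; apply.
  - move=> [A CA Au] [B CB Bv]; have [_ AB _ _] := Cg _ CA; have [_ BB _ _] := Cg _ CB.
    by have [sub|sub] := tot _ _ CA CB; [exists B => //; apply: BB => //; exact: sub|
      exists A => //; apply: AB => //; exact: sub].
  - move=> [A CA Au] [B CB Bv]; have [_ _ AM _] := Cg _ CA; have [_ _ BM _] := Cg _ CB.
    by have [sub|sub] := tot _ _ CA CB; [exists B => //; apply: BM => //; exact: sub|
      exists A => //; apply: AM => //; exact: sub].
  - by move=> [A CA Ay]; have [_ _ _] := Cg _ CA; apply.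
have /choice[f fP] x : exists y, H (x, y).
  have [m1 [m2 [m mm mx mmin]]] := min_poly_graph x gH.
  have /closed_rootP[x' mx'] : size m2 != 1%N.
    have m1s : (1 < size m1)%N by rewrite (root_size_gt1 _ mx)// monic_neq0.
    apply/eqP => /eqP/size_poly1P[c c0 m2c].
    have := m (size m1).-1; rewrite -/(lead_coef m1) (monicP mm) m2c coefC.
    rewrite -[(size m1).-1]prednK -?subn1 ?subn_gt0//= => /(graph_snd0 gH)/eqP.
    by rewrite oner_eq0.
  exists x'; rewrite -(Hmax _ (sub_adjoin_graph gH x x')); first exact: mem_adjoin_graph.
  exact: (adjoin_graph_hom gH m mm mx mmin mx').
have [HK HB HM H0] := gH.
have Hf x y : H (x, y) -> f x = y.
  move=> Hxy; apply/eqP; rewrite -subr_eq0; apply/eqP/H0.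
  by have := HB _ _ (fP x) Hxy; rewrite /= subrr.
have fK k : f (iota k) = iota k by exact: Hf.
have fB : zmod_morphism f by move=> x y; apply: Hf; exact: HB (fP x) (fP y).
have fM : monoid_morphism f.
  split; first by have := fK 1; rewrite rmorph1.
  by move=> x y; apply: Hf; exact: HM (fP x) (fP y).
have fA : is_automorphism_over iota f by split=> //; exact: endomorphism_bij.
exists (GaloisElement fA) => u Gu /=; apply: Hf; apply: GH.
by case: u Gu.
Qed.

(** If the minimal polynomial [m1] of [x] over [K] had degree above [1], it would have a root [x']
    other than [x], being separable in characteristic [0], and sending [x] to [x'] would extend to
    an automorphism that moves [x]. *)
Lemma fixed_field x : (forall s : galois_group iota, s x = x) -> exists k, x = iota k.
Proof.
move=> fx; pose D : set (L * L) := [set u | exists k, u = (iota k, iota k)].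
have gD : hom_graph D.
  split=> [k|_ _ [k ->] [l ->]|_ _ [k ->] [l ->]|y [k []]].
  - by exists k.
  - by exists (k - l); rewrite rmorphB.
  - by exists (k * l); rewrite rmorphM.
  - by move=> <- ->.
have [m1 [m2 [m mm mx mmin]]] := min_poly_graph x gD.
have m12 : m2 = m1 by apply/polyP => i; have [k [-> ->]] := m i.
rewrite {}m12 in m; have m10 := monic_neq0 mm.
have [h mE] := factor_theorem _ _ mx.
have h0 : h != 0 by apply: contra_neq m10 => h0; rewrite mE h0 mul0r.
have ms : size m1 = (size h).+1 by rewrite mE size_Mmonic ?monicXsubC// size_XsubC addn2.
have [hs|hs] := eqVneq (size h) 1%N.
  have [k /(congr1 fst)/= kE] := m 0%N; exists (- k).
  move: mm mE kE; have /size_poly1P[c c0 ->] : size h == 1%N by rewrite hs.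
  move=> mm mE; move: mm; rewrite mE monicE lead_coefM lead_coefC lead_coefXsubC mulr1.
  move=> /eqP ->; rewrite mul1r coefB coefX coefC/= sub0r rmorphN => <-.
  by rewrite opprK.
have [x' hx'] := closed_rootP _ hs.
have hx : ~~ root h x.
  apply/negP => hx; have dx : root m1^`() x.
    by rewrite rootE mE derivM derivXsubC mulr1 !hornerE subrr mulr0 add0r (rootP hx).
  have dG : poly_graph D m1^`() m1^`().
    move=> i; have [k /(congr1 fst)/= kE] := m i.+1; exists (k *+ i.+1).
    by rewrite coef_deriv kE rmorphMn.
  have d0 : m1^`() != 0.
    apply/eqP => /(congr1 (fun g : {poly L} => g`_(size h).-1)).
    have sh : (0 < size h)%N by rewrite size_poly_gt0.
    rewrite coef_deriv coef0 prednK// -[size h]/(_.+1.-1) -ms -/(lead_coef m1).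
    by rewrite (monicP mm) ms => /eqP; apply/negP; rewrite natr_L_neq0.
  have := mmin _ _ dG d0 dx; rewrite leqNgt lt_size_deriv//.
have mx' : root m1 x' by rewrite mE rootM hx'.
have [s sE] := hom_graph_extend (adjoin_graph_hom gD m mm mx mmin mx').
have := sE _ (mem_adjoin_graph gD x x'); rewrite /= fx => xx'.
by rewrite xx' hx' in hx.
Qed.

(* The automorphisms form a compact space: take the limit of the [tau e] along an
   ultrafilter refining inclusion of finite sets [e]. *)
Lemma galois_compact (A : L -> L -> Prop) :
    (forall e : seq L, exists s : galois_group iota, forall y, y \in e -> A y (s y)) ->
  exists s : galois_group iota, forall y, A y (s y).
Proof.
move=> /choice[tau tauP].
pose F : set_system (seq L) := [set B | exists e : seq L, forall e' : seq L,
  {subset e <= e'} -> B e'].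
have FF : ProperFilter F.
  split; first by case=> e He; exact: (He e).
  split; first by exists [::].
  - move=> B C [e eB] [f fC]; exists (e ++ f) => e' sub; split.
      by apply: eB => y ye; apply: sub; rewrite mem_cat ye.
    by apply: fC => y ye; apply: sub; rewrite mem_cat ye orbT.
  - by move=> B C BC [e eB]; exists e => e' /eB /BC.
have [U [UU FU]] := ultraFilterLemma FF.
have Uex B : U B -> exists e, B e by exact: filter_ex.
(* A function with finitely many values is constant on a member of an ultrafilter; the values
   [tau e x] are roots of one polynomial. *)
have Ufin (s : seq L) (t : seq L -> L) : U [set e | t e \in s] ->
    exists v, U [set e | t e = v].
  elim: s => [|v s IHs] Us; first by have [] := Uex _ Us.
  have [Uv|Uv] := in_ultra_setVsetC [set e | t e = v] UU; first by exists v.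
  apply: IHs; apply: filterS2 Us Uv => e /=.
  by rewrite inE => /orP[/eqP ->|].
have /choice[f fU] x : exists v, U [set e | tau e x = v].
  have [s [xs sP]] := algebraic_roots x; apply: (Ufin s).
  apply: filterS filterT => e _ /=; apply: sP => //.
  - exact: rmorphB.
  - by split; [exact: rmorph1|exact: rmorphM].
  - exact: gal_fix.
have fK k : f (iota k) = iota k.
  by have [e /= <-] := Uex _ (fU (iota k)); rewrite gal_fix.
have fB : zmod_morphism f.
  move=> x y; have [e [/= [<- <-] <-]] := Uex _ (filterI (filterI (fU (x - y)) (fU x)) (fU y)).
  exact: rmorphB.
have fM : monoid_morphism f.
  split=> [|x y]; first by have := fK 1; rewrite rmorph1.
  have [e [/= [<- <-] <-]] := Uex _ (filterI (filterI (fU (x * y)) (fU x)) (fU y)).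
  exact: rmorphM.
have fA : is_automorphism_over iota f by split=> //; exact: endomorphism_bij.
exists (GaloisElement fA) => y /=.
have Uy : U [set e : seq L | y \in e] by apply: FU; exists [:: y] => e /(_ y); apply; rewrite mem_head.
have [e [/= <- ye]] := Uex _ (filterI (fU y) Uy).
exact: tauP.
Qed.

End Extension.

(** * Frobenius elements *)

Lemma int_map_zmod (E F : fieldType) (f : {rmorphism E -> F}) : zmod_morphism (int_map f).
Proof. by move=> x y; apply: int_val_inj => /=; rewrite !rmorphB. Qed.

Lemma int_map_monoid (E F : fieldType) (f : {rmorphism E -> F}) : monoid_morphism (int_map f).
Proof.
split=> [|x y]; apply: int_val_inj => /=; first by rewrite !rmorph1.
by rewrite !rmorphM.
Qed.

HB.instance Definition _ (E F : fieldType) (f : {rmorphism E -> F}) :=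
  GRing.isZmodMorphism.Build _ _ (int_map f) (int_map_zmod f).
HB.instance Definition _ (E F : fieldType) (f : {rmorphism E -> F}) :=
  GRing.isMonoidMorphism.Build _ _ (int_map f) (int_map_monoid f).

Lemma int_map_inj (E F : fieldType) (f : {rmorphism E -> F}) : injective (int_map f).
Proof. by move=> x y /(congr1 (@int_val F))/= /fmorph_inj/int_val_inj. Qed.

(* Gauss's lemma modulo [Q]. *)
Lemma prime_polyM (F : fieldType) (Q : prime_of F) (f g : {poly ring_of_integers F}) :
  (forall i, (f * g)`_i \in prime_ideal Q) ->
  (forall i, f`_i \in prime_ideal Q) \/ (forall i, g`_i \in prime_ideal Q).
Proof.
move=> fg; apply: contrapT => /not_orP[/existsNP[i0 /negP fi0] /existsNP[j0 /negP gj0]].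
have exf : exists i, f`_i \notin prime_ideal Q by exists i0.
have exg : exists j, g`_j \notin prime_ideal Q by exists j0.
case: (ex_minnP exf) => i fi imin; case: (ex_minnP exg) => j gj jmin.
have : f`_i * g`_j \notin prime_ideal Q by rewrite primeM negb_or fi gj.
apply/negP/negPn; have := fg (i + j)%N; rewrite coefM.
have iij : (i < (i + j).+1)%N by rewrite ltnS leq_addr.
rewrite (bigD1 (Ordinal iij))//= addKn => H.
rewrite -[X in X \in _](addrK (\sum_(k < (i + j).+1 | k != Ordinal iij) f`_k * g`_(i + j - k))).
apply: rpredB => //; apply: rpred_sum => k /eqP ki.
have [lt|gt|eq] := ltngtP k i; last by case: ki; exact: val_inj.
  by apply: (@primeMl _ Q); apply: contraTT lt => /imin; rewrite -leqNgt.
apply: (@primeMr _ Q); apply: contraTT gt => /jmin; rewrite -leqNgt.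
by have := ltn_ord k; lia.
Qed.

Lemma prime_poly_prod (F : fieldType) (Q : prime_of F)
    (s : seq {poly ring_of_integers F}) :
  (forall i, (\prod_(h <- s) h)`_i \in prime_ideal Q) ->
  exists2 h, h \in s & forall i, h`_i \in prime_ideal Q.
Proof.
elim: s => [|h s IHs]; first by move/(_ 0%N); rewrite big_nil coef1 prime1.
rewrite big_cons => /prime_polyM[hQ|/IHs[h' h's h'Q]].
  by exists h => //; rewrite mem_head.
by exists h' => //; rewrite inE h's orbT.
Qed.

Lemma fermat_int (p : nat) (a : int) : prime p -> (p %| a ^+ p - a)%Z.
Proof.
move=> p_pr; rewrite -(intr_Fp_eq0 _ p_pr) rmorphB rmorphXn/= subr_eq0.
by apply/eqP; exact: (rmorph_int (pFrobenius_aut (pchar_Fp p_pr))).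
Qed.

Section Orbit.
Variables (K : fieldExtType rat) (L : closedFieldType) (iota : {rmorphism K -> L}).
Hypothesis algL : forall x : L, algebraicOver iota x.
Local Notation OK := (ring_of_integers K).
Local Notation OL := (ring_of_integers L).
Local Notation G := (galois_group iota).

Definition gal_poly (s : G) : {poly OL} -> {poly OL} := map_poly (int_map s).

HB.instance Definition _ (s : G) :=
  GRing.RMorphism.copy (gal_poly s) (map_poly (int_map s)).

Lemma gal_poly_inj s : injective (gal_poly s).
Proof. by apply: map_inj_poly; [exact: int_map_inj|rewrite rmorph0]. Qed.

Lemma gal_polyM s t h : gal_poly (s * t)%g h = gal_poly s (gal_poly t h).
Proof.
rewrite /gal_poly -map_poly_comp; apply: eq_map_poly => x.
exact: int_val_inj.
Qed.

Lemma galois_orbit_finite (Y : {poly OL}) : exists l : seq {poly OL},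
  forall s : G, gal_poly s Y \in l.
Proof.
elim/poly_ind: Y => [|Y c [l lP]].
  by exists [:: 0] => s; rewrite /gal_poly rmorph0 mem_head.
have [r [cr rP]] := algebraic_roots algL (int_val c).
exists [seq h * 'X + e%:P | h <- l, e <- pmap insub r] => s.
rewrite /gal_poly rmorphD rmorphM/= map_polyX map_polyC/=.
apply/allpairsP; exists (gal_poly s Y, int_map s c); split=> //=.
rewrite mem_pmap_sub /=; apply: rP => //.
- exact: rmorphB.
- by split; [exact: rmorph1|exact: rmorphM].
- exact: gal_fix.
Qed.

Lemma galois_orbit (Y : {poly OL}) : exists l : seq {poly OL}, uniq l /\
  forall h, h \in l <-> exists s : G, h = gal_poly s Y.
Proof.
have [l lP] := galois_orbit_finite Y.
exists [seq h <- undup l | `[< exists s : G, h = gal_poly s Y >]].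
rewrite filter_uniq ?undup_uniq//; split=> // h; rewrite mem_filter mem_undup.
split=> [/andP[/asboolP]//|[s hs]]; apply/andP; split; last by rewrite hs.
by apply/asboolP; exists s.
Qed.

Lemma integral_fixed (x : OL) : (forall s : G, int_map s x = x) ->
  exists k : OK, x = int_map iota k.
Proof.
move=> fx; have [k kE] : exists k, int_val x = iota k.
  by apply: (fixed_field algL) => s; have /(congr1 (@int_val L)) := fx s.
have kI : k \in integral_elements K.
  have /asboolP[q qm qx] := int_valP x; apply/asboolP; exists q => //.
  rewrite -(fmorph_root iota) -map_poly_comp -kE.
  by rewrite (eq_map_poly (g := intr))// => z /=; rewrite rmorph_int.
by exists (RingOfIntegers kI); exact: int_val_inj.
Qed.

(* The coefficients of the polynomial of the orbit of [Y] are fixed by Galois. *)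
Lemma orbit_poly_coef (Y : {poly OL}) (l : seq {poly OL}) : uniq l ->
    (forall h, h \in l <-> exists s : G, h = gal_poly s Y) ->
  forall i j, exists k : OK,
    ((\prod_(h <- l) ('X - h%:P))`_i)`_j = int_map iota k.
Proof.
move=> ul lP i j; apply: integral_fixed => s.
set Phi := \prod_(h <- l) _; rewrite -[LHS]coef_map -[map_poly _ _]/(gal_poly s _) -coef_map.
suff -> : map_poly (gal_poly s) Phi = Phi by [].
have usl : uniq (map (gal_poly s) l) by rewrite map_inj_uniq//; exact: gal_poly_inj.
have sub : {subset map (gal_poly s) l <= l}.
  move=> _ /mapP[h /lP[t ->] ->]; apply/lP; exists (s * t)%g.
  by rewrite gal_polyM.
have [_ eql] := uniq_min_size usl sub (eq_leq (esym (size_map _ _))).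
transitivity (\prod_(h <- map (gal_poly s) l) ('X - h%:P)).
  rewrite big_map rmorph_prod; apply: eq_bigr => h _.
  by rewrite rmorphB/= map_polyX map_polyC.
by apply: perm_big; apply: uniq_perm => // h; rewrite eql.
Qed.

Lemma coef_poly_seq (s : seq OL) u : u \in s -> exists i, (Poly s)`_i = u.
Proof. by move=> us; exists (index u s); rewrite coef_Poly nth_index. Qed.

Lemma seq_int_val (e : seq L) (u : OL) : (u \in pmap insub e) = (int_val u \in e).
Proof. exact: mem_pmap_sub. Qed.

(** Take finitely many elements of [Q] as coefficients of [Y]. The product of the [- h] over the
    orbit of [Y] has coefficients in [Q] that come from [K], hence lie in [Q']; by Gauss's lemma
    some conjugate of [Y] has all its coefficients in [Q']. Compactness passes to all of [Q]. *)
Lemma gal_transitive (P : prime_of K) (Q Q' : prime_of L) :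
    lies_over iota Q P -> lies_over iota Q' P ->
  exists s : G, forall u : OL, u \in prime_ideal Q -> int_map s u \in prime_ideal Q'.
Proof.
move=> QP Q'P.
(* [galois_compact] quantifies over [L]; the condition is empty at elements that are not
   integral. *)
pose A (y z : L) := forall u v : OL, int_val u = y -> int_val v = z ->
  u \in prime_ideal Q -> v \in prime_ideal Q'.
suff [s sA] : exists s : G, forall y, A y (s y).
  by exists s => u uQ; apply: (sA (int_val u)) uQ.
apply: (galois_compact algL) => e.
pose us : seq OL := [seq u <- pmap insub e | u \in prime_ideal Q].
pose Y : {poly OL} := Poly us; have [l [ul lP]] := galois_orbit Y.
have YQ i : Y`_i \in prime_ideal Q.
  rewrite coef_Poly; have [i_us|i_us] := ltnP i (size us); last by rewrite nth_default ?prime0.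
  by have := mem_nth 0 i_us; rewrite mem_filter => /andP[].
have Yl : Y \in l.
  by apply/lP; exists 1%g; apply/polyP => i; rewrite coef_map; exact: int_val_inj.
have PhiE : (\prod_(h <- l) ('X - h%:P))`_0 = \prod_(h <- l) (- h).
  rewrite -horner_coef0 horner_prod; apply: eq_bigr => h _.
  by rewrite hornerXsubC sub0r.
have PhiQ i : (\prod_(h <- l) (- h))`_i \in prime_ideal Q.
  rewrite (big_rem Y)//= mulNr coefN rpredN coefM.
  by apply: rpred_sum => j _; apply: (@primeMl _ Q).
have PhiQ' i : (\prod_(h <- map (fun h => - h) l) h)`_i \in prime_ideal Q'.
  rewrite big_map -PhiE; have [k kE] := orbit_poly_coef ul lP 0 i.
  by rewrite kE Q'P -QP -kE PhiE.
have [_ /mapP[h hl ->] hQ'] := prime_poly_prod PhiQ'.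
have [s hE] := (lP h).1 hl; exists s => y ye u v uy vy uQ.
have [i iE] : exists i, Y`_i = u.
  by apply: coef_poly_seq; rewrite mem_filter uQ seq_int_val uy.
have -> : v = int_map s u by apply: int_val_inj; rewrite /= uy.
by have := hQ' i; rewrite hE coefN rpredN coef_map iE.
Qed.

Lemma residue_pchar (F : fieldType) (Q : prime_of F) (p : nat) : prime p -> lies_above Q p ->
  p \in [pchar (residue_field Q)].
Proof.
move=> p_pr Qp; rewrite inE p_pr/= -(rmorph_nat (\pi_(residue_field Q))).
by rewrite -(rmorph0 (\pi_(residue_field Q))) -Quotient.idealrBE subr0.
Qed.

Lemma lies_over_above (P : prime_of K) (Q : prime_of L) (p : nat) :
  lies_over iota Q P -> lies_above P p -> lies_above Q p.
Proof. by move=> QP; rewrite /lies_above -(rmorph_nat (int_map iota)) QP. Qed.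

(* Frobenius of the residue field fixes the reduction of the orbit polynomial of
   [Y], so it maps the root [Y] to another root. *)
Lemma frobenius_exists (P : prime_of K) (Q : prime_of L) :
    lies_over iota Q P -> inertia_degree P = 1%N ->
  exists s : G, is_frobenius Q P s.
Proof.
move=> QP f1; pose p := residue_char P.
have [p_pr Pp] := residue_charP P; have Qp := lies_over_above QP Pp.
have NP : prime_norm P = p by rewrite /prime_norm f1 expn1.
have charp := residue_pchar p_pr Qp.
pose A (y z : L) := forall u v : OL, int_val u = y -> int_val v = z ->
  v - u ^+ p \in prime_ideal Q.
suff [s sA] : exists s : G, forall y, A y (s y).
  by exists s; split=> // u; rewrite NP; apply: (sA (int_val u)).
apply: (galois_compact algL) => e.
pose us : seq OL := pmap insub e.
pose Y : {poly OL} := Poly us; have [l [ul lP]] := galois_orbit Y.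
pose W : {poly OL} := \poly_(i < size Y) Y`_i ^+ p.
have WE i : W`_i = Y`_i ^+ p.
  by rewrite coef_poly; case: ltnP => // iY; rewrite nth_default// expr0n gtn_eqF ?prime_gt0.
have Yl : Y \in l.
  by apply/lP; exists 1%g; apply/polyP => i; rewrite coef_map; exact: int_val_inj.
pose pi : {rmorphism OL -> residue_field Q} := \pi_(residue_field Q).
pose Fr : {rmorphism residue_field Q -> residue_field Q} := pFrobenius_aut charp.
pose Phi := \prod_(h <- l) ('X - h%:P).
(* A coefficient [k] comes from the integers of [K] and, as [f = 1], is congruent to an integer [a]
   modulo [P]; Fermat's little theorem gives [k^p = k] modulo [P]. *)
have PhiFr : map_poly (map_poly Fr) (map_poly (map_poly pi) Phi) = map_poly (map_poly pi) Phi.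
  apply/polyP => i; rewrite !coef_map; apply/polyP => j; rewrite !coef_map /=.
  have [k kE] := orbit_poly_coef ul lP i j; rewrite kE pFrobenius_autE -rmorphXn/=.
  apply/eqP; rewrite -subr_eq0 -rmorphB pi_residue_eq0 -rmorphXn -rmorphB QP.
  have [a aP] := degree1_int_mod k f1.
  have -> : k ^+ p - k = (k ^+ p - a%:~R ^+ p) + (a ^+ p - a)%:~R - (k - a%:~R).
    have aux (x y z w : OK) : x - z = (x - y) + (y - w) - (z - w) by ring.
    by rewrite rmorphB rmorphXn/=; exact: aux.
  rewrite rpredB// rpredD//; first by rewrite subrXX; apply: (@primeMl _ P).
  by rewrite (prime_intE _ p_pr Pp) fermat_int.
have Phi0 : (map_poly (map_poly pi) Phi).[map_poly pi Y] = 0.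
  rewrite horner_map -[RHS](rmorph0 (map_poly pi)); congr (map_poly _ _).
  by rewrite /Phi horner_prod (big_rem Y)//= !hornerE subrr mul0r.
have PhiW : map_poly pi Phi.[W] = 0.
  have -> : map_poly pi Phi.[W] = map_poly Fr (map_poly (map_poly pi) Phi).[map_poly pi Y].
    rewrite -[RHS]horner_map PhiFr -[LHS]horner_map; congr (_ .[_]).
    by apply/polyP => i; rewrite !coef_map/= WE pFrobenius_autE rmorphXn.
  by rewrite Phi0 rmorph0.
have WQ i : (\prod_(h <- [seq W - h | h <- l]) h)`_i \in prime_ideal Q.
  have prodE : \prod_(h <- l) (W - h) = \prod_(h <- l) ('X - h%:P).[W].
    by apply: eq_bigr => h _; rewrite hornerXsubC.
  rewrite big_map prodE -pi_residue_eq0; have /(congr1 (fun g : {poly residue_field Q} => g`_i)) := PhiW.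
  by rewrite coef_map coef0 /Phi horner_prod => H; apply/eqP.
have [_ /mapP[h hl ->] hQ] := prime_poly_prod WQ.
have [s hE] := (lP h).1 hl; exists s => y ye u v uy vy.
have [i iE] : exists i, Y`_i = u by apply: coef_poly_seq; rewrite seq_int_val uy.
have -> : v = int_map s u by apply: int_val_inj; rewrite /= uy.
by have := hQ i; rewrite hE coefB WE coef_map iE -rpredN opprB.
Qed.

(** [Q] is maximal among the ideals that avoid the image of the complement of [P], so it contracts
    into [P]. If some [a] in [P] were outside [Q], maximality would give [c] outside [P] congruent
    to [v a] modulo [Q], and the integral equation of [v] would force [c^d] into [P]. *)
Lemma lies_over_exists (P : prime_of K) : exists Q : prime_of L, lies_over iota Q P.
Proof.
pose S : {pred OL} := fun x => `[< exists2 c, x = int_map iota c & c \notin prime_ideal P >].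
have [||a|||x|Q0 [Qi Qp _ QS Qmax]] := @exists_prime_avoiding L (pred1 0) S.
- by rewrite inE.
- by move=> x y; rewrite !inE => /eqP -> /eqP ->; rewrite subr0.
- by move=> x; rewrite !inE => /eqP ->; rewrite mulr0.
- by apply/asboolP; exists 1; rewrite ?rmorph1// prime1.
- move=> _ _ /asboolP[c -> cP] /asboolP[d -> dP]; apply/asboolP; exists (c * d).
    by rewrite rmorphM.
  by rewrite primeM negb_or cP.
- rewrite inE => /eqP ->; apply/asboolPn => -[c c0]; apply/negP/negPn.
  suff -> : c = 0 by exact: prime0.
  by apply: (@int_map_inj _ _ iota); rewrite -c0 rmorph0.
have QP c : int_map iota c \in Q0 -> c \in prime_ideal P.
  by move=> /QS /asboolPn cS; apply: contrapT => /negP cP; apply: cS; exists c.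
have PQ a : a \in prime_ideal P -> int_map iota a \in Q0.
  have Q0ideal := Qi; case: (Qi) => Q00 Q01 QD.
  move=> aP; apply: contraT => /Qmax[u [v [uQ /asboolP[c cE cP]]]].
  have QB x y : x \in Q0 -> y \in Q0 -> x - y \in Q0.
    by move=> xQ yQ; rewrite addrC -mulN1r; exact: QD.
  have QM b x : x \in Q0 -> b * x \in Q0.
    by move=> xQ; rewrite -[b * x]addr0; exact: QD.
  have QN x y : x \in Q0 -> y \in Q0 -> x + y \in Q0.
    by move=> xQ yQ; rewrite -[x]mul1r; exact: QD.
  have [q qm qv] := integral_root v.
  pose d := (size q).-1; have qs : size q = d.+1.
    by rewrite prednK// size_poly_gt0 monic_neq0.
  (* The terms of the integral equation of [v], multiplied by [a^d] and with [c] in place of [v a],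
     to which it is congruent modulo [Q0]. *)
  pose w i := (q`_i)%:~R * a ^+ (d - i) * c ^+ i : OK.
  have : int_map iota (\sum_(i < d.+1) w i) \in Q0.
    have qv0 : \sum_(i < d.+1) (q`_i)%:~R * int_map iota a ^+ (d - i) * (v * int_map iota a) ^+ i = 0.
      transitivity (int_map iota a ^+ d * (map_poly intr q).[v]); last by rewrite qv mulr0.
      rewrite (@horner_coef_wide _ d.+1) ?(leq_trans (size_poly _ _)) ?qs//.
      rewrite mulr_sumr; apply: eq_bigr => i _; rewrite coef_map/= exprMn.
      have -> : int_map iota a ^+ d = int_map iota a ^+ (d - i) * int_map iota a ^+ i.
        by rewrite -exprD subnK// -ltnS.
      have aux (x y z t : OL) : x * y * (z * t) = y * t * (x * z) by ring.
      exact: aux.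
    rewrite rmorph_sum -[X in X \in _]subr0 -[X in _ - X]qv0 -sumrB.
    elim/big_ind: _ => [//|x y|i _]; first exact: QN.
    rewrite !rmorphM/= rmorph_int !rmorphXn -mulrBr; apply: (QM).
    rewrite subrXX mulrC; apply: (QM).
    by rewrite [X in X - _](esym cE) addrK.
  move=> /QP; rewrite big_ord_recr/= => H.
  have wd : w d = c ^+ d.
    have := monicP qm; rewrite /lead_coef -/d => qd.
    by rewrite /w subnn expr0 mulr1 qd mul1r.
  have : c ^+ d \in prime_ideal P.
    rewrite -wd -(addKr (\sum_(i < d) w i) (w d)) rpredD// rpredN.
    apply: rpred_sum => i _; rewrite /w; apply: (@primeMl _ P); apply: (@primeMr _ P).
    by rewrite primeX aP subn_gt0 ltn_ord.
  by rewrite primeX (negPf cP) andbF.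
have Q0n : exists2 x : OL, x \in Q0 & x != 0.
  have [a aP a0] := prime_neq0 P; exists (int_map iota a); first exact: PQ.
  by apply: contra_neq a0 => a0; apply: (@int_map_inj _ _ iota); rewrite a0 rmorph0.
exists (PrimeOf Qi Qp Q0n) => c /=.
by apply/idP/idP; [exact: QP|exact: PQ].
Qed.

End Orbit.

(** * Characters *)

(* If [H1 .. Hr] cover and some [x] lies in [H1] only, then for [y] outside [H1]
   the [l] elements [x ^ k * y] lie in the other [r - 1 < l] subgroups, so two of
   them share a subgroup, which then contains [x]. *)
Lemma subgroup_cover (X : groupType) (T : eqType) (l : nat) (U : set X)
    (H : T -> set X) (r : seq T) : prime l -> (size r <= l)%N ->
    (forall x, U x -> (x ^+ l = 1)%g) ->
    U 1%g -> (forall x y, U x -> U y -> U (x * y)%g) ->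
    (forall i, i \in r -> H i 1%g) ->
    (forall i x y, i \in r -> H i x -> H i y -> H i (x * y)%g) ->
    (forall i x, i \in r -> H i x -> H i (x^-1)%g) ->
    (forall x, U x -> exists2 i, i \in r & H i x) ->
  exists2 i, i \in r & forall x, U x -> H i x.
Proof.
move=> l_pr + Ul U1 UM; have l0 := prime_gt0 l_pr.
elim: r => [|i r IHr] /= rl H1 HM HV cov; first by have [] := cov _ U1.
have [all|] := pselect (forall x, U x -> exists2 j, j \in r & H j x).
  have sub j : j \in r -> j \in i :: r by move=> jr; rewrite inE jr orbT.
  have [|||j jr Hj] := IHr (ltnW rl) _ _ _ all.
  - by move=> j /sub /H1.
  - by move=> j x y /sub /HM; apply.
  - by move=> j x /sub /HV; apply.
  by exists j => //; exact: sub.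
move=> /existsNP[x /not_implyP[Ux xr]].
have Hix : H i x.
  have [j] := cov x Ux; rewrite inE => /orP[/eqP -> //|jr Hj].
  by case: xr; exists j.
exists i; first exact: mem_head.
move=> y Uy; apply: contrapT => Hiy.
have HX j z k : j \in i :: r -> H j z -> H j (z ^+ k)%g.
  move=> jr Hz; elim: k => [|k IHk]; first by rewrite expg0; exact: H1.
  by rewrite expgS; exact: HM.
have UX z k : U z -> U (z ^+ k)%g.
  by move=> Uz; elim: k => [|k IHk]; rewrite ?expg0// expgS; exact: UM.
have /choice[j jP] (k : 'I_l) : exists j, j \in r /\ H j (x ^+ k * y)%g.
  have [j] := cov _ (UM _ _ (UX x k Ux) Uy); rewrite inE => /orP[/eqP ->|jr Hj]; last by exists j.
  move=> Hk; case: Hiy; rewrite -[y](mulKg (x ^+ k)%g).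
  have ir := mem_head i r.
  by apply: HM => //; apply: HV => //; apply: HX.
have : ~ injective j.
  move=> jinj; have : uniq (codom j) by rewrite map_inj_uniq ?enum_uniq.
  move=> /(@uniq_leq_size _ _ r); rewrite size_codom card_ord => lr.
  have : (l <= size r)%N by apply: lr => _ /codomP[k ->]; exact: (jP k).1.
  by rewrite leqNgt rl.
apply => k1 k2 jk; apply: contrapT => k12.
wlog lt12 : k1 k2 jk k12 / (k1 < k2)%N.
  move=> W; have [lt|lt|/val_inj//] := ltngtP k1 k2; first exact: (W k1 k2).
  by apply: (W k2 k1) => // /esym.
have [j1r Hj1] := jP k1; have [_ Hj2] := jP k2; rewrite -jk in Hj2.
have jr : j k1 \in i :: r by rewrite inE j1r orbT.
pose d := (k2 - k1)%N.
have Hd : H (j k1) (x ^+ d)%g.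
  have -> : (x ^+ d = x ^+ k2 * y * (x ^+ k1 * y)^-1)%g.
    by rewrite invgM mulgA mulgK expgnFr// ltnW.
  by apply: HM => //; exact: HV.
have d0 : (0 < d)%N by rewrite subn_gt0.
have dl : coprime d l.
  rewrite coprime_sym prime_coprime// gtnNdvd//.
  by rewrite (leq_ltn_trans (leq_subr _ _)).
have [u v uv _] := egcdnP l d0; rewrite (eqP dl) in uv.
apply: xr; exists (j k1) => //.
have -> : x = ((x ^+ d) ^+ u)%g.
  by rewrite -expgnA mulnC uv expgnDr mulnC expgnA Ul// expg1n mul1g expg1.
exact: HX.
Qed.

Lemma exprB_pchar (A : comNzRingType) (p n : nat) (u v : A) :
  p \in [pchar A] -> p.-nat n -> (u - v) ^+ n = u ^+ n - v ^+ n.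
Proof.
move=> charp pn; have An : [pchar A].-nat n by apply: sub_in_pnat pn => z _ /eqnP ->.
by rewrite exprDn_pchar// exprNn_pchar.
Qed.

Section Characters.
Variables (R : realType) (K : fieldExtType rat) (L : closedFieldType).
Variable iota : {rmorphism K -> L}.
Hypothesis algL : forall x : L, algebraicOver iota x.
Local Notation G := (galois_group iota).
Local Notation OL := (ring_of_integers L).
Implicit Types (chi : dirichlet_character R iota) (P : prime_of K).

Lemma char_mulE chi psi s : (chi * psi)%g s = chi s * psi s. Proof. by []. Qed.
Lemma char_oneE s : (1%g : dirichlet_character R iota) s = 1. Proof. by []. Qed.
Lemma char_invE chi s : (chi^-1)%g s = (chi s)^-1. Proof. by []. Qed.

Lemma char_expE chi k s : (chi ^+ k)%g s = chi s ^+ k.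
Proof. by elim: k => [|k IHk]; rewrite ?expg0// expgS char_mulE IHk exprS. Qed.

Lemma charM chi s t : chi (s * t)%g = chi s * chi t.
Proof. by have [_ + _] := char_funP chi; apply. Qed.

(** Let [tau] carry [Q] to [Q'] and define [t] by [s' t tau = tau s]; it is enough that [t] lies in
    the inertia group of [Q']. Modulo [Q'] both [(t x)^q] and [x^q] agree with [s' (t x)], and since
    [q] is a power of the residue characteristic, [(t x - x)^q] lies in [Q']. *)
Lemma frobenius_char_uniq chi P (Q Q' : prime_of L) (s s' : G) :
  char_unramified chi P -> is_frobenius Q P s -> is_frobenius Q' P s' ->
  chi s = chi s'.
Proof.
move=> chiP [QP sP] [Q'P s'P].
have [tau tauQ] := gal_transitive algL QP Q'P.
have [t tE] : exists t : G, (s' * t * tau = tau * s)%g.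
  by exists (s'^-1 * (tau * s * tau^-1))%g; rewrite mulVKg mulgVK.
suff tI : inertia_group Q' t.
  have := congr1 chi tE; rewrite !charM (chiP _ _ Q'P tI) mulr1 mulrC.
  by move/(mulfI (char_neq0 _ _)).
move=> x; have [p_pr Pp] := residue_charP P.
have charp := residue_pchar p_pr (lies_over_above Q'P Pp).
set q := prime_norm P in sP s'P *.
have qnat : (residue_char P).-nat q by rewrite /q /prime_norm pnatX pnat_id.
have [y xE] : exists y, x = int_map tau y.
  exists (int_map (tau^-1)%g x); apply: int_val_inj => /=.
  by rewrite gal_Kinv.
have stx : int_map s' (int_map t x) = int_map tau (int_map s y).
  rewrite xE; apply: int_val_inj => /=.
  by have := congr1 (fun u : G => u (int_val y)) tE.
have H : int_map t x ^+ q - x ^+ q \in prime_ideal Q'.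
  have -> : int_map t x ^+ q - x ^+ q = int_map tau (int_map s y - y ^+ q)
      - (int_map s' (int_map t x) - int_map t x ^+ q).
    by rewrite stx rmorphB rmorphXn/= -xE opprB [RHS]addrC addrA subrK.
  by apply: rpredB; [exact/tauQ/sP|exact: s'P].
have q0 : (0 < q)%N by rewrite ltnW// prime_norm_gt1.
have E : \pi_(residue_field Q') ((int_map t x - x) ^+ q) =
    \pi_(residue_field Q') (int_map t x ^+ q - x ^+ q).
  by rewrite rmorphXn !rmorphB !rmorphXn; exact: (exprB_pchar _ _ charp qnat).
by move: H; rewrite -pi_residue_eq0 -E pi_residue_eq0 primeX => /andP[].
Qed.

Lemma char_at_frobenius chi P (Q : prime_of L) (s : G) :
  char_unramified chi P -> is_frobenius Q P s -> char_at chi P = chi s.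
Proof.
move=> chiP Qs; rewrite /char_at; case: xgetP => [z _ [_ [Q' [s' [Qs' ->]]]]|/(_ (chi s))[]].
  exact: frobenius_char_uniq chiP Qs' Qs.
by split=> //; exists Q, s.
Qed.

Lemma char_at_neq0 chi P : char_at chi P != 0 ->
  char_unramified chi P /\ exists (Q : prime_of L) (s : G), is_frobenius Q P s.
Proof.
rewrite /char_at; case: xgetP => [z _ [chiP [Q [s [Qs _]]]] _|_]; last by rewrite eqxx.
by split=> //; exists Q, s.
Qed.

Lemma char_unramified1 P : char_unramified (1%g : dirichlet_character R iota) P.
Proof. by []. Qed.

Lemma char_unramifiedM chi psi P : char_unramified chi P -> char_unramified psi P ->
  char_unramified (chi * psi)%g P.
Proof. by move=> c p Q s QP sI; rewrite char_mulE (c Q s) ?(p Q s)// mulr1. Qed.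

Lemma char_unramifiedV chi P : char_unramified chi P -> char_unramified (chi^-1)%g P.
Proof. by move=> c Q s QP sI; rewrite char_invE (c Q s)// invr1. Qed.

Lemma primes_over_seq (p : nat) : prime p -> exists r : seq (prime_of K),
  [/\ uniq r, (size r <= \dim {:K})%N & forall P, (P \in r) <-> lies_above P p].
Proof.
move=> p_pr; pose D m := `[< exists r : seq (prime_of K),
  [/\ uniq r, size r = m & forall P, P \in r -> lies_above P p] >].
have D0 : exists m, D m by exists 0%N; apply/asboolP; exists [::].
have Dn m : D m -> (m <= \dim {:K})%N.
  by move=> /asboolP[r [ur <- rp]]; exact: primes_over_leq_dim p_pr ur rp.
case: (ex_maxnP D0 Dn) => m /asboolP[r [ur rm rp]] mmax; exists r; split=> //.
  by rewrite rm; apply: Dn; apply/asboolP; exists r.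
move=> P; split; first exact: rp.
move=> Pp; apply: contraT => Pr; have := mmax m.+1; rewrite ltnn; apply.
apply/asboolP; exists (P :: r); rewrite /= Pr ur rm; split=> // P'.
by rewrite inE => /orP[/eqP ->|/rp].
Qed.

Lemma L_factor_seq (p : nat) chi (r : seq (prime_of K)) : uniq r ->
  (forall P, (P \in r) <-> lies_above P p) ->
  L_factor p chi = \prod_(P <- r) (1 - (char_at chi P) *: 'X^(inertia_degree P)).
Proof.
move=> ur rp; rewrite /L_factor (_ : [set P | _] = [set` r]); first by rewrite -fsbig_seq.
by apply/seteqP; split=> P /=; rewrite rp.
Qed.

(** Characters commute, so those killed by [l] form a subgroup, and it contains the generators. *)
Lemma order_part_exp (l : nat) (chi : order_part_group R iota l) : (chi ^+ l = 1)%g.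
Proof.
apply: val_inj; suff H s : order_part_val chi s ^+ l = 1.
  by apply: char_ext => s; rewrite -[RHS](H s) -char_expE; congr (char_fun _ s); rewrite gmulfXn.
have /asboolP := order_part_valP chi.
pose H : {pred dirichlet_character R iota} := fun c => `[< forall s, c s ^+ l = 1 >].
have Hc : group_closed H.
  split=> [|c d /asboolP cl /asboolP dl]; apply/asboolP => t; first by rewrite char_oneE expr1n.
  by rewrite char_mulE char_invE exprMn exprVn cl dl divr1.
have Hg c : has_order l c -> c \in H.
  by move=> [_ cl _]; apply/asboolP => t; rewrite -char_expE cl.
by move=> /(_ H Hc Hg) /asboolP; apply.
Qed.

End Characters.

(** * From divisibility of local factors to a map on primes *)

Section Transfer.
Variables (R : realType) (K K' : fieldExtType rat) (L L' : closedFieldType).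
Variables (iota : {rmorphism K -> L}) (iota' : {rmorphism K' -> L'}).
Hypothesis algL : forall x : L, algebraicOver iota x.
Hypothesis algL' : forall x : L', algebraicOver iota' x.
Variables (l : nat) (psi : {multiplicative order_part_group R iota l ->
                           order_part_group R iota' l}).
Hypotheses (l_prime : prime l) (l_gt : (\dim {:K'} < l)%N).
Hypothesis psiL : Hom_L_series R iota iota' l psi.
Local Notation G := (galois_group iota).
Local Notation G' := (galois_group iota').

Lemma exists_matching_prime (P : prime_of K) : inertia_degree P = 1%N ->
  exists P' : prime_of K', contraction_to_int P = contraction_to_int P' /\
    forall chi : order_part_group R iota l, char_unramified chi P ->
      char_at (psi chi) P' = char_at chi P ^+ inertia_degree P'.
Proof.
move=> fP; have [p_pr Pp] := residue_charP P.
set p := residue_char P in p_pr Pp.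
have [Q QP] := lies_over_exists iota P.
have [s Qs] := frobenius_exists algL QP fP.
have chiPE (chi : order_part_group R iota l) : char_unramified chi P ->
    char_at chi P = order_part_val chi s.
  by move=> chiP; exact (char_at_frobenius algL chiP Qs).
have [r [ur _ rp]] := primes_over_seq K p_pr.
have [r' [ur' r'l r'p]] := primes_over_seq K' p_pr.
pose frobs (P' : prime_of K') :=
  `[< exists (Q' : prime_of L') (s' : G'), is_frobenius Q' P' s' >].
pose U : set (order_part_group R iota l) := [set chi | char_unramified chi P].
(* The value is taken at some Frobenius element; by [frobenius_char_uniq] any other gives the same
   value, which makes [H P'] closed under products. *)
pose H (P' : prime_of K') : set (order_part_group R iota l) :=
  [set chi | char_unramified (psi chi) P' /\
     exists (Q' : prime_of L') (s' : G'), is_frobenius Q' P' s' /\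
       order_part_val (psi chi) s' = order_part_val chi s ^+ inertia_degree P'].
have valM (chi eta : order_part_group R iota' l) t :
    order_part_val (chi * eta)%g t = order_part_val chi t * order_part_val eta t.
  by [].
have valV (chi : order_part_group R iota' l) t :
    order_part_val (chi^-1)%g t = (order_part_val chi t)^-1.
  by [].
have psi1 : (psi 1 = 1)%g by rewrite -[LHS](mulgK (psi 1%g)) -gmulfM mulg1 mulgV.
have psiV chi : (psi chi^-1 = (psi chi)^-1)%g.
  by rewrite -[LHS](mulgK (psi chi)) -gmulfM mulVg psi1 mul1g.
(* Primes without a Frobenius element are filtered out, since for them [H P'] would be empty and not
   a subgroup. *)
have [P' P'r HU] : exists2 P', P' \in [seq P' <- r' | frobs P'] & forall chi, U chi -> H P' chi.
  apply: (@subgroup_cover _ _ l U H) => //.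
  - by rewrite (leq_trans _ (ltnW l_gt))// (leq_trans _ r'l)// size_filter count_size.
  - by move=> chi _; exact: order_part_exp.
  - by move=> chi eta; exact: char_unramifiedM.
  - move=> P'; rewrite mem_filter => /andP[/asboolP[Q' [s' Qs']] _].
    rewrite /H/= psi1; split; first exact: char_unramified1.
    by exists Q', s'; split=> //=; rewrite expr1n.
  - move=> P' chi eta _ [uc [Q1 [s1 [F1 E1]]]] [ue [Q2 [s2 [F2 E2]]]].
    rewrite /H/= gmulfM; split; first exact: char_unramifiedM.
    exists Q1, s1; split=> //; rewrite valM exprMn E1; congr (_ * _).
    by rewrite -E2; exact: (frobenius_char_uniq algL' ue F1 F2).
  - move=> P' chi _ [uc [Q1 [s1 [F1 E1]]]].
    rewrite /H/= psiV; split; first exact: char_unramifiedV.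
    by exists Q1, s1; split=> //; rewrite valV exprVn E1.
  move=> chi chiP; have z0 : char_at chi P != 0 by rewrite chiPE// char_neq0.
  have := psiL p_pr chi; rewrite (L_factor_seq _ ur rp) (L_factor_seq _ ur' r'p).
  have Pr : P \in r by apply/rp.
  rewrite (big_rem P Pr)/= => /(dvdp_trans (dvdp_mulr _ (dvdpp _))) dvd.
  have : root (\prod_(P' <- r') (1 - char_at (psi chi) P' *: 'X^(inertia_degree P')))
      (char_at chi P)^-1.
    by rewrite -dvdp_XsubCl; apply: dvdp_trans dvd; rewrite dvdp_XsubCl rootE fP !hornerE mulfV// subrr.
  rewrite rootE horner_prod prodf_seq_eq0 => /hasP[P' P'r /=].
  rewrite !hornerE exprVn subr_eq0 => /eqP E.
  have zf0 : char_at chi P ^+ inertia_degree P' != 0 by rewrite expf_neq0.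
  have {}E : char_at (psi chi) P' = char_at chi P ^+ inertia_degree P'.
    by apply: (mulIf (invr_neq0 zf0)); rewrite -E mulfV.
  (* The value is nonzero, so [char_at] did not return its default: [psi chi] is unramified at [P']
     and a Frobenius element exists there. *)
  have [|uP' [Q' [s' F']]] := @char_at_neq0 _ _ _ _ (psi chi) P'; first by rewrite E.
  exists P'; first by rewrite mem_filter P'r andbT; apply/asboolP; exists Q', s'.
  split=> //; exists Q', s'; split=> //.
  by rewrite -chiPE// -E (char_at_frobenius algL' uP' F').
exists P'; split.
  have P'p : lies_above P' p by apply/r'p; move: P'r; rewrite mem_filter => /andP[].
  by apply/seteqP; split=> z; rewrite /contraction_to_int/= (prime_intE _ p_pr Pp) (prime_intE _ p_pr P'p).
move=> chi chiP; have [uP' [Q' [s' [F' E]]]] := HU chi chiP.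
by rewrite (char_at_frobenius algL' uP' F') E chiPE.
Qed.

End Transfer.

Theorem theorem5p2 (R : realType) (K K' : fieldExtType rat)
    (L L' : closedFieldType)
    (iota : {rmorphism K -> L}) (iota' : {rmorphism K' -> L'})
    (algL : forall x : L, algebraicOver iota x)
    (algL' : forall x : L', algebraicOver iota' x)
    (l : nat) (l_prime : prime l) (l_gt : (\dim {:K'} < l)%N)
    (psi : {multiplicative order_part_group R iota l ->
                           order_part_group R iota' l}) :
  Hom_L_series R iota iota' l psi -> Hom_density R iota iota' l psi.
Proof.
move=> psiL; exists (degree_one_primes K); split=> //.
  exact: degree_one_primes_density.
have /choice[phi phiP] (P : degree_one_primes K) :
    exists P' : prime_of K', contraction_to_int (val P) = contraction_to_int P' /\
    forall chi : order_part_group R iota l, char_unramified chi (val P) ->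
      char_at (psi chi) P' = char_at chi (val P) ^+ inertia_degree P'.
  apply: (exists_matching_prime algL algL' l_prime l_gt psiL).
  by have [] := set_mem (valP P).
by exists phi => P _; exact: phiP.
Qed.
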